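(* Let $f(x)=\int_0^\infty (1-e^{-xs})\,\overline{\nu}(ds)$, $x>0$, be a Bernstein function whose Lévy measure $\overline{\nu}$ on $(0,\infty)$ satisfies $\int_0^\infty (s\wedge 1)\,\overline{\nu}(ds)<\infty$. Assume that $\overline{\nu}(0,\infty)=\infty$ and that the tail $\nu(s)=\overline{\nu}(s,\infty)$, $s>0$, is absolutely continuous. Let $Y^f$ be the inverse of a subordinator $H^f$ with Laplace exponent $f$, let $l^f(t,\cdot)$ be the density of $Y^f(t)$, and let $\tilde l^f(t,\eta)=\mathsf{E}e^{-\eta Y^f(t)}$ for $\eta\in\mathbb{R}$. Let $S(t)=N_1(t)-N_2(t)$ be a Skellam process, where $N_1,N_2$ are independent homogeneous Poisson processes with intensities $\lambda_1>0$ and $\lambda_2>0$, with $S$ independent of $Y^f$, and let $Z(t)=S(Y^f(t))$, $t\ge 0$. Then: 1. The marginal distribution of $Z(t)$ is given, for $k\in\mathbb{Z}$ and $t>0$, by $$r_k^f(t)=\mathsf{P}\{Z(t)=k\}=\int_0^\infty s_k(u)\,l^f(t,u)\,du,$$ where $s_k(u)=\mathsf{P}\{S(u)=k\}$, and satisfies the system of differential equations $${}^f\mathcal{D}_t\, r_k^f(t)=\lambda_1\left(r_{k-1}^f(t)-r_k^f(t)\right)-\lambda_2\left(r_k^f(t)-r_{k+1}^f(t)\right),\qquad k\in\mathbb{Z},$$ with initial condition $r_0^f(0)=1$ and $r_k^f(0)=0$ for $k\ne 0$. 2. The moment generating function $L(\theta,t)=\mathsf{E}e^{\theta Z(t)}$,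 $\theta\in\mathbb{R}$, is given by $$L(\theta,t)=\tilde l^f\left(t,\lambda_1+\lambda_2-\lambda_1e^{\theta}-\lambda_2e^{-\theta}\right)$$ and satisfies the differential equation $${}^f\mathcal{D}_t\, L(\theta,t)=\left[\lambda_1(e^{\theta}-1)+\lambda_2(e^{-\theta}-1)\right]L(\theta,t)$$ with initial condition $L(\theta,0)=1$.
   Context: Subordinator and inverse: $H^f(t)$, $t\ge0$, is the subordinator with $\mathsf{E}e^{-xH^f(t)}=e^{-tf(x)}$ for $x>0$, and $Y^f(t)=\inf\{s\ge 0: H^f(s)>t\}$. Under the stated conditions on $\overline{\nu}$, for $t>0$ the random variable $Y^f(t)$ has a density $u\mapsto l^f(t,u)$ on $(0,\infty)$, and $\int_0^\infty e^{-rt}l^f(t,u)\,dt=\frac{f(r)}{r}e^{-uf(r)}$, $r>0$ (known fact); thus $\tilde l^f(t,\eta)=\int_0^\infty e^{-\eta u}l^f(t,u)\,du$. Absolute continuity of the tail is understood on $(0,\infty)$, i.e. on compact subintervals. Convolution-type derivative: the generalized Caputo-Djrbashian derivative with respect to $f$ is defined on absolutely continuous functions $w$ by $${}^f\mathcal{D}_t w(t)=\int_0^t \frac{\partial}{\partial t}w(t-s)\,\nu(s)\,ds,\qquad \nu(s)=\overline{\nu}(s,\infty),$$ and in the equations above it acts in the variable $t$, with $t>0$. Skellam distribution: $s_k(u)=e^{-u(\lambda_1+\lambda_2)}\left(\lambda_1/\lambda_2\right)^{k/2}I_{|k|}\left(2u\sqrt{\lambda_1\lambda_2}\right)$, $k\in\mathbb{Z}$,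 where $I_k(z)=\sum_{n\ge0}\frac{(z/2)^{2n+k}}{n!(n+k)!}$ is the modified Bessel function of the first kind. *)

(* Defs.v *)
From HB Require Import structures.
From mathcomp Require Export all_boot all_order all_algebra.
From mathcomp Require Export all_classical all_reals all_analysis.
Export Order.TTheory GRing.Theory Num.Theory.
Export numFieldNormedType.Exports.

Set Implicit Arguments.
Unset Strict Implicit.
Unset Printing Implicit Defensive.

Local Open Scope classical_set_scope.
Local Open Scope ring_scope.

(* Absolute continuity of [w] on the compact interval [a, b]. *)
Definition abs_continuous_on (R : realType) (a b : R) (w : R -> R) : Prop :=
  forall e : R, 0 < e -> exists2 delta : R, 0 < delta &
    forall (n : nat) (x y : 'I_n -> R),
      (forall i, [&& a <= x i, x i <= y i & y i <= b]) ->
      trivIset [set: 'I_n] (fun i => `]x i, y i[%classic) ->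
      \sum_(i < n) (y i - x i) < delta ->
      \sum_(i < n) `|w (y i) - w (x i)| < e.

(* A process is indexed by all of [R]; only times [t >= 0] are ever used.
   Paths are nondecreasing, so right-continuity already makes them cadlag. *)
Section processes.
Context (R : realType) (d : measure_display) (T : measurableType d).
Variable P : probability T R.
Implicit Types X : R -> T -> R.

Definition process_sigma_algebra X : set (set T) :=
  <<s \bigcup_(t in `[0, +oo[)
        preimage_set_system [set: T] (X t) (@measurable _ R) >>.

Definition independent_processes X1 X2 : Prop :=
  forall A B, process_sigma_algebra X1 A -> process_sigma_algebra X2 B ->
    P (A `&` B) = (P A * P B)%E.

Definition independent_increments X : Prop :=
  forall (n : nat) (t : nat -> R) (B : nat -> set R),
    0 <= t 0%N ->
    (forall i, (i < n)%N -> t i <= t i.+1) ->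
    (forall i, (i < n)%N -> measurable (B i)) ->
    P (\bigcap_(i < n) [set w | B i (X (t i.+1) w - X (t i) w)]) =
    (\prod_(i < n) P [set w | B i (X (t i.+1) w - X (t i) w)%R])%E.

Definition stationary_increments X : Prop :=
  forall (s t : R) (B : set R), 0 <= s -> s <= t -> measurable B ->
    P [set w | B (X t w - X s w)] = P [set w | B (X (t - s) w)].

Record is_subordinator X : Prop := {
  subordinator_measurable : forall t, 0 <= t -> measurable_fun [set: T] (X t);
  subordinator_start : {ae P, forall w, X 0 w = 0};
  subordinator_indep : independent_increments X;
  subordinator_stationary : stationary_increments X;
  subordinator_nondecreasing :
    forall w s t, 0 <= s -> s <= t -> X s w <= X t w;
  subordinator_right_continuous :
    forall w t, 0 <= t -> X s w @[s --> t^'+] --> X t w }.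

(* The law is prescribed for [t > 0] only: the library's [poisson_pmf] takes a
   default value at rate 0. *)
Record is_poisson_process (lambda : R) (N : R -> T -> nat) : Prop := {
  poisson_process_levy : is_subordinator (fun t w => (N t w)%:R);
  poisson_process_law : forall t n, 0 < t ->
    P [set w | N t w = n] = (poisson_pmf (lambda * t) n)%:E }.

(* [inf set0 = 0], so the value is 0, not +oo, on the event that the path never
   exceeds level [t]; that event is negligible when the Levy measure is
   infinite. *)
Definition inverse_process X : R -> T -> R :=
  fun t w => inf [set s | 0 <= s /\ t < X s w].

Definition is_density_on_pos (Y : T -> R) (l : R -> R) : Prop :=
  [/\ measurable_fun (`]0, +oo[%classic : set R) l,
      (forall u, 0 < u -> 0 <= l u) &
      forall B : set R, measurable B ->
        P (Y @^-1` B) =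
        (\int[lebesgue_measure]_(u in B `&` `]0%R, +oo[) (l u)%:E)%E].

Definition state_prob (Z : R -> T -> int) (k : int) (t : R) : R :=
  fine (P [set w | Z t w = k]).

Definition mgf (Z : R -> T -> int) (theta t : R) : R :=
  fine 'E_P[fun w => expR (theta * (Z t w)%:~R)].

End processes.

(* A Levy measure on (0, oo) is a Borel measure on [R] used only on (0, oo). *)
Section bernstein.
Context (R : realType).
Variable nubar : {measure set (measurableTypeR R) -> \bar R}.

Definition levy_tail (s : R) : R := fine (nubar `]s, +oo[%classic).

Definition bernstein (x : R) : R :=
  \int[nubar]_(s in `]0, +oo[) (1 - expR (- (x * s))).

End bernstein.

(* The derivative of [w] exists only almost everywhere in general; the other
   points, where [derive1] takes a default value, do not affect the integral. *)
Definition caputo_djrbashian (R : realType) (nu w : R -> R) (t : R) : R :=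
  \int[lebesgue_measure]_(s in `]0, t[)
    (derive1 (fun x : R => w (x - s)) t * nu s).

(* The derivative at [t] is meaningful, i.e. [w] is absolutely continuous and
   the defining integral converges absolutely, and it has value [v]. *)
Definition caputo_djrbashian_eq (R : realType) (nu w : R -> R) (t v : R)
    : Prop :=
  [/\ abs_continuous_on 0 t w,
      lebesgue_measure.-integrable (`]0, t[%classic : set R)
        (fun s => (derive1 (fun x : R => w (x - s)) t * nu s)%:E) &
      caputo_djrbashian nu w t = v].

Definition besselI (R : realType) (k : nat) (z : R) : R :=
  limn (series (fun n : nat =>
    (z / 2) ^+ (2 * n + k) / (n`!%:R * (n + k)`!%:R))).

Definition skellam_pmf (R : realType) (lambda1 lambda2 u : R) (k : int) : R :=
  expR (- (u * (lambda1 + lambda2))) *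
  (lambda1 / lambda2) `^ (k%:~R / 2) *
  besselI `|k|%N (2 * u * Num.sqrt (lambda1 * lambda2)).

(* Main.v *)
(* Let mu_v be the law of H(v).  Since S is independent of Y(t), the quantity
   E phi(Z(t)) is E g(Y(t)) with g(u) = E phi(S(u)), and in both cases
   g(u) = g(0) + int_0^u (h1 - h2) with h1, h2 >= 0 (forward equations of the
   Skellam law, resp. an exponential).  As {v <= Y(t)} = {H(v) <= t} a.s., this
   gives E g(Y(t)) = g(0) + U h1(t) - U h2(t), where
   U h(t) = int_0^oo h(v) P(H(v) <= t) dv, so everything reduces to
   fD(U h)(t) = E h(Y(t)).
   Differentiating the Laplace transform of mu_v yields Steutel's identity
   y mu_v(dy) = v (s nubar(ds)) * mu_v; the tail of nubar being absolutely
   continuous, so are nubar, mu_v and hence U h, with some density rho.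
   Comparing Laplace transforms in t gives
   int_0^b E nu(t - H(v)) dv = P(H(b) > t) for almost every t, and the semigroup
   property together with mu_s << Lebesgue upgrades this to every t > 0.  Thus
   v |-> E nu(t - H(v)) is the density of Y(t), and
   fD(U h)(t) = int_0^t rho(t - s) nu(s) ds = int_0^oo h(v) E nu(t - H(v)) dv
   = E h(Y(t)). *)
From HB Require Import structures.
Require Import Defs.
From mathcomp Require Import measurable_realfun.
From mathcomp Require Import ring lra.

Set Implicit Arguments.
Unset Strict Implicit.
Unset Printing Implicit Defensive.

Local Open Scope classical_set_scope.
Local Open Scope ring_scope.

(** * Weighted measures and uniqueness of the Laplace transform *)

(** The infinite mass of [nubar] is used in the form that f is unbounded. Steutel's identity carries
    the factor y, so it cannot see an atom of mu_v at 0; Chernoff's bound P(H(v) <= t) <= e^{xt - v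
    f(x)} with f(x) large excludes that atom. The same bound gives Y(t) exponential moments of every
    order, which the moment generating function needs because its exponent can have either sign.
    Laplace transforms are compared at the integers 0, 1, 2, ... only: under y -> e^{-y} they are
    the moments of a measure on a compact interval. The value at 0 must be finite, which explains
    the weights e^{-y}. Transforms in t determine functions up to null sets, whereas the equations
    are claimed at every t > 0. Starting the flow at a time s > 0 turns the exceptional set into an
    event about t - H(s), of probability zero; s then decreases to 0. Integral equations are kept
    free of subtraction, with nonnegative terms on both sides, so that Tonelli justifies the
    interchanges. *)

Section weighted_measure.
Local Open Scope ereal_scope.
Context d (S : measurableType d) (R : realType).
Variables (m : {measure set S -> \bar R}) (w : S -> \bar R).

(** The proofs [w0] and [mw] are arguments so that the measure structure can be attached to this
    term. *)
Definition weighted_measure (w0 : forall x, 0 <= w x)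
    (mw : measurable_fun setT w) (A : set S) : \bar R :=
  \int[m]_(x in A) w x.

Variables (w0 : forall x, 0 <= w x) (mw : measurable_fun setT w).

Let wm := weighted_measure w0 mw.

Let wm_set0 : wm set0 = 0.
Proof. by rewrite /wm /weighted_measure integral_set0. Qed.

Let wm_ge0 A : 0 <= wm A.
Proof. exact: integral_ge0. Qed.

Let wm_sigma_additive : semi_sigma_additive wm.
Proof.
move=> F mF tF mUF; rewrite /wm /weighted_measure ge0_integral_bigcup//.
- exact: is_cvg_ereal_nneg_natsum_cond (fun _ _ _ => integral_ge0 _ _).
- exact: measurable_funTS.
Qed.

HB.instance Definition _ := isMeasure.Build _ _ _ (weighted_measure w0 mw)
  wm_set0 wm_ge0 wm_sigma_additive.

Import HBNNSimple.

(** True by definition for simple functions, and passes to [f] by monotone convergence. The delicate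
    point is that [w] may be infinite. *)
Lemma ge0_integral_weighted_measure (f : S -> \bar R) :
  measurable_fun setT f -> (forall x, 0 <= f x) ->
  \int[weighted_measure w0 mw]_x f x = \int[m]_x (w x * f x).
Proof.
move=> mf f0.
pose g := nnsfun_approx measurableT mf.
have gf x : (g n x)%:E @[n --> \oo] --> f x.
  by apply: cvg_nnsfun_approx.
have mg n : measurable_fun setT (EFin \o g n).
  exact/measurable_EFinP.
have nd x : nondecreasing_seq (fun n => (g n x)%:E).
  by move=> a b ab; rewrite lee_fin; exact/lefP/nd_nnsfun_approx.
transitivity (limn (fun n => \int[weighted_measure w0 mw]_x (g n x)%:E)).
  rewrite -monotone_convergence//.
  - by apply: eq_integral => x _; apply/esym/cvg_lim.
  - by move=> n x _; rewrite lee_fin.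
transitivity (limn (fun n => \int[m]_x (w x * (g n x)%:E))); last first.
  rewrite -monotone_convergence//.
  - apply: eq_integral => x _; apply/cvg_lim => //.
    have [->|wx0] := eqVneq (w x) 0.
      by under eq_fun do rewrite mul0e; rewrite mul0e; exact: cvg_cst.
    (* Multiplication by +oo is discontinuous at 0: if [f x] is 0, all approximants vanish there;
       otherwise one of them is positive and the products are eventually +oo. *)
    have [wxoo|wxoo] := eqVneq (w x) +oo.
      rewrite wxoo.
      have [fx0|fx0] := eqVneq (f x) 0.
        have gx0 n : (g n x)%:E = 0.
          apply/eqP; rewrite eq_le; apply/andP; split; last by rewrite lee_fin.
          rewrite -fx0 -(cvg_lim _ (gf x))//.
          rewrite (cvg_lim _ (ereal_nondecreasing_cvgn (nd x)))//.
          by apply: ereal_sup_ubound; exists n.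
        by under eq_fun do rewrite gx0 mule0; rewrite fx0 mule0; exact: cvg_cst.
      have fx_gt0 : 0 < f x by rewrite lt_neqAle eq_sym fx0 f0.
      rewrite gt0_mulye//; apply: (cvg_near_cst _ (F := \oo)).
      have [n0 gn0] : exists n0, 0 < (g n0 x)%:E.
        apply: contrapT => /forallNP gx; move: fx_gt0; apply/negP.
        rewrite -leNgt -(cvg_lim _ (gf x))//; apply: lime_le.
          by apply: cvgP; exact: gf.
        by apply: nearW => n; rewrite leNgt; apply/negP.
      near=> n; rewrite gt0_mulye// (lt_le_trans gn0)//.
      by apply: nd; near: n; exists n0.
    apply: cvgeZl; last exact: gf.
    by rewrite fin_numE wxoo andbT gt_eqF// (lt_le_trans _ (w0 x)).
  - by move=> n; apply: emeasurable_funM => //; exact: mg.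
  - by move=> n x _; rewrite mule_ge0// lee_fin.
  - by move=> x _ a b ab; apply: lee_wpmul2l => //; exact: nd.
congr (limn _); apply/funext => n.
rewrite integralT_nnsfun sintegralE.
under [RHS]eq_integral => x _.
  rewrite fimfunE -fsumEFin// ge0_mule_fsumr; last first.
    by move=> r; rewrite EFinM nnfun_muleindic_ge0.
  over.
rewrite ge0_integral_fsum//; last 2 first.
- move=> r; apply: emeasurable_funM => //; apply/measurable_EFinP.
  exact: measurable_funM.
- by move=> r x _; rewrite mule_ge0// nnfun_muleindic_ge0.
apply: eq_fsbigr => r /set_mem[y _ gyr].
have r0 : (0 <= r)%R by rewrite -gyr.
rewrite /weighted_measure [X in _ * X]integral_mkcond -ge0_integralZl//; last 2 first.
- apply/(measurable_restrictT _ _).1 => //; exact: measurable_funTS.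
- by move=> x _; rewrite patchE; case: ifP.
apply: eq_integral => x _; rewrite patchE indicE EFinM.
rewrite muleCA; case: ifPn => xr; rewrite ?mule1// ?mule0//.
Unshelve. all: by end_near. Qed.

End weighted_measure.

Section laplace_uniqueness.
Context (R : realType).

(** The power (1 - e^{-nx})^N behaves like exp(-N e^{-nx}), and this N makes the exponent about -n
    e^{n(a - x)}: it tends to 0 for x > a and to -oo for x <= a, the factor n settling the case x =
    a. *)
Let N (a : R) (n : nat) := Num.truncn (n%:R * expR (n%:R * a)).

Lemma bernoulli_ineq (y : R) n : 0 <= y <= 1 -> 1 - n%:R * y <= (1 - y) ^+ n.
Proof.
move=> /andP[y0 y1]; elim: n => [|n IH]; first by rewrite mul0r subr0 expr0.
rewrite exprS (le_trans _ (ler_wpM2l _ IH)) ?subr_ge0//.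
rewrite -natr1 mulrDl mul1r mulrBr mulr1 mulrBl mul1r.
have : 0 <= y * (n%:R * y) by rewrite !mulr_ge0.
lra.
Qed.

(* Replacing [x] by a random variable and expanding the power turns Laplace
   transforms into the distribution function. *)
Lemma expr_onem_expR_cvg (a x : R) : 0 <= x ->
  (1 - expR (- (n%:R * x))) ^+ (N a n) @[n --> \oo] --> ((a < x)%R%:R : R).
Proof.
move=> x0.
have y01 n : 0 <= expR (- (n%:R * x)) <= 1.
  by rewrite expR_ge0 -expR0 ler_expR oppr_le0 mulr_ge0.
have cvgexp (c : R) : 0 < c -> expR (- (n%:R * c)) @[n --> \oo] --> (0 : R).
  move=> c0; under eq_fun do rewrite -mulrN expRM_natl.
  by apply: cvg_expr; rewrite ger0_norm ?expR_ge0// -expR0 ltr_expR oppr_lt0.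
have [ax|xa] := ltP a x.
  (* Bernoulli leaves the error n e^{-2nc}; one factor e^{-nc} absorbs n, since n c <= e^{nc}, and
     the other tends to 0. *)
  pose c := (x - a) / 2.
  have c0 : 0 < c by rewrite divr_gt0// subr_gt0.
  apply: (@squeeze_cvgr _ _ _ _ (fun n => 1 - c^-1 * expR (- (n%:R * c))) (cst 1)).
  - apply: nearW => n; apply/andP; split; last first.
      by rewrite exprn_ile1 ?subr_ge0 ?lerBlDr ?lerDl; case/andP: (y01 n).
    apply: le_trans (bernoulli_ineq _ (y01 n)); rewrite lerD2l lerN2.
    apply: (@le_trans _ _ (n%:R * expR (n%:R * a) * expR (- (n%:R * x)))).
      by rewrite ler_wpM2r ?expR_ge0// truncn_le mulr_ge0 ?expR_ge0.
    rewrite -mulrA -expRD.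
    have -> : n%:R * a - n%:R * x = - (n%:R * c) - n%:R * c.
      by rewrite /c; lra.
    rewrite expRD mulrA ler_wpM2r ?expR_ge0//.
    rewrite -(@ler_pM2r _ (expR (n%:R * c))) ?expR_gt0//.
    rewrite -mulrA -expRD addrC subrr expR0 mulr1.
    rewrite -(@ler_pM2l _ c)// mulrA divff ?gt_eqF// mul1r.
    have := expR_ge1Dx (n%:R * c); lra.
  - rewrite -[X in _ --> X]subr0; apply: cvgB; first exact: cvg_cst.
    rewrite -(mulr0 c^-1); apply: cvgMl_tmp; exact: cvgexp.
  - exact: cvg_cst.
(* With y the exponential, N >= n e^{na} - 1, x <= a and y <= 1 give N y >= n - 1, hence (1 - y)^N
   <= e^{-N y} <= e^{1 - n}. *)
apply: (@squeeze_cvgr _ _ _ _ (cst 0) (fun n => expR 1 * expR (- (n%:R * 1)))).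
- apply: nearW => n; apply/andP; split.
    by rewrite exprn_ge0// subr_ge0; case/andP: (y01 n).
  set y := expR _.
  apply: (@le_trans _ _ (expR (- y) ^+ N a n)).
    rewrite lerXn2r// ?nnegrE ?expR_ge0// ?subr_ge0//; first by case/andP: (y01 n).
    exact: expR_ge1Dx.
  rewrite -expRM_natl -expRD ler_expR mulr1 mulrN lerNl opprB.
  apply: (@le_trans _ _ ((n%:R * expR (n%:R * a) - 1) * y)); last first.
    rewrite ler_wpM2r ?expR_ge0// lerBlDr natr1 ltW// truncnS_gt//.
  rewrite mulrBl mul1r lerB//; last by case/andP: (y01 n).
  rewrite -mulrA -expRD -[leLHS]mulr1 ler_wpM2l// -expR0 ler_expR.
  by rewrite -mulrBr mulr_ge0// subr_ge0.
- exact: cvg_cst.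
- rewrite (_ : false%:R = expR 1 * 0); last by rewrite mulr0.
  exact: cvgMl_tmp (cvgexp _ ltr01).
Qed.

Variables m1 m2 : {measure set (measurableTypeR R) -> \bar R}.
Let D : set (measurableTypeR R) := `[0, +oo[%classic.
Let mD : measurable D. Proof. exact: measurable_itv. Qed.
Hypothesis m1D : (m1 D < +oo)%E.
Hypothesis m12 : forall n : nat,
  (\int[m1]_(x in D) (expR (- (n%:R * x)))%:E =
   \int[m2]_(x in D) (expR (- (n%:R * x)))%:E)%E.

Let m1m2D : m1 D = m2 D.
Proof.
have := m12 0.
under eq_integral do rewrite mul0r oppr0 expR0.
under [RHS]eq_integral do rewrite mul0r oppr0 expR0.
by rewrite !integral_cst// !mul1e.
Qed.

Let m2D : (m2 D < +oo)%E. Proof. by rewrite -m1m2D. Qed.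

(** The factor e^{-jx} closes the family under splitting off one factor of the power, so an
    induction on k replaces the binomial expansion. *)
Let q (j n k : nat) (x : R) : R :=
  expR (- (j%:R * x)) * (1 - expR (- (n%:R * x))) ^+ k.

Let q01 j n k x : 0 <= x -> 0 <= q j n k x <= 1.
Proof.
move=> x0; have y01 i : 0 <= expR (- (i%:R * x)) <= 1.
  by rewrite expR_ge0 -expR0 ler_expR oppr_le0 mulr_ge0.
have /andP[jx0 jx1] := y01 j; have /andP[nx0 nx1] := y01 n.
rewrite mulr_ge0 ?exprn_ge0 ?subr_ge0//=.
by rewrite mulr_ile1 ?exprn_ge0 ?exprn_ile1 ?subr_ge0 ?lerBlDr ?lerDl.
Qed.

Let mq j n k : measurable_fun D (q j n k).
Proof.
apply: measurable_funTS; apply: measurable_funM.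
  by apply: measurableT_comp => //; apply: measurableT_comp => //; exact: measurable_funM.
apply: measurable_funX; apply: measurable_funB => //.
by apply: measurableT_comp => //; apply: measurableT_comp => //; exact: measurable_funM.
Qed.

Let q_bounded j n k : [bounded q j n k x | x in D].
Proof.
exists 1; split => // M M1 x; rewrite /D /= in_itv/= andbT => x0.
have /andP[? ?] := q01 j n k x0.
by rewrite ger0_norm// (le_trans _ (ltW M1)).
Qed.

Let qS j n k x : q j n k.+1 x = q j n k x - q (j + n) n k x.
Proof. by rewrite /q exprS natrD (mulrDl _ _ x) opprD expRD; ring. Qed.

Let q_eq j n k :
  (\int[m1]_(x in D) (q j n k x)%:E = \int[m2]_(x in D) (q j n k x)%:E)%E.
Proof.
elim: k j => [|k IH] j.
  by under eq_integral do rewrite /q expr0 mulr1;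
     under [RHS]eq_integral do rewrite /q expr0 mulr1.
under eq_integral do rewrite qS EFinB.
under [RHS]eq_integral do rewrite qS EFinB.
rewrite !integralB_EFin//; try exact: measurable_bounded_integrable.
by rewrite !IH.
Qed.

(** The functions [q 0 n (N a n)] have equal integrals and converge boundedly to the indicator of
    the ray. *)
Let ray_eq (a : R) : 0 <= a -> m1 `]a, +oo[%classic = m2 `]a, +oo[%classic.
Proof.
move=> a0.
have cvgm (m : {measure set (measurableTypeR R) -> \bar R}) : (m D < +oo)%E ->
    (\int[m]_(x in D) (q 0 n (N a n) x)%:E)%E @[n --> \oo] --> m `]a, +oo[%classic.
  move=> mDoo.
  have -> : m `]a, +oo[%classic = (\int[m]_(x in D) ((a < x)%R%:R : R)%:E)%E.
    have aD : `]a, +oo[ `<=` D.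
      by move=> x; rewrite /D /= !in_itv/= !andbT => /ltW; exact: le_trans.
    rewrite -[in LHS](setIidl aD) -integral_indic//; apply: eq_integral => x _.
    by rewrite indicE mem_setE in_itv/= andbT.
  apply: (@dominated_cvg _ _ _ m D mD _ _ (cst 1%E)) => //=.
  - by move=> n; apply/measurable_EFinP; exact: mq.
  - move=> x; rewrite /D /= in_itv/= andbT => x0.
    apply/fine_cvgP; split; first exact: nearW.
    apply: (cvg_trans _ (@expr_onem_expR_cvg a x x0)).
    by apply: near_eq_cvg; apply: nearW => n; rewrite /q /= mul0r oppr0 expR0 mul1r.
  - apply: (@measurable_bounded_integrable _ _ _ _ (cst 1)) => //.
    by exists 1; split => // M M1 x _; rewrite /= normr1 ltW.
  - move=> n x; rewrite /D /= in_itv/= andbT => x0.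
    have /andP[? ?] := q01 0 n (N a n) x0.
    by rewrite ger0_norm// lee_fin.
have := cvgm m2 m2D.
rewrite (_ : (fun _ => _) = (fun n => \int[m1]_(x in D) (q 0 n (N a n) x)%:E)%E).
  by move/(cvg_unique _ (cvgm m1 m1D)); exact.
by apply/funext => n; rewrite q_eq.
Qed.

Theorem laplace_measure_unique (A : set R) : measurable A -> A `<=` `[0, +oo[ ->
  m1 A = m2 A.
Proof.
move=> mA AD.
have -> : m1 A = mrestr m1 mD A by rewrite /mrestr setIidl.
have -> : m2 A = mrestr m2 mD A by rewrite /mrestr setIidl.
apply: (@measure_unique _ R (measurableTypeR R) (@RGenOInfty.G R)
  (fun n : nat => `](- n%:R : R), +oo[%classic) _ _ _ _ (mrestr m1 mD) (mrestr m2 mD)).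
- exact: RGenOInfty.measurableE.
- move=> _ _ [x ->] [y ->]; exists (Num.max x y); apply/seteqP; split => z /=;
    by rewrite !in_itv/= !andbT gt_max => /andP.
- by move=> n; exists (- n%:R).
- apply/seteqP; split => // x _; exists (Num.truncn (- x)).+1 => //=.
  by rewrite in_itv/= andbT ltrNl truncnS_gt.
- move=> _ [x ->]; rewrite /= /mrestr; have [x0|x0] := leP 0 x.
    rewrite setIidl; first exact: ray_eq.
    by move=> y; rewrite /D /= !in_itv/= !andbT => /ltW; exact: le_trans.
  (* A ray starting below 0 meets [D] in all of [D], whose mass is the transform at 0. *)
  rewrite setIidr// => y; rewrite /D /= !in_itv/= !andbT.
  exact: lt_le_trans.
- move=> k; rewrite /= /mrestr; apply: le_lt_trans m1D; apply: le_measure.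
  + by rewrite inE; apply: measurableI.
  + by rewrite inE.
  + exact: subIsetr.
- exact: mA.
Qed.

End laplace_uniqueness.

Section weighted_law.
Local Open Scope ereal_scope.
Context d d' (S : measurableType d) (U : measurableType d') (R : realType).
Variables (m : {measure set S -> \bar R}) (w : S -> \bar R) (X : S -> U).

(** The image under [X] of the measure with density [w]. Laws, size-biased laws and potential
    measures all have this shape. *)
Definition weighted_law (w0 : forall x, 0 <= w x)
    (mw : measurable_fun setT w) (mX : measurable_fun setT X) : set U -> \bar R :=
  pushforward (weighted_measure m w0 mw) X.

Variables (w0 : forall x, 0 <= w x) (mw : measurable_fun setT w)
  (mX : measurable_fun setT X).

Let wl := weighted_law w0 mw mX.

Let wl_set0 : wl set0 = 0.
Proof. by rewrite /wl /weighted_law /pushforward preimage_set0 measure0. Qed.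

Let wl_ge0 A : 0 <= wl A.
Proof. exact: measure_ge0. Qed.

Let wl_sigma_additive : semi_sigma_additive wl.
Proof.
move=> F mF tF mUF; rewrite /wl /weighted_law /pushforward preimage_bigcup.
apply: measure_semi_sigma_additive.
- by move=> n; rewrite -[X in measurable X]setTI; exact: mX.
- apply/trivIsetP => /= i j _ _ ij; rewrite -preimage_setI.
  by move/trivIsetP : tF => /(_ _ _ _ _ ij) ->//; rewrite preimage_set0.
- by rewrite -preimage_bigcup -[X in measurable X]setTI; exact: mX.
Qed.

HB.instance Definition _ := isMeasure.Build _ _ _ (weighted_law w0 mw mX)
  wl_set0 wl_ge0 wl_sigma_additive.

Lemma weighted_lawE A : weighted_law w0 mw mX A = \int[m]_(x in X @^-1` A) w x.
Proof. by []. Qed.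

Lemma ge0_integral_weighted_law (f : U -> \bar R) :
  measurable_fun setT f -> (forall x, 0 <= f x) ->
  \int[weighted_law w0 mw mX]_x f x = \int[m]_x (w x * f (X x)).
Proof.
move=> mf f0; rewrite ge0_integral_pushforward// preimage_setT.
rewrite ge0_integral_weighted_measure//; last first.
  by move=> x; exact: f0.
exact: measurableT_comp.
Qed.

End weighted_law.

Section laplace_law_unique.
Local Open Scope ereal_scope.
Context d1 d2 (S1 : measurableType d1) (S2 : measurableType d2) (R : realType).
Variables (m1 : {measure set S1 -> \bar R}) (m2 : {measure set S2 -> \bar R}).
Variables (w1 : S1 -> \bar R) (w2 : S2 -> \bar R) (X1 : S1 -> R) (X2 : S2 -> R).
Hypotheses (w10 : forall x, 0 <= w1 x) (w20 : forall x, 0 <= w2 x).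
Hypotheses (mw1 : measurable_fun setT w1) (mw2 : measurable_fun setT w2).
Hypotheses (mX1 : measurable_fun setT X1) (mX2 : measurable_fun setT X2).
Hypotheses (X10 : forall x, (0 <= X1 x)%R) (X20 : forall x, (0 <= X2 x)%R).
Hypothesis w1oo : \int[m1]_x w1 x < +oo.
Hypothesis lap : forall n : nat, \int[m1]_x (w1 x * (expR (- (n%:R * X1 x)))%:E) =
  \int[m2]_x (w2 x * (expR (- (n%:R * X2 x)))%:E).

(** Compares functionals of nonnegative variables living on different spaces, for instance on [T]
    and on a product. Both images sit on [[0, +oo[], so restricting to that half-line loses
    nothing. *)
Lemma laplace_law_unique (f : R -> \bar R) :
  measurable_fun setT f -> (forall x, 0 <= f x) ->
  \int[m1]_x (w1 x * f (X1 x)) = \int[m2]_x (w2 x * f (X2 x)).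
Proof.
move=> mf f0.
pose M1 : {measure set (measurableTypeR R) -> \bar R} := @weighted_law _ _ S1 (measurableTypeR R) R m1 w1 X1 w10 mw1 mX1.
pose M2 : {measure set (measurableTypeR R) -> \bar R} :=
    @weighted_law _ _ S2 (measurableTypeR R) R m2 w2 X2 w20 mw2 mX2.
pose D : set (measurableTypeR R) := `[0%R, +oo[%classic.
have mD : measurable D by exact: measurable_itv.
have i1 (g : R -> \bar R) : measurable_fun setT g -> (forall x, 0 <= g x) ->
    \int[M1]_(x in D) g x = \int[m1]_x (w1 x * g (X1 x)).
  move=> mg g0; rewrite [LHS]integral_mkcond.
  transitivity (\int[m1]_x (w1 x * (g \_ D) (X1 x))).
    apply: (@ge0_integral_weighted_law _ _ S1 (measurableTypeR R)
      R m1 w1 X1 w10 mw1 mX1 (g \_ D)).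
    - by apply/(measurable_restrictT _ _).1 => //; exact: measurable_funTS.
    - by move=> x; rewrite patchE; case: ifP.
  apply: eq_integral => x _; rewrite patchE mem_set//.
  by rewrite /D /= in_itv/= andbT.
have i2 (g : R -> \bar R) : measurable_fun setT g -> (forall x, 0 <= g x) ->
    \int[M2]_(x in D) g x = \int[m2]_x (w2 x * g (X2 x)).
  move=> mg g0; rewrite [LHS]integral_mkcond.
  transitivity (\int[m2]_x (w2 x * (g \_ D) (X2 x))).
    apply: (@ge0_integral_weighted_law _ _ S2 (measurableTypeR R)
      R m2 w2 X2 w20 mw2 mX2 (g \_ D)).
    - by apply/(measurable_restrictT _ _).1 => //; exact: measurable_funTS.
    - by move=> x; rewrite patchE; case: ifP.
  apply: eq_integral => x _; rewrite patchE mem_set//.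
  by rewrite /D /= in_itv/= andbT.
rewrite -i1// -i2//; apply: eq_measure_integral => A mA AD.
apply: laplace_measure_unique => //.
- rewrite (le_lt_trans _ w1oo)// [M1 _]weighted_lawE.
  apply: ge0_subset_integral => //.
  by rewrite -[X in measurable X]setTI; exact: mX1.
- move=> n.
  have me : measurable_fun setT (fun x : R => (expR (- (n%:R * x)))%:E).
    apply/measurable_EFinP; apply: measurableT_comp => //.
    by apply: measurableT_comp => //; exact: measurable_funM.
  by rewrite i1// ?i2// => x; rewrite lee_fin expR_ge0.
Qed.

End laplace_law_unique.

(** * The Levy measure and its Bernstein function *)

Section expR_integrals.
Context (R : realType).
Notation leb := (@lebesgue_measure R).

Lemma is_derive_expRN (x c t : R) :
  is_derive t 1 (fun t => c * expR (- (x * t))) (- (c * x) * expR (- (x * t))).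
Proof.
have h : is_derive t 1 (fun t : R => - (x * t)) (- x).
  have -> : (fun t : R => - (x * t)) = (- x) \*: (@idfun R).
    by apply/funext => s; rewrite /= /GRing.scale /= mulNr.
  by apply: is_derive_eq; rewrite /GRing.scale /= mulr1.
have h2 := @is_derive1_comp _ expR (fun t : R => - (x * t)) t _ _ (is_derive_expR _) h.
have h3 := is_deriveZ c h2.
by apply: (is_derive_eq h3); rewrite /GRing.scale /=; ring.
Qed.

Lemma continuous_expRN (x : R) : continuous (fun t : R => expR (- (x * t))).
Proof.
move=> t; apply: continuous_comp; last exact: continuous_expR.
by apply: cvgN; apply: cvgM; [exact: cvg_cst|exact: cvg_id].
Qed.

Lemma measurable_expRN (x : R) : measurable_fun [set: R] (fun t : R => expR (- (x * t))).
Proof.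
by apply: measurableT_comp => //; exact: measurableT_comp.
Qed.

Let F (x t : R) : R := - x^-1 * expR (- (x * t)).

Let dF (x t : R) : x != 0 -> is_derive t 1 (F x) (expR (- (x * t))).
Proof.
move=> x0; apply: (is_derive_eq (is_derive_expRN _ _ _)).
rewrite (_ : - (- x^-1 * x) = 1) ?mul1r//.
by rewrite mulNr opprK mulVf.
Qed.

Let cF (x : R) : continuous (F x).
Proof. by move=> t; apply: cvgM; [exact: cvg_cst|exact: continuous_expRN]. Qed.

Lemma integral_expRN_itv (x a b : R) : x != 0 -> a <= b ->
  (\int[leb]_(t in `[a, b]) (expR (- (x * t)))%:E =
   ((expR (- (x * a)) - expR (- (x * b))) / x)%:E)%E.
Proof.
move=> x0; rewrite le_eqVlt => /predU1P[<-|ab].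
  by rewrite set_itv1 integral_set1 subrr mul0r.
rewrite (@continuous_FTC2 _ _ (F x))//.
- by rewrite -EFinB; congr EFin; rewrite /F; field.
- by apply: continuous_subspaceT; exact: continuous_expRN.
- split.
  + by move=> t _; apply: ex_derive; exact: dF.
  + apply: cvg_at_right_filter; exact: cF.
  + apply: cvg_at_left_filter; exact: cF.
- by move=> t _; rewrite derive1E; apply: derive_val; exact: dF.
Qed.

Lemma integral_expRN_ge (x a : R) : 0 < x ->
  (\int[leb]_(t in `[a, +oo[) (expR (- (x * t)))%:E = (expR (- (x * a)) / x)%:E)%E.
Proof.
move=> x0; have xn0 : x != 0 by rewrite gt_eqF.
rewrite (@ge0_continuous_FTC2y _ _ (F x) _ 0)//.
- by rewrite -EFinB; congr EFin; rewrite /F; field.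
- by apply: continuous_subspaceT; exact: continuous_expRN.
- rewrite (_ : 0 = - x^-1 * 0 :> R); last by rewrite mulr0.
  apply: cvgMl_tmp.
  apply: (@cvg_comp _ _ _ (fun t => x * t) (fun t => expR (- t)) _ +oo%R).
    exact: gt0_cvgMry.
  exact: cvgr_expR.
- apply: cvg_at_right_filter; exact: cF.
- by move=> t _; rewrite derive1E; apply: derive_val; exact: dF.
Qed.

Lemma expR_sub_ge0 (x s : R) : 0 <= x -> 0 <= s -> 0 <= 1 - expR (- (x * s)) <= 1.
Proof.
move=> x0 s0; rewrite subr_ge0 -{1}expR0 ler_expR oppr_le0 mulr_ge0//=.
Qed.

(** From u s <= e^{us}; this dominates the derivative of e^{-xs} uniformly in x >= u. *)
Lemma mul_expRN_le (u s : R) : 0 < u -> 0 <= s -> s * expR (- (u * s)) <= u^-1.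
Proof.
move=> u0 s0; rewrite expRN ler_pdivrMr ?expR_gt0// ler_pdivlMl//.
by rewrite (le_trans _ (expR_ge1Dx _))// lerDr.
Qed.

End expR_integrals.

Section levy_measure.
Context (R : realType).
Variable nubar : {measure set (measurableTypeR R) -> \bar R}.

Definition levy_integrable : Prop :=
  (\int[nubar]_(s in `]0%R, +oo[) (Num.min s 1)%:E < +oo)%E.

Let I : set (measurableTypeR R) := `]0, +oo[%classic.
Let mI : measurable I. Proof. exact: measurable_itv. Qed.

(** [nubar] is arbitrary outside []0, +oo[], hence the restriction. The integrability proof is an
    argument because the sigma-finite structure attached below depends on it. *)
Definition levy_restr (_ : levy_integrable) : set (measurableTypeR R) -> \bar R :=
  mrestr nubar mI.

Hypothesis hmin : levy_integrable.
Let lev := levy_restr hmin.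

HB.instance Definition _ := Measure.copy (levy_restr hmin) (mrestr nubar mI).

Let mmin : measurable_fun setT (fun s : R => (Num.min s 1)%:E).
Proof. by apply/measurable_EFinP; exact: measurable_minr. Qed.

(** Chebyshev: on the ray the integrand min(., 1) is at least min(s, 1) > 0. *)
Lemma levy_ray_fin (s : R) : 0 < s -> (nubar `]s, +oo[%classic < +oo)%E.
Proof.
move=> s0; pose c := Num.min s 1.
have c0 : 0 < c by rewrite lt_min s0 ltr01.
have mJ : measurable (`]s, +oo[%classic : set (measurableTypeR R)) by exact: measurable_itv.
rewrite -(@lte_pmul2l _ c%:E) ?lte_fin// ?fin_numE//.
rewrite -integral_cst// (@le_lt_trans _ _ (\int[nubar]_(s in `]0%R, +oo[) (Num.min s 1)%:E)%E)//; last first.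
  by rewrite gt0_muley ?lte_fin.
apply: (@le_trans _ _ (\int[nubar]_(s in `]s, +oo[) (Num.min s 1)%:E)%E).
  apply: ge0_le_integral => //.
  - by move=> x _; rewrite lee_fin ltW.
  - exact: measurable_funTS.
  - move=> x; rewrite /= in_itv/= andbT => sx; rewrite lee_fin /c.
    by rewrite le_min !ge_min (ltW sx) lexx orbT.
apply: ge0_subset_integral => //.
- exact: measurable_funTS.
- move=> x; rewrite /= in_itv/= andbT => sx.
  by rewrite lee_fin le_min ler01 andbT ltW.
- by move=> x; rewrite /= !in_itv/= !andbT; exact: lt_trans.
Qed.

Lemma levy_tailE (s : R) : 0 < s -> nubar `]s, +oo[%classic = (levy_tail nubar s)%:E.
Proof. by move=> s0; rewrite /levy_tail fineK// ge0_fin_numE// levy_ray_fin. Qed.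

Let lev_sigma_finite : sigma_finite setT lev.
Proof.
(* The left half-line has mass 0 after restriction, but the sets must cover the whole line. *)
exists (fun n : nat => `]-oo, 0] `|` `](n.+1%:R)^-1, +oo[)%classic.
  apply/seteqP; split => // x _; have [x0|x0] := leP x 0.
    by exists 0 => //; left; rewrite /= in_itv.
  exists (Num.truncn x^-1) => //; right; rewrite /= in_itv/= andbT.
  by rewrite invf_plt ?posrE// truncnS_gt.
move=> n; split; first by apply: measurableU; exact: measurable_itv.
rewrite /lev /levy_restr /mrestr; apply: le_lt_trans (@levy_ray_fin n.+1%:R^-1 _) => //.
apply: le_measure; rewrite ?inE.
- by apply: measurableI => //; apply: measurableU; exact: measurable_itv.
- exact: measurable_itv.
- move=> x [[]]; rewrite /I /= !in_itv/= ?andbT//.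
  by move=> x0 /(le_lt_trans x0); rewrite ltxx.
Qed.

HB.instance Definition _ := @Measure_isSigmaFinite.Build _ _ _ (levy_restr hmin)
  lev_sigma_finite.

Lemma ge0_integral_levy (f : R -> \bar R) : measurable_fun setT f ->
  (forall x, 0 <= f x)%E -> (\int[lev]_x f x = \int[nubar]_(x in `]0%R, +oo[) f x)%E.
Proof.
move=> mf f0.
have mIC : measurable (~` I) by exact: measurableC.
rewrite (@ge0_negligible_integral _ _ _ lev setT (~` I))//; last first.
  by change (nubar (~` I `&` I) = 0%E); rewrite setICl measure0.
rewrite setTD setCK.
apply: eq_measure_integral => A mA AI.
by change (nubar (A `&` I) = nubar A); rewrite setIidl.
Qed.

Lemma levy_tail_ge0 (s : R) : 0 <= levy_tail nubar s.
Proof. exact: fine_ge0. Qed.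

Lemma levy_tail_le (s t : R) : 0 < s -> s <= t -> levy_tail nubar t <= levy_tail nubar s.
Proof.
move=> s0 st; rewrite -lee_fin -!levy_tailE ?(lt_le_trans s0 st)//.
apply: le_measure; rewrite ?inE; try exact: measurable_itv.
by move=> x; rewrite /= !in_itv/= !andbT; exact: le_lt_trans.
Qed.

Lemma integrable_levy_min : nubar.-integrable `]0, +oo[ (fun s : R => (Num.min s 1)%:E).
Proof.
apply/integrableP; split; first exact: measurable_funTS.
apply: le_lt_trans hmin; rewrite le_eqVlt; apply/orP; left; apply/eqP.
apply: eq_integral => x.
rewrite inE /I /= in_itv/= andbT => x0.
by rewrite ger0_norm// le_min ler01 andbT ltW.
Qed.

Let min_exp_le (x s : R) : 0 < x -> 0 < s ->
  1 - expR (- (x * s)) <= (1 + x) * Num.min s 1.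
Proof.
move=> x0 s0; have := expR_ge1Dx (- (x * s)); have := expR_ge0 (- (x * s)).
rewrite /Num.min; case: ifP => _.
  by have : 0 < x * s := mulr_gt0 x0 s0; lra.
lra.
Qed.

Lemma integrable_levy_exp (x : R) : 0 < x ->
  nubar.-integrable `]0, +oo[ (fun s : R => (1 - expR (- (x * s)))%:E).
Proof.
move=> x0; apply: (le_integrable mI _ _ (integrableZl mI (1 + x) integrable_levy_min)).
  apply: measurable_funTS; apply/measurable_EFinP; apply: measurable_funB => //.
  exact: measurable_expRN.
move=> s; rewrite /I /= in_itv/= andbT => s0.
rewrite !lee_fin; have /andP[? _] := expR_sub_ge0 (ltW x0) (ltW s0).
rewrite ger0_norm// ger0_norm ?min_exp_le//.
by rewrite mulr_ge0// ?addr_ge0 ?ler01 ?(ltW x0)// le_min ler01 (ltW s0).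
Qed.

Let m1exp (x : R) : measurable_fun setT (fun s : R => (1 - expR (- (x * s)))%:E).
Proof.
apply/measurable_EFinP; apply: measurable_funB => //; exact: measurable_expRN.
Qed.

Lemma bernsteinE (x : R) : 0 < x ->
  ((bernstein nubar x)%:E = \int[nubar]_(s in `]0%R, +oo[) (1 - expR (- (x * s)))%:E)%E.
Proof.
by move=> x0; rewrite /bernstein /Rintegral fineK// integrable_fin_num//; exact: integrable_levy_exp.
Qed.

Lemma bernstein_ge0 (x : R) : 0 < x -> 0 <= bernstein nubar x.
Proof.
move=> x0; apply: Rintegral_ge0 => s; rewrite /= in_itv/= andbT => s0.
by have /andP[] := expR_sub_ge0 (ltW x0) (ltW s0).
Qed.

Lemma bernstein_levy (x : R) : 0 < x ->
  ((bernstein nubar x)%:E = \int[lev]_s (if 0 < s then 1 - expR (- (x * s)) else 0)%:E)%E.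
Proof.
move=> x0; rewrite bernsteinE// ge0_integral_levy//; last 2 first.
- apply/measurable_EFinP; apply: measurable_fun_ifT => //.
  + exact: measurable_fun_ltr.
  + by apply: measurable_funB => //; exact: measurable_expRN.
- move=> s; rewrite lee_fin; case: ifPn => // s0.
  by have /andP[] := expR_sub_ge0 (ltW x0) (ltW s0).
by apply: eq_integral => s; rewrite inE /= in_itv/= andbT => ->.
Qed.

(** Along x = n + 1 the integrands increase to 1 on []0, +oo[], so by monotone convergence f
    increases to the total mass. *)
Lemma bernstein_unbounded (M : R) : nubar `]0, +oo[%classic = +oo%E ->
  exists2 x, 0 < x & M <= bernstein nubar x.
Proof.
move=> nuoo.
have : (\int[nubar]_(s in `]0%R, +oo[) (1 - expR (- (n.+1%:R * s)))%:E @[n --> \oo] -->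
    \int[nubar]_(s in `]0%R, +oo[) 1)%E.
  rewrite (_ : (\int[nubar]_(s in `]0%R, +oo[) 1 = \int[nubar]_(s in `]0%R, +oo[)
      limn (fun n => (1 - expR (- (n.+1%:R * s)))%:E))%E); last first.
    apply: eq_integral => s; rewrite inE /= in_itv/= andbT => s0.
    apply/esym/cvg_lim => //.
    apply/fine_cvgP; split; first exact: nearW.
    rewrite (_ : _ \o _ = (fun n => 1 - expR (- s) ^+ n.+1)); last first.
      by apply/funext => n /=; rewrite -mulrN expRM_natl.
    rewrite -[X in _ --> X]subr0; apply: cvgB; first exact: cvg_cst.
    rewrite (_ : (fun _ => _) = (fun n => expR (- s) * expR (- s) ^+ n)); last first.
      by apply/funext => n; rewrite exprS.
    rewrite -(mulr0 (expR (- s))); apply: cvgMl_tmp; apply: cvg_expr.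
    by rewrite ger0_norm ?expR_ge0// -expR0 ltr_expR oppr_lt0.
  apply: cvg_monotone_convergence => //.
  - by move=> n; apply: measurable_funTS; exact: m1exp.
  - move=> n s; rewrite /= in_itv/= andbT => s0.
    by rewrite lee_fin; have /andP[] := @expR_sub_ge0 R n.+1%:R s (ler0n _ _) (ltW s0).
  - move=> s; rewrite /= in_itv/= andbT => s0 m n mn.
    by rewrite lee_fin lerD2l lerN2 ler_expR lerN2 ler_wpM2r ?ler_nat// ltW.
rewrite integral_cst// nuoo mul1e => /cvgeyPge/(_ M)[N _ /(_ N (leqnn _))].
rewrite /= -bernsteinE// lee_fin => MN.
by exists N.+1%:R.
Qed.

(** If f(x) were 0, the integrand would vanish almost everywhere; being positive on all of []0,
    +oo[], it would force this set to be null. *)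
Lemma bernstein_gt0 (x : R) : nubar `]0, +oo[%classic = +oo%E -> 0 < x ->
  0 < bernstein nubar x.
Proof.
move=> nuoo x0; rewrite lt_neqAle bernstein_ge0// andbT; apply/eqP => f0.
have := bernsteinE x0; rewrite -f0.
move=> /esym i0.
have : (\int[nubar]_(s in `]0%R, +oo[) `|(1 - expR (- (x * s)))%:E| = 0)%E.
  apply: etrans i0; apply: eq_integral => s; rewrite inE /= in_itv/= andbT => s0.
  by have /andP[h _] := expR_sub_ge0 (ltW x0) (ltW s0); rewrite ger0_norm.
move/(ae_eq_integral_abs _ mI (measurable_funTS (m1exp x))) => [N [mN N0 IN]].
have : (nubar I <= nubar N)%E.
  apply: le_measure; rewrite ?inE//; apply: subset_trans IN => s.
  rewrite /I /= in_itv/= andbT => s0 /(_ s0)[] /eqP.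
  by rewrite subr_eq0 eq_sym -expR0 (inj_eq (@expR_inj _)) oppr_eq0 mulf_eq0 !gt_eqF.
by rewrite nuoo N0.
Qed.

End levy_measure.

Lemma integral_if d (T : measurableType d) (R : realType)
    (mu : {measure set T -> \bar R}) (c : T -> bool) (g : T -> R) :
  (\int[mu]_x (if c x then g x else 0)%:E = \int[mu]_(x in [set x | c x]) (g x)%:E)%E.
Proof.
rewrite [RHS]integral_mkcond; apply: eq_integral => x _.
by rewrite patchE; case: ifPn => cx; [rewrite mem_set|rewrite memNset//; exact/negP].
Qed.

Section levy_kernel.
Context (R : realType).
Variable nubar : {measure set (measurableTypeR R) -> \bar R}.
Notation leb := (@lebesgue_measure R).
Hypothesis hmin : levy_integrable nubar.
Notation lev := (levy_restr hmin).

(** Extended by 0 to t <= 0, so that in [levy_kernel (t - K v w)] only paths still below level t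
    contribute. *)
Definition levy_kernel (t : R) : R := if 0 < t then levy_tail nubar t else 0.

Lemma levy_kernel_ge0 t : 0 <= levy_kernel t.
Proof. by rewrite /levy_kernel; case: ifP => // _; exact: levy_tail_ge0. Qed.

Lemma levy_kernelE (t : R) :
  ((levy_kernel t)%:E = \int[lev]_s (if (0 < t) && (t < s) then 1 else 0)%:E)%E.
Proof.
rewrite /levy_kernel; case: ifPn => t0 /=; last by rewrite integral0_eq.
rewrite -levy_tailE// ge0_integral_levy//; last 2 first.
- by apply/measurable_EFinP; apply: measurable_fun_ifT => //; exact: measurable_fun_ltr.
- by move=> x; rewrite lee_fin; case: ifP.
rewrite (eq_integral (fun s : measurableTypeR R => (\1_(`]t, +oo[%classic : set (measurableTypeR R)) s)%:E)); last first.
  by move=> s _; rewrite indicE mem_setE in_itv/= andbT; case: (t < s).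
rewrite integral_indic//; congr (nubar _); apply/seteqP; split => s /=.
  by rewrite !in_itv/= !andbT => ts; split => //; exact: lt_trans ts.
by case.
Qed.

Lemma measurable_levy_kernel : measurable_fun setT levy_kernel.
Proof.
apply/measurable_EFinP.
rewrite (_ : _ \o _ = fubini_F lev
  (fun p : measurableTypeR R * measurableTypeR R =>
     (if (0 < p.1) && (p.1 < p.2) then (1:R) else 0)%:E)); last first.
  by apply/funext => t; rewrite /fubini_F /= levy_kernelE.
apply: measurable_fun_fubini_tonelli_F; last by move=> p; rewrite lee_fin; case: ifP.
apply/measurable_EFinP; apply: measurable_fun_ifT => //.
by apply: measurable_and; exact: measurable_fun_ltr.
Qed.

(** Writing the tail as the mass of s > t and exchanging the integrals leaves the integral of
    e^{-xt} over 0 < t < s, which is (1 - e^{-xs}) / x. *)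
Lemma laplace_levy_kernel (x : R) : 0 < x ->
  (\int[leb]_t (levy_kernel t * expR (- (x * t)))%:E = (bernstein nubar x / x)%:E)%E.
Proof.
move=> x0.
pose f (p : measurableTypeR R * measurableTypeR R) : \bar R :=
  (if (0 < p.1) && (p.1 < p.2) then expR (- (x * p.1)) else 0)%:E.
have mf : measurable_fun setT f.
  apply/measurable_EFinP; apply: measurable_fun_ifT => //.
    by apply: measurable_and; exact: measurable_fun_ltr.
  by apply: (@measurableT_comp _ _ _ _ _ _ (fun t : R => expR (- (x * t)))) => //;
    exact: measurable_expRN.
have f0 p : (0 <= f p)%E.
  by rewrite lee_fin; case: ifP => // _; exact: expR_ge0.
transitivity (\int[leb]_t \int[lev]_s f (t, s))%E.
  apply: eq_integral => t _; rewrite EFinM levy_kernelE -ge0_integralZr//; last 2 first.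
  - apply/measurable_EFinP; apply: measurable_fun_ifT => //.
    by apply: measurable_and => //; exact: measurable_fun_ltr.
  - by move=> s _; rewrite lee_fin; case: ifP.
  by apply: eq_integral => s _; rewrite /f /= -EFinM; case: ifP => _; rewrite ?mul1r ?mul0r.
rewrite fubini_tonelli//.
rewrite EFinM bernstein_levy// -ge0_integralZr//; last 3 first.
- apply/measurable_EFinP; apply: measurable_fun_ifT => //.
  + exact: measurable_fun_ltr.
  + by apply: measurable_funB => //; exact: measurable_expRN.
- move=> s _; rewrite lee_fin; case: ifPn => // s0.
  by have /andP[] := expR_sub_ge0 (ltW x0) (ltW s0).
- by rewrite lee_fin invr_ge0 ltW.
apply: eq_integral => s _; rewrite /f /= integral_if.
case: ifPn => s0.
  rewrite (_ : [set _ | _] = `]0, s[%classic); last by apply/seteqP; split.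
  rewrite -(@integral_itv_bndoo _ 0 s _ true false)//; last first.
    by apply: measurable_funTS; apply/measurable_EFinP; exact: measurable_expRN.
  apply: (etrans (integral_expRN_itv (lt0r_neq0 x0) (ltW s0))).
  by rewrite mulr0 oppr0 expR0 EFinM.
rewrite (_ : [set _ | _] = set0); first by rewrite integral_set0 mul0e.
apply/seteqP; split => t //= /andP[t0 ts].
by move: s0; rewrite (lt_trans t0 ts).
Qed.

End levy_kernel.

Section levy_moment.
Context (R : realType).
Variable nubar : {measure set (measurableTypeR R) -> \bar R}.
Hypothesis hmin : levy_integrable nubar.
Notation lev := (levy_restr hmin).
Let mI : measurable (`]0, +oo[%classic : set (measurableTypeR R)).
Proof. exact: measurable_itv. Qed.

(** The Laplace transform of s nubar(ds), which is also f'(x). *)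
Definition levy_moment (x : R) : R :=
  \int[nubar]_(s in `]0, +oo[) (s * expR (- (x * s))).

Let mul_expRN_le_min (u s : R) : 0 < u -> 0 < s ->
  s * expR (- (u * s)) <= (1 + u^-1) * Num.min s 1.
Proof.
move=> u0 s0; have := mul_expRN_le u0 (ltW s0).
have ui : 0 < u^-1 by rewrite invr_gt0.
rewrite /Num.min; case: ifP => s1; last by lra.
move=> _; rewrite mulrC; apply: ler_wpM2r; first exact: ltW.
rewrite (@le_trans _ _ 1)//; last by rewrite lerDl ltW.
by rewrite -expR0 ler_expR oppr_le0 mulr_ge0// ltW.
Qed.

Let mmom (x : R) : measurable_fun setT (fun s : R => (s * expR (- (x * s)))%:E).
Proof. by apply/measurable_EFinP; apply: measurable_funM => //; exact: measurable_expRN. Qed.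

(** Dominates s e^{-ys} for all y > u and s > 0. The absolute value keeps it nonnegative on the
    whole line, as differentiation under the integral requires. *)
Let G (u s : R) : R := (1 + u^-1) * `|Num.min s 1|.

Let integrableG (u : R) : 0 < u -> nubar.-integrable `]0, +oo[ (fun s : R => (G u s)%:E).
Proof.
move=> u0; have := integrableZl mI (1 + u^-1) (integrable_abse (integrable_levy_min hmin)).
exact: eq_integrable.
Qed.

Lemma integrable_levy_moment (x : R) : 0 < x ->
  nubar.-integrable `]0, +oo[ (fun s : R => (s * expR (- (x * s)))%:E).
Proof.
move=> x0; apply: (le_integrable mI _ _ (integrableG x0)).
  exact: measurable_funTS (mmom x).
move=> s; rewrite /= in_itv/= andbT => s0.
rewrite lee_fin ger0_norm ?mulr_ge0 ?expR_ge0 ?(ltW s0)// /G.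
rewrite (ger0_norm (x := Num.min _ _)); last by rewrite le_min ler01 ltW.
by apply: (le_trans (mul_expRN_le_min x0 s0)); exact: ler_norm.
Qed.

Lemma levy_momentE (x : R) : 0 < x -> ((levy_moment x)%:E =
  \int[lev]_s (if 0 < s then s * expR (- (x * s)) else 0)%:E)%E.
Proof.
move=> x0; rewrite /levy_moment /Rintegral fineK; last first.
  by apply: integrable_fin_num => //; exact: integrable_levy_moment.
rewrite ge0_integral_levy//; last 2 first.
- apply/measurable_EFinP; apply: measurable_fun_ifT => //.
  + exact: measurable_fun_ltr.
  + by apply: measurable_funM => //; exact: measurable_expRN.
- by move=> s; rewrite lee_fin; case: ifPn => // s0; rewrite mulr_ge0 ?expR_ge0// ltW.
by apply: eq_integral => s; rewrite inE /= in_itv/= andbT => ->.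
Qed.

Lemma is_derive_bernstein (x : R) : 0 < x ->
  is_derive x 1 (bernstein nubar) (levy_moment x).
Proof.
(* A neighbourhood of x that stays away from 0, where the bound 1/u blows up. *)
move=> x0; pose u := x / 2; pose v := x + 1.
have u0 : 0 < u by rewrite divr_gt0.
have dF (y s : R) : is_derive y 1 (fun y : R => 1 - expR (- (y * s))) (s * expR (- (y * s))).
  have h := is_derive_expRN s 1 y.
  have -> : (fun y : R => 1 - expR (- (y * s))) = (cst 1 - (fun t => 1 * expR (- (s * t)))).
    by apply/funext => t; rewrite -[RHS]/(1 - 1 * expR (- (s * t))) mul1r [t * s]mulrC.
  apply: (is_derive_eq (is_deriveB (is_derive_cst (1 : R) y 1) h)).
  by rewrite mul1r sub0r mulNr opprK [y * s]mulrC.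
have xI : `]u, v[%classic x.
  by rewrite /= in_itv/= /u /v ltrDl ltr01 andbT; lra.
have h1 (y : R) : `]u, v[%classic y -> nubar.-integrable `]0, +oo[
    (EFin \o (fun s : measurableTypeR R => 1 - expR (- (y * s)))).
  rewrite /= in_itv/= => /andP[uy _]; apply: (integrable_levy_exp hmin).
  exact: lt_trans uy.
have h2 (y : R) (s : measurableTypeR R) : `]u, v[%classic y -> `]0, +oo[%classic s ->
    derivable ((fun (y : R) (s : measurableTypeR R) => 1 - expR (- (y * s))) ^~ s) y 1.
  by move=> _ _; apply: ex_derive; exact: dF.
have h3 (y : R) (s : measurableTypeR R) : `]u, v[%classic y -> `]0, +oo[%classic s ->
   `|partial1of2 (fun (y : R) (s : measurableTypeR R) => 1 - expR (- (y * s))) y s| <= G u s.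
  rewrite /= !in_itv/= andbT => /andP[uy _] s0.
  rewrite /partial1of2 derive1E (@derive_val _ _ _ _ _ _ _ (dF y s)).
  rewrite ger0_norm ?mulr_ge0 ?expR_ge0 ?(ltW s0)// /G.
  rewrite (ger0_norm (x := Num.min _ _)); last by rewrite le_min ler01 ltW.
  apply: le_trans (mul_expRN_le_min u0 s0).
  by rewrite ler_wpM2l ?(ltW s0)// ler_expR lerN2 ler_wpM2r ?(ltW s0)// ltW.
have G0 (s : measurableTypeR R) : 0 <= G u s.
  by rewrite mulr_ge0// addr_ge0// invr_ge0 ltW.
have iG : nubar.-integrable `]0, +oo[ (EFin \o (G u : measurableTypeR R -> R)) := integrableG u0.
apply: DeriveDef; first exact: (derivable_under_integral mI xI h1 h2 G0 iG h3).
have := differentiation_under_integral mI xI h1 h2 G0 iG h3.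
rewrite derive1E => ->; apply: eq_Rintegral => s _.
by rewrite /partial1of2 derive1E (@derive_val _ _ _ _ _ _ _ (dF x s)).
Qed.

End levy_moment.

(** Gives endpoints to the components of an open set, as absolute continuity speaks of endpoints. An
    empty component becomes []a, a[], hence the weak inequality between them. *)
Lemma open_bounded_intervalE (R : realType) (J : set R) (a b : R) :
  a <= b -> open J -> is_interval J -> J `<=` `]a, b[ ->
  exists x y, [/\ a <= x, x <= y, y <= b & J = `]x, y[%classic].
Proof.
move=> ab oJ iJ Jab; have [->|/set0P[z Jz]] := eqVneq J set0.
  by exists a, a; rewrite lexx set_itvoo0.
have lJ : has_lbound J by exists a => t /Jab; rewrite /= in_itv/= => /andP[/ltW].
have uJ : has_ubound J by exists b => t /Jab; rewrite /= in_itv/= => /andP[_ /ltW].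
have JE := interval_bounded_interior iJ lJ uJ.
rewrite (interior_id J).1 // in JE.
exists (inf J), (sup J); split.
- by apply: lb_le_inf; [exists z|move=> t /Jab; rewrite /= in_itv/= => /andP[/ltW]].
- by move: Jz; rewrite {1}JE => /= /andP[xz zy]; exact: ltW (lt_trans xz zy).
- by apply: sup_le_ub; [exists z|move=> t /Jab; rewrite /= in_itv/= => /andP[_ /ltW]].
- by rewrite {1}JE; apply/seteqP; split => t /=; rewrite in_itv.
Qed.

(** * Absolute continuity of the Levy measure *)

Section levy_dominated.
Context (R : realType).
Variable nubar : {measure set (measurableTypeR R) -> \bar R}.
Notation leb := (@lebesgue_measure R).
Hypothesis hmin : levy_integrable nubar.
Hypothesis hac : forall a b : R, 0 < a -> a <= b ->
  abs_continuous_on a b (levy_tail nubar).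
Notation lev := (levy_restr hmin).

Let levy_itv (x y : R) : 0 < x -> x <= y ->
  (nubar `]x, y[%classic <= `|levy_tail nubar y - levy_tail nubar x|%:E)%E.
Proof.
move=> x0 xy; have y0 := lt_le_trans x0 xy.
rewrite distrC ger0_norm ?subr_ge0 ?(levy_tail_le hmin)// EFinB.
rewrite leeBrDr// -!(levy_tailE hmin)// -measureU//; try exact: measurable_itv.
  apply: le_measure; rewrite ?inE; try exact: measurable_itv.
    by apply: measurableU; exact: measurable_itv.
  move=> t [|]; rewrite /= !in_itv/= !andbT; first by case/andP.
  exact: le_lt_trans.
apply/seteqP; split => // t []; rewrite /= !in_itv/= andbT => /andP[_ ty] yt.
by have := lt_trans ty yt; rewrite ltxx.
Qed.

(** Outer regularity encloses the null set in an open set of Lebesgue measure below delta; its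
    components are disjoint intervals, and their [nubar] masses are increments of the tail, of total
    size at most e. *)
Let levy_null_bounded (B : set (measurableTypeR R)) (a b : R) :
  measurable B -> leb B = 0%E -> 0 < a -> a <= b -> nubar (B `&` `]a, b[) = 0%E.
Proof.
move=> mB B0 a0 ab.
have mab : measurable (`]a, b[%classic : set (measurableTypeR R)) by exact: measurable_itv.
apply/eqP; rewrite eq_le measure_ge0 andbT.
apply/lee_addgt0Pr => e e0; rewrite add0e.
have [del del0 acd] := hac a0 ab e0.
have UB0 : (leb B < +oo)%E by rewrite B0.
have [U [oU BU UB]] := lebesgue_regularity_outer mB UB0 del0.
have mU : measurable (U : set (measurableTypeR R)) by exact: open_measurable.
have Udel : (leb U < del%:E)%E.
  rewrite -(setDUK BU); apply: le_lt_trans (measureU2 _ _ _) _ => //.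
    exact: measurableD.
  rewrite (_ : (_ + _)%E = leb (U `\` B))//.
  by rewrite -[RHS]add0e; congr (_ + _)%E.
pose V := U `&` `]a, b[%classic.
have oV : open V by apply: openI => //; exact: itv_open.
pose J := open_disjoint_itv oV.
have JV n : J n `<=` V by rewrite (open_disjoint_itv_bigcup oV); exact: bigcup_sup.
have Jab n : J n `<=` `]a, b[ by move=> t /JV[].
have /choice[x hx] : forall n, exists x, exists y,
    [/\ a <= x, x <= y, y <= b & J n = `]x, y[%classic].
  move=> n; apply: open_bounded_intervalE => //.
  - exact: open_disjoint_itv_open.
  - exact: open_disjoint_itv_is_interval.
have /choice[y hxy] := hx.
have mJ n : measurable (J n : set (measurableTypeR R)).
  by case: (hxy n) => _ _ _ ->; exact: measurable_itv.
apply: (@le_trans _ _ (nubar (\bigcup_n J n))).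
  apply: le_measure; rewrite ?inE.
  - exact: measurableI.
  - exact: bigcupT_measurable.
  - by rewrite -(open_disjoint_itv_bigcup oV) => t [/BU ? ?]; split.
have tJ : trivIset setT J  by exact: open_disjoint_itv_trivIset.
have cv := measure_semi_sigma_additive (s := nubar) J mJ tJ (bigcupT_measurable _ mJ).
(* Absolute continuity bounds finite families only, so the partial sums are bounded and the limit is
   taken afterwards. *)
rewrite -(cvg_lim _ cv)//; apply: lime_le; first by apply: cvgP; exact: cv.
apply: nearW => n; rewrite big_mkord.
apply: (@le_trans _ _ (\sum_(i < n) `|levy_tail nubar (y i) - levy_tail nubar (x i)|%:E)%E).
  apply: lee_sum => i _; case: (hxy i) => ax xy yb ->.
  exact: levy_itv (lt_le_trans a0 ax) xy.
rewrite sumEFin lee_fin ltW//; apply: acd.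
- by move=> i; case: (hxy i) => -> -> ->.
- move=> i j _ _ [t [ti tj]]; apply: val_inj; apply: (tJ _ _ I I); exists t.
  by case: (hxy i) => _ _ _ ->; case: (hxy j) => _ _ _ ->.
rewrite -lte_fin -sumEFin; apply: le_lt_trans Udel.
rewrite (eq_bigr (fun i : 'I_n => leb (J i))); last first.
  move=> i _; case: (hxy i) => _ xy _ ->; rewrite lebesgue_measure_itv/= lte_fin.
  by move: xy; rewrite le_eqVlt => /predU1P[->|->]; rewrite ?ltxx ?subrr.
rewrite -measure_bigsetU//; apply: le_measure; rewrite ?inE//.
  exact: bigsetU_measurable.
apply: (subset_trans (@bigsetU_bigcup _ J n)).
by rewrite -(open_disjoint_itv_bigcup oV); exact: subIsetl.
Qed.

(** The tail is absolutely continuous on compact subintervals of (0, oo) only; the half-line is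
    exhausted by the intervals from 1/(n+1) to n+1. *)
Lemma levy_dominated (B : set (measurableTypeR R)) :
  measurable B -> leb B = 0%E -> lev B = 0%E.
Proof.
move=> mB B0; change (nubar (B `&` `]0, +oo[) = 0%E).
have -> : B `&` `]0, +oo[ = \bigcup_n (B `&` `](n.+1%:R)^-1 : R, n.+1%:R[).
  apply/seteqP; split => [x [Bx]|x [n _ [Bx]]]; rewrite /= in_itv/= ?andbT.
    move=> x0; exists (maxn (Num.truncn x) (Num.truncn x^-1)) => //; split => //=.
    rewrite in_itv/= invf_plt ?posrE//; apply/andP; split.
      by apply: lt_le_trans (truncnS_gt _) _; rewrite ler_nat ltnS leq_maxr.
    by apply: lt_le_trans (truncnS_gt _) _; rewrite ler_nat ltnS leq_maxl.
  by move=> /andP[nx _]; split => //=; rewrite in_itv/= andbT (lt_trans _ nx).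
apply/eqP; rewrite eq_le measure_ge0 andbT.
have mBn n : measurable (B `&` `](n.+1%:R)^-1 : R, n.+1%:R[).
  by apply: measurableI => //; exact: measurable_itv.
apply: (le_trans (measure_sigma_subadditive _ mBn _ (subset_refl _))).
  exact: bigcupT_measurable.
  exact: subset_refl.
rewrite eseries0// => n _ _; apply: levy_null_bounded => //.
by rewrite (@le_trans _ _ 1)// ?invf_le1// ler1n.
Qed.

End levy_dominated.

(** * Laws of the subordinator *)

Section lebesgue_isometries.
Context (R : realType).
Notation leb := (@lebesgue_measure R).

(** A measure is Lebesgue measure as soon as it is right on the intervals ]a, b], so only their
    preimages have to be computed. *)
Let ge0_integral_preserving (X : measurableTypeR R -> measurableTypeR R)
    (mX : measurable_fun setT X) (f : measurableTypeR R -> \bar R) :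
  (forall a b : R, a <= b -> leb (X @^-1` `]a, b]) = (b - a)%:E) ->
  measurable_fun setT f -> (forall x, 0 <= f x)%E ->
  (\int[leb]_s f (X s) = \int[leb]_s f s)%E.
Proof.
move=> hX mf f0.
have w0 (s : measurableTypeR R) : (0 <= cst 1 s :> \bar R)%E by exact: lee01.
have mw : measurable_fun setT (cst 1%E : measurableTypeR R -> \bar R) by [].
pose M : {measure set (measurableTypeR R) -> \bar R} := weighted_law leb w0 mw mX.
transitivity (\int[M]_s f s)%E.
  transitivity (\int[leb]_s (1 * f (X s)))%E; last first.
    by symmetry; exact: ge0_integral_weighted_law.
  by apply: eq_integral => s _; rewrite mul1e.
symmetry; apply: eq_measure_integral => A mA _.
have ME B : measurable B -> M B = leb (X @^-1` B).
  move=> mB; rewrite [LHS](weighted_lawE leb w0 mw mX) integral_cst ?mul1e//.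
  by rewrite -[Y in measurable Y]setTI; have := mX measurableT _ mB; apply.
apply: lebesgue_measure_unique => // B.
move=> /ocitvP[->|[[a b] /= ab ->]]; first by rewrite !measure0.
rewrite ME; last exact: measurable_itv.
rewrite hX ?ltW// lebesgue_measure_itv/= lte_fin.
by rewrite ab EFinB.
Qed.

Lemma ge0_integral_shift (y : R) (f : R -> \bar R) :
  measurable_fun setT f -> (forall x, 0 <= f x)%E ->
  (\int[leb]_s f (s + y)%R = \int[leb]_s f s)%E.
Proof.
move=> mf f0.
have mX : measurable_fun setT (fun s : measurableTypeR R => s + y : measurableTypeR R).
  exact: measurable_funD.
apply: (ge0_integral_preserving mX) => // a b ab.
rewrite (_ : _ @^-1` _ = `](a - y), (b - y)]%classic); last first.
  by apply/seteqP; split => s /=; rewrite !in_itv/= ltrBlDr lerBrDr.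
rewrite lebesgue_measure_itv/= lte_fin ltrD2r; move: ab.
rewrite le_eqVlt => /predU1P[->|ab]; first by rewrite ltxx subrr.
by rewrite ab -EFinB; congr EFin; lra.
Qed.

Lemma ge0_integral_reflect (t : R) (f : R -> \bar R) :
  measurable_fun setT f -> (forall x, 0 <= f x)%E ->
  (\int[leb]_s f (t - s)%R = \int[leb]_s f s)%E.
Proof.
move=> mf f0.
have mX : measurable_fun setT (fun s : measurableTypeR R => t - s : measurableTypeR R).
  exact: measurable_funB.
apply: (ge0_integral_preserving mX) => // a b ab.
rewrite (_ : _ @^-1` _ = `[(t - b), (t - a)[%classic); last first.
  apply/seteqP; split => s /=; rewrite !in_itv/= => /andP[h1 h2]; apply/andP; split; lra.
rewrite lebesgue_measure_itv/= lte_fin ltrD2l ltrN2; move: ab.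
rewrite le_eqVlt => /predU1P[->|ab]; first by rewrite ltxx subrr.
by rewrite ab -EFinB; congr EFin; lra.
Qed.

Lemma lebesgue_shift0 (B : set (measurableTypeR R)) (y : R) : measurable B ->
  leb B = 0%E -> leb [set s | B (s + y)] = 0%E.
Proof.
move=> mB B0.
have mBy : measurable [set s : measurableTypeR R | B (s + y)].
  rewrite -[X in measurable X]setTI.
  by apply: (measurable_funD (@measurable_id _ _ setT) (@measurable_cst _ _ _ _ setT y)).
rewrite -[LHS]mul1e -integral_cst// integral_mkcond.
transitivity (\int[leb]_s (\1_B s)%:E)%E; last by rewrite integral_indic// setIT.
rewrite -(@ge0_integral_shift y (fun s => (\1_B s)%:E)).
- apply: eq_integral => s _; rewrite patchE indicE.
  have [h|h] := boolP (s + y \in B); first by rewrite mem_set //; exact/set_mem.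
  by rewrite memNset// => /mem_set; exact/negP.
- exact/measurable_EFinP.
- by move=> s; rewrite lee_fin.
Qed.

End lebesgue_isometries.

Section joint_measurability.
Context (R : realType) d (T : measurableType d).

(** By monotonicity and right-continuity, K v w < c exactly when K q w < c for some rational q > v,
    so the event is a countable union of rectangles. *)
Lemma measurable_monotone_process (K : R -> T -> R) :
  (forall v, measurable_fun setT (K v)) ->
  (forall w u v, u <= v -> K u w <= K v w) ->
  (forall w v c, K v w < c -> exists2 u, v < u & K u w < c) ->
  measurable_fun setT (fun p : measurableTypeR R * T => K p.1 p.2).
Proof.
move=> mK ndK rcK; apply: (measurability _ (RGenInftyO.measurableE R)) => //.
move=> _ [_ [c ->] <-]; rewrite setTI.
rewrite (_ : _ @^-1` _ = \bigcup_(q in [set: rat])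
    (`]-oo, (ratr q : R)[%classic `*` (K (ratr q) @^-1` `]-oo, c[))); last first.
  apply/seteqP; split => [[v w] /=|[v w] [q _] /= []]; rewrite !in_itv/=.
    move=> /rcK[u vu Kuc]; have [q] := rat_in_itvoo vu.
    rewrite in_itv/= => /andP[vq qu]; exists q => //=; rewrite !in_itv/=; split => //.
    exact: le_lt_trans (ndK _ _ _ (ltW qu)) Kuc.
  by move=> vq; apply: le_lt_trans; exact/ndK/ltW.
apply: bigcupT_measurable_rat => q; apply: measurableX; first exact: measurable_itv.
by rewrite -[X in measurable X]setTI; apply: mK => //; exact: measurable_itv.
Qed.

End joint_measurability.

(** Working interface to the subordinator. The path properties hold for every path and every real v,
    which makes the flow jointly measurable on the whole product; [flow_right_continuous] is
    right-continuity of a nondecreasing path in threshold form. The semigroup property is read off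
    the one-dimensional laws in [flow_laplace]. *)
Record subordinator_flow (R : realType) d (T : measurableType d)
    (P : probability T R) (f : R -> R) (K : R -> T -> R) : Prop := {
  flow_measurable : forall v, measurable_fun setT (K v);
  flow_ge0 : forall v w, 0 <= K v w;
  flow_start : forall w, K 0 w = 0;
  flow_nondecreasing : forall w u v, u <= v -> K u w <= K v w;
  flow_right_continuous : forall w v c, K v w < c -> exists2 u, v < u & K u w < c;
  flow_laplace : forall v x, 0 <= v -> 0 < x ->
    (\int[P]_w (expR (- (x * K v w)))%:E = (expR (- (v * f x)))%:E)%E }.

Section subordinator_flow_moments_section.
Context (R : realType) d (T : measurableType d) (P : probability T R).
Variable nubar : {measure set (measurableTypeR R) -> \bar R}.
Hypothesis hmin : levy_integrable nubar.
Hypothesis hinf : nubar `]0, +oo[%classic = +oo%E.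
Notation f := (bernstein nubar).
Variable K : R -> T -> R.
Hypothesis hK : subordinator_flow P f K.

Let mK v : measurable_fun setT (K v) := flow_measurable hK v.
Let K0 v w : 0 <= K v w := flow_ge0 hK v w.

Lemma measurable_flow :
  measurable_fun setT (fun p : measurableTypeR R * T => K p.1 p.2).
Proof.
apply: measurable_monotone_process.
- exact: mK.
- exact: flow_nondecreasing hK.
- exact: flow_right_continuous hK.
Qed.

Lemma flow_event_measurable v t : measurable [set w | K v w <= t].
Proof.
rewrite (_ : [set _ | _] = K v @^-1` `]-oo, t]); last first.
  by apply/seteqP; split => w /=; rewrite in_itv.
by rewrite -[X in measurable X]setTI; apply: mK => //; exact: measurable_itv.
Qed.

Lemma measurable_exp_flow x v : measurable_fun setT (fun w => expR (- (x * K v w))).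
Proof.
by apply: (@measurableT_comp _ _ _ _ _ _ (fun t : R => expR (- (x * t)))) => //;
  exact: measurable_expRN.
Qed.

(** Markov's inequality for e^{-xK}, with x left free to be tuned to f. *)
Lemma flow_chernoff v t x : 0 <= v -> 0 < x ->
  (P [set w | (K v w <= t)%R] <= (expR (x * t) * expR (- (v * f x)))%:E)%E.
Proof.
move=> v0 x0.
have mA := flow_event_measurable v t.
rewrite EFinM -(flow_laplace hK v0 x0) -ge0_integralZl//; last first.
  by apply/measurable_EFinP; exact: measurable_exp_flow.
rewrite -[leLHS]mul1e -integral_cst// integral_mkcond.
apply: ge0_le_integral => //.
- by move=> w _; rewrite patchE; case: ifP => //; rewrite lee_fin.
- by apply/(measurable_restrictT _ _).1.
- apply: emeasurable_funM => //.
  by apply/measurable_EFinP; exact: measurable_exp_flow.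
- move=> w _; rewrite patchE; case: ifPn => wA; last first.
    by rewrite mule_ge0// lee_fin expR_ge0.
  rewrite -EFinM lee_fin -expRD -[leLHS]expR0 ler_expR -mulrBr mulr_ge0 ?(ltW x0)//.
  by rewrite subr_ge0; move/set_mem: wA.
Qed.

(** At level 0 Chernoff's bound is e^{-v f(x)}, arbitrarily small because f is unbounded. *)
Lemma flow_pos v : 0 < v -> P [set w | K v w <= 0] = 0%E.
Proof.
move=> v0; apply/eqP; rewrite eq_le measure_ge0 andbT.
apply/lee_addgt0Pr => e e0; rewrite add0e.
(* This x makes v f(x) >= 1/e, and exp(1/e) >= 1/e turns the bound into e. *)
have [x x0 fx] := bernstein_unbounded hmin (v^-1 * e^-1) hinf.
apply: le_trans (flow_chernoff 0 (ltW v0) x0) _.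
rewrite mulr0 expR0 mul1r lee_fin expRN -[leRHS]invrK lef_pV2 ?posrE ?expR_gt0 ?invr_gt0//.
apply: le_trans (expR_ge1Dx _).
rewrite (@le_trans _ _ (v * (v^-1 * e^-1)))//.
  by rewrite mulrA divff ?gt_eqF// mul1r.
by rewrite (@le_trans _ _ (v * f x)) ?lerDr// ler_wpM2l// ltW.
Qed.

(** Both sides of [flow_laplace] are differentiated in x; on the left the derivative is dominated by
    the constant 1/u near x. *)
Lemma flow_moment v x : 0 <= v -> 0 < x ->
  (\int[P]_w (K v w * expR (- (x * K v w)))%:E =
   (v * levy_moment nubar x * expR (- (v * f x)))%:E)%E.
Proof.
move=> v0 x0; pose u := x / 2; pose V := x + 1.
have u0 : 0 < u by rewrite divr_gt0.
have xI : `]u, V[%classic x.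
  by rewrite /= in_itv/= /u /V ltrDl ltr01 andbT; lra.
pose g (y : R) (w : T) := expR (- (y * K v w)).
have dg (y : R) (w : T) : is_derive y 1 (g ^~ w) (- K v w * g y w).
  have -> : g ^~ w = (fun t => 1 * expR (- (K v w * t))).
    by apply/funext => t; rewrite /g mul1r [t * _]mulrC.
  apply: (is_derive_eq (is_derive_expRN (K v w) 1 y)).
  by rewrite mul1r /g [y * _]mulrC.
have mg y : measurable_fun setT (g y) by exact: measurable_exp_flow.
have h1 (y : R) : `]u, V[%classic y -> P.-integrable setT (EFin \o g y).
  rewrite /= in_itv/= => /andP[uy _]; apply: measurable_bounded_integrable => //.
    exact: (le_lt_trans (probability_le1 P measurableT) (ltry 1)).
  exists 1; split => // M M1 w _; rewrite /= ger0_norm ?expR_ge0//.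
  rewrite (le_trans _ (ltW M1))// -expR0 ler_expR oppr_le0 mulr_ge0// ltW//.
  exact: lt_trans uy.
have h2 (y : R) (w : T) : `]u, V[%classic y -> [set: T] w -> derivable (g ^~ w) y 1.
  by move=> _ _; apply: ex_derive; exact: dg.
have d1E (y : R) (w : T) : partial1of2 g y w = - K v w * g y w.
  by rewrite /partial1of2 derive1E (@derive_val _ _ _ _ _ _ _ (dg y w)).
have h3 (y : R) (w : T) : `]u, V[%classic y -> [set: T] w ->
    `|partial1of2 g y w| <= cst u^-1 w.
  rewrite /= !in_itv/= => /andP[uy _] _.
  rewrite d1E normrM normrN !ger0_norm ?expR_ge0//.
  apply: le_trans (mul_expRN_le u0 (K0 v w)).
  by rewrite ler_wpM2l// ler_expR lerN2 ler_wpM2r// ltW.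
have G0 (w : T) : 0 <= (cst u^-1 : T -> R) w by rewrite invr_ge0 ltW.
have iG : P.-integrable setT (EFin \o (cst u^-1 : T -> R)).
  exact: finite_measure_integrable_cst.
have dF := differentiation_under_integral measurableT xI h1 h2 G0 iG h3.
have FE (y : R) : 0 < y -> \int[P]_(w in setT) g y w = expR (- (v * f y)).
  by move=> y0; rewrite /Rintegral (flow_laplace hK).
have dE : is_derive x 1 (fun y => expR (- (v * f y)))
    (- (v * levy_moment nubar x * expR (- (v * f x)))).
  have h := is_deriveZ (- v) (is_derive_bernstein hmin x0).
  have h' := @is_derive1_comp _ expR (- v \*: f) x _ _ (is_derive_expR _) h.
  have -> : (fun y => expR (- (v * f y))) = expR \o (- v \*: f).
    by apply/funext => y; rewrite /= /GRing.scale /= mulNr.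
  apply: (is_derive_eq h'); rewrite /GRing.scale /=.
  by rewrite -[- v *: f x]/(- v * f x) !mulNr; ring.
have : derive1 (fun y => \int[P]_(w in setT) g y w) x =
    - (v * levy_moment nubar x * expR (- (v * f x))).
  rewrite derive1E -(@derive_val _ _ _ _ _ _ _ dE); apply: near_eq_derive.
  near=> y; apply: FE; near: y; exact: lt_nbhsr.
rewrite dF => h.
have iK : P.-integrable setT (fun w => (K v w * g x w)%:E).
  apply: (le_integrable measurableT _ _ iG).
    by apply/measurable_EFinP; apply: measurable_funM.
  move=> w _; have := h3 x w xI I; rewrite d1E lee_fin mulNr normrN => h'.
  by rewrite (le_trans h')// ler_norm.
rewrite -[LHS]fineK; last exact: integrable_fin_num.
congr EFin; apply: oppr_inj; rewrite -h.
rewrite -mulN1r -[X in -1 * X]/(\int[P]_(w in setT) (K v w * g x w)) -RintegralZl//.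
by apply: eq_Rintegral => w _; rewrite d1E; ring.
Unshelve. all: by end_near. Qed.

End subordinator_flow_moments_section.

Section steutel_identity_section.
Context (R : realType) d (T : measurableType d) (P : probability T R).
Variable nubar : {measure set (measurableTypeR R) -> \bar R}.
Hypothesis hmin : levy_integrable nubar.
Notation lev := (levy_restr hmin).
Notation f := (bernstein nubar).
Variable K : R -> T -> R.
Hypothesis hK : subordinator_flow P f K.

Let mK v : measurable_fun setT (K v) := flow_measurable hK v.
Let K0 v w : 0 <= K v w := flow_ge0 hK v w.

(* Steutel's identity: differentiating [E e^{-xK} = e^{-v f(x)}] in [x] shows
   that [y P(K in dy)] is [v] times the convolution of [s nubar(ds)] with the
   law of [K]. *)
Lemma flow_steutel v (h : R -> \bar R) : 0 <= v ->
  measurable_fun setT h -> (forall y, 0 <= h y)%E ->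
  (\int[P]_w ((K v w * expR (- K v w))%:E * h (K v w)) =
   \int[lev \x P]_p ((if 0 < p.1 then v * (p.1 * expR (- p.1) * expR (- K v p.2)) else 0)%:E *
     h (Num.max p.1 0 + K v p.2)%R))%E.
Proof.
move=> v0 mh h0.
(* The tilt by e^{-y} makes the measures finite and moves the integer n to the argument c = n + 1 >
   0, where [flow_moment] applies. Off the positive half-line the weight is 0, so the maximum in
   [X2] only makes the variable nonnegative everywhere. *)
pose w1 (w : T) : \bar R := (K v w * expR (- K v w))%:E.
pose w2 (p : measurableTypeR R * T) : \bar R :=
  (if 0 < p.1 then v * (p.1 * expR (- p.1) * expR (- K v p.2)) else 0)%:E.
pose X2 (p : measurableTypeR R * T) : R := Num.max p.1 0 + K v p.2.
have mexp1 : measurable_fun setT (fun t : R => expR (- t)) by exact: measurableT_comp.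
have mp1 : measurable_fun setT (fun p : measurableTypeR R * T => p.1 : R) by exact: measurable_fst.
have mp2 : measurable_fun setT (fun p : measurableTypeR R * T => K v p.2).
  exact: measurableT_comp.
have w10 w : (0 <= w1 w)%E by rewrite lee_fin mulr_ge0 ?expR_ge0.
have w20 p : (0 <= w2 p)%E.
  rewrite lee_fin; case: ifPn => // p0.
  by rewrite !mulr_ge0 ?expR_ge0// ltW.
have mw1 : measurable_fun setT w1.
  apply/measurable_EFinP; apply: measurable_funM => //.
  exact: (measurableT_comp mexp1).
have mw2 : measurable_fun setT w2.
  apply/measurable_EFinP; apply: measurable_fun_ifT => //.
    exact: measurable_fun_ltr.
  apply: measurable_funM => //; apply: measurable_funM => //.
    apply: measurable_funM => //; exact: (measurableT_comp mexp1).
  exact: (measurableT_comp mexp1).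
have mX2 : measurable_fun setT X2.
  by apply: measurable_funD => //; exact: measurable_maxr.
have X20 p : 0 <= X2 p by rewrite addr_ge0// le_max lexx orbT.
have lap1 (n : nat) (c : R) : 0 < c -> n%:R = c - 1 ->
    (\int[P]_w (w1 w * (expR (- (n%:R * K v w)))%:E) =
    (v * levy_moment nubar c * expR (- (v * f c)))%:E)%E.
  move=> c0 ->; have <- := flow_moment hmin hK v0 c0; apply: eq_integral => w _.
  rewrite /w1 -EFinM -mulrA -expRD; congr (_ * expR _)%:E.
  by rewrite mulrBl mul1r opprB addKr.
have lap2 (n : nat) (c : R) : 0 < c -> n%:R = c - 1 ->
    (\int[lev \x P]_p (w2 p * (expR (- (n%:R * X2 p)))%:E) =
    (v * levy_moment nubar c * expR (- (v * f c)))%:E)%E.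
  move=> c0 ->.
  rewrite fubini_tonelli1; last 2 first.
  - apply: emeasurable_funM => //; apply/measurable_EFinP.
    by apply: (@measurableT_comp _ _ _ _ _ _ (fun t : R => expR (- ((c - 1) * t)))) => //;
      exact: measurable_expRN.
  - by move=> p; rewrite mule_ge0// lee_fin expR_ge0.
  have hl := flow_laplace hK v0 c0.
  move: (expR (- (v * f c))) hl (expR_ge0 (- (v * f c))) => e hl e0.
  transitivity (\int[lev]_s ((if 0 < s then s * expR (- (c * s)) else 0)%:E *
      (v * e)%:E))%E.
    apply: eq_integral => s _; rewrite /fubini_F /w2 /X2 /=.
    case: ifPn => s0; last first.
      by rewrite integral0_eq ?mul0e// => w _; rewrite mul0e.
    rewrite (max_l (ltW s0)).
    transitivity (\int[P]_y ((v * (s * expR (- (c * s))))%:E * (expR (- (c * K v y)))%:E))%E.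
      apply: eq_integral => w _; rewrite -!EFinM; congr EFin.
      rewrite -!mulrA; congr (v * (s * _)); rewrite -!expRD; congr expR; ring.
    rewrite ge0_integralZl//.
    - by rewrite hl -EFinM; congr EFin; ring.
    - by apply/measurable_EFinP; exact: (measurable_exp_flow hK).
    - by rewrite lee_fin !mulr_ge0 ?expR_ge0// ltW.
  rewrite ge0_integralZr//; last 3 first.
  - apply/measurable_EFinP; apply: measurable_fun_ifT => //.
      exact: measurable_fun_ltr.
    by apply: measurable_funM => //; exact: measurable_expRN.
  - by move=> s _; rewrite lee_fin; case: ifPn => // s0; rewrite mulr_ge0 ?expR_ge0// ltW.
  - by rewrite lee_fin mulr_ge0.
  by rewrite -levy_momentE// -EFinM; congr EFin; rewrite mulrA [_ * v]mulrC.
have nE (n : nat) : n%:R = n.+1%:R - 1 :> R by rewrite -natr1 addrK.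
apply: (@laplace_law_unique _ _ T (measurableTypeR R * T)%type R P (lev \x P)%E
  w1 w2 (K v) X2) => //.
- rewrite (_ : (\int[P]_w w1 w)%E = (\int[P]_w (w1 w * (expR (- (0%N%:R * K v w)))%:E))%E).
    by rewrite (lap1 0%N 1) ?ltry// subrr.
  by apply: eq_integral => w _; rewrite mul0r oppr0 expR0 mule1.
- by move=> n; rewrite (lap1 n _ (ltr0Sn R n) (nE n)) (lap2 n _ (ltr0Sn R n) (nE n)).
Qed.

End steutel_identity_section.

Section flow_dominated_section.
Context (R : realType) d (T : measurableType d) (P : probability T R).
Variable nubar : {measure set (measurableTypeR R) -> \bar R}.
Notation leb := (@lebesgue_measure R).
Hypothesis hmin : levy_integrable nubar.
Hypothesis hinf : nubar `]0, +oo[%classic = +oo%E.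
Hypothesis hac : forall a b : R, 0 < a -> a <= b ->
  abs_continuous_on a b (levy_tail nubar).
Notation lev := (levy_restr hmin).
Notation f := (bernstein nubar).
Variable K : R -> T -> R.
Hypothesis hK : subordinator_flow P f K.

Let mK v : measurable_fun setT (K v) := flow_measurable hK v.
Let K0 v w : 0 <= K v w := flow_ge0 hK v w.

(** Take the indicator of [B] in Steutel's identity. For fixed w the inner integral is over a
    translate of [B], null for the Levy measure, so K e^{-K} vanishes almost surely on the event K
    in [B]; and K > 0 almost surely. *)
Lemma flow_dominated v (B : set (measurableTypeR R)) : 0 < v -> measurable B ->
  leb B = 0%E -> P (K v @^-1` B) = 0%E.
Proof.
move=> v0 mB B0.
have mKB (A : set (measurableTypeR R)) : measurable A -> measurable (K v @^-1` A).
  by move=> mA; rewrite -[X in measurable X]setTI; exact: mK.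
have mI : measurable_fun setT (fun y : R => (\1_B y)%:E : \bar R).
  by apply/measurable_EFinP.
have I0 (y : R) : (0 <= (\1_B y)%:E :> \bar R)%E by rewrite lee_fin.
have := flow_steutel hmin hK (ltW v0) mI I0.
rewrite fubini_tonelli2; last 2 first.
- have mp1 : measurable_fun setT (fun p : measurableTypeR R * T => p.1 : R) by exact: measurable_fst.
  have mp2 : measurable_fun setT (fun p : measurableTypeR R * T => K v p.2).
    exact: measurableT_comp.
  have mexp1 : measurable_fun setT (fun t : R => expR (- t)) by exact: measurableT_comp.
  apply: emeasurable_funM; last first.
    apply: (measurableT_comp mI); apply: measurable_funD => //; exact: measurable_maxr.
  apply/measurable_EFinP; apply: measurable_fun_ifT => //; first exact: measurable_fun_ltr.
  apply: measurable_funM => //; apply: measurable_funM => //.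
    by apply: measurable_funM => //; exact: (measurableT_comp mexp1).
  exact: (measurableT_comp mexp1).
- move=> p; rewrite mule_ge0// lee_fin//; case: ifPn => // p0.
  by rewrite !mulr_ge0 ?expR_ge0// ltW.
rewrite [X in _ = X]integral0_eq; last first.
  move=> w _; rewrite /fubini_G /=.
  have mBw : measurable [set s : measurableTypeR R | B (s + K v w)].
    rewrite -[X in measurable X]setTI.
    by apply: (measurable_funD (@measurable_id _ _ setT) (@measurable_cst _ _ _ _ setT (K v w))).
  rewrite (@ge0_negligible_integral _ _ _ lev setT [set s | B (s + K v w)])//.
  - rewrite integral0_eq// => s [_ /= nB]; case: ifPn => s0; last by rewrite mul0e.
    by rewrite (max_l (ltW s0)) indicE memNset// mule0.
  - apply: emeasurable_funM.
      apply/measurable_EFinP; apply: measurable_fun_ifT => //; first exact: measurable_fun_ltr.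
      apply: measurable_funM => //; apply: measurable_funM => //.
      by apply: measurable_funM => //; apply: measurableT_comp.
    apply: (measurableT_comp mI); apply: measurable_funD => //.
    exact: measurable_maxr.
  - move=> s _; rewrite mule_ge0// lee_fin//; case: ifPn => // s0.
    by rewrite !mulr_ge0 ?expR_ge0// ltW.
  - by apply: levy_dominated => //; exact: lebesgue_shift0.
move=> i0.
have mg : measurable_fun setT (fun w => (K v w * expR (- K v w))%:E * (\1_B (K v w))%:E)%E.
  apply: emeasurable_funM; last exact: (measurableT_comp mI).
  apply/measurable_EFinP; apply: measurable_funM => //.
  by do 2 apply: measurableT_comp => //.
have : (\int[P]_w `|(K v w * expR (- K v w))%:E * (\1_B (K v w))%:E| = 0)%E.
  rewrite -i0; apply: eq_integral => w _; rewrite gee0_abs//.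
  by rewrite mule_ge0// lee_fin mulr_ge0 ?expR_ge0.
move/(ae_eq_integral_abs _ measurableT mg) => [N [mN N0 IN]].
apply/eqP; rewrite eq_le measure_ge0 andbT.
have mK0 : measurable [set w | K v w <= 0].
  rewrite (_ : [set _ | _] = K v @^-1` `]-oo, 0]); first by apply: mKB; exact: measurable_itv.
  by apply/seteqP; split => w /=; rewrite in_itv.
apply: (@le_trans _ _ (P (N `|` [set w | K v w <= 0]))).
  apply: le_measure; rewrite ?inE; [exact: mKB|exact: measurableU|].
  move=> w /= BKw; have [K00|K00] := leP (K v w) 0; [by right|left].
  apply: IN => /= /(_ Logic.I) /eqP; rewrite indicE mem_set// mule1 eqe mulf_eq0.
  by rewrite !gt_eqF ?expR_gt0.
apply: (le_trans (measureU2 _ _ _)) => //.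
rewrite (_ : (_ + _)%E = 0%E)// -[RHS]add0e; congr (_ + _)%E; first exact: N0.
exact: (flow_pos hmin hinf hK v0).
Qed.

End flow_dominated_section.

(* The library's sigma-finiteness instance for [\x] is not found by inference,
   hence this copy. *)
Section sigma_finite_product.
Local Open Scope ereal_scope.
Context d1 d2 (T1 : measurableType d1) (T2 : measurableType d2) (R : realType).
Variables (m1 : {sigma_finite_measure set T1 -> \bar R})
  (m2 : {sigma_finite_measure set T2 -> \bar R}).

Definition sigma_finite_product : set (T1 * T2) -> \bar R := m1 \x m2.

HB.instance Definition _ := Measure.copy sigma_finite_product (m1 \x m2).

Let sfp_sigma_finite : sigma_finite setT sigma_finite_product.
Proof.
have /sigma_finiteP[F [TF ndF Foo]] := sigma_finiteT m1.
have /sigma_finiteP[G [TG ndG Goo]] := sigma_finiteT m2.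
exists (fun n => F n `*` G n).
  rewrite -setXTT TF TG predeqE => -[x y]; split.
    move=> [/= [n _ Fnx] [k _ Gky]]; exists (maxn n k) => //; split.
    - by move: x Fnx; exact/subsetPset/ndF/leq_maxl.
    - by move: y Gky; exact/subsetPset/ndG/leq_maxr.
  by move=> [n _ []/= ? ?]; split; exists n.
move=> k; have [? ?] := Foo k; have [? ?] := Goo k.
split; first exact: measurableX.
by rewrite /sigma_finite_product product_measure1E// lte_mul_pinfty// ge0_fin_numE.
Qed.

HB.instance Definition _ := @Measure_isSigmaFinite.Build _ _ _
  sigma_finite_product sfp_sigma_finite.

Lemma sigma_finite_product_tonelli1 (f : T1 * T2 -> \bar R) :
  measurable_fun setT f -> (forall x, 0 <= f x) ->
  \int[sigma_finite_product]_z f z = \int[m1]_x \int[m2]_y f (x, y).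
Proof. exact: fubini_tonelli1. Qed.

Lemma sigma_finite_product_tonelli2 (f : T1 * T2 -> \bar R) :
  measurable_fun setT f -> (forall x, 0 <= f x) ->
  \int[sigma_finite_product]_z f z = \int[m2]_y \int[m1]_x f (x, y).
Proof. exact: fubini_tonelli2. Qed.

End sigma_finite_product.
Arguments sigma_finite_product {d1 d2 T1 T2 R}.

(** * The potential kernel and its identity with the survival function *)

Section potential_kernel_section.
Context (R : realType) d (T : measurableType d) (P : probability T R).
Variable nubar : {measure set (measurableTypeR R) -> \bar R}.
Notation leb := (@lebesgue_measure R).
Hypothesis hmin : levy_integrable nubar.
Hypothesis hinf : nubar `]0, +oo[%classic = +oo%E.
Notation lebP := (sigma_finite_product leb P).
Notation f := (bernstein nubar).
Variable K : R -> T -> R.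
Hypothesis hK : subordinator_flow P f K.

Let mK v : measurable_fun setT (K v) := flow_measurable hK v.
Let K0 v w : 0 <= K v w := flow_ge0 hK v w.

(** The integral of E nu(t - K_v) over a < v < b: the mass that the candidate density of the passage
    time gives to []a, b[]. *)
Definition potential_kernel (a b t : R) : \bar R :=
  (\int[lebP]_p
    (if (a < p.1)%R && (p.1 < b)%R then levy_kernel nubar (t - K p.1 p.2) else 0)%:E)%E.

Let measurable_kernel_flow : measurable_fun setT
  (fun q : measurableTypeR R * (measurableTypeR R * T) =>
    levy_kernel nubar (q.1 - K q.2.1 q.2.2)).
Proof.
apply: (measurableT_comp (measurable_levy_kernel hmin)).
apply: measurable_funB; first exact: measurable_fst.
exact: (measurableT_comp (measurable_flow hK) (@measurable_snd _ _ _ _)).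
Qed.

Let mpk (a b : R) : measurable_fun setT
  (fun q : measurableTypeR R * (measurableTypeR R * T) =>
    (if (a < q.2.1)%R && (q.2.1 < b)%R then levy_kernel nubar (q.1 - K q.2.1 q.2.2) else 0)%:E).
Proof.
have m21 : measurable_fun setT (fun q : measurableTypeR R * (measurableTypeR R * T) => q.2.1 : R).
  exact: (measurableT_comp (@measurable_fst _ _ _ _) (@measurable_snd _ _ _ _)).
apply/measurable_EFinP; apply: measurable_fun_ifT => //.
by apply: measurable_and; exact: measurable_fun_ltr.
Qed.

Let pk0 (a b : R) (q : measurableTypeR R * (measurableTypeR R * T)) :
  (0 <= (if (a < q.2.1)%R && (q.2.1 < b)%R then levy_kernel nubar (q.1 - K q.2.1 q.2.2) else 0)%:E)%E.
Proof. by rewrite lee_fin; case: ifP => // _; exact: levy_kernel_ge0. Qed.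

Lemma potential_kernel_ge0 a b t : (0 <= potential_kernel a b t)%E.
Proof. by apply: integral_ge0 => p _; exact: (pk0 a b (t, p)). Qed.

Lemma measurable_potential_kernel a b : measurable_fun setT (potential_kernel a b).
Proof.
have h := measurable_fun_fubini_tonelli_F  _ (mpk a b) (pk0 a b).
exact: h.
Qed.

(** Transforming in t first gives e^{-c K_v} f(c)/c; its expectation is e^{-v f(c)} f(c)/c,
    integrated over 0 < v < a. Positivity of f(c) permits the final division. *)
Lemma laplace_potential_kernel a c : 0 <= a -> 0 < c ->
  (\int[leb]_t ((expR (- (c * t)))%:E * potential_kernel 0 a t) =
   ((1 - expR (- (a * f c))) / c)%:E)%E.
Proof.
move=> a0 c0.
have fc0 := bernstein_gt0 hmin hinf c0.
transitivity (\int[leb]_t \int[lebP]_p ((expR (- (c * t)))%:E *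
    (if (0 < p.1)%R && (p.1 < a)%R then levy_kernel nubar (t - K p.1 p.2) else 0)%:E))%E.
  apply: eq_integral => t _; rewrite ge0_integralZl//.
  - exact: (measurableT_comp (mpk 0 a) (measurable_pair1 t)).
  - by move=> p _; exact: (pk0 0 a (t, p)).
rewrite (fubini_tonelli  (fun q : measurableTypeR R * (measurableTypeR R * T) =>
  ((expR (- (c * q.1)))%:E * (if (0 < q.2.1)%R && (q.2.1 < a)%R
    then levy_kernel nubar (q.1 - K q.2.1 q.2.2) else 0)%:E)%E)); last 2 first.
- apply: emeasurable_funM; last exact: mpk.
  apply/measurable_EFinP; apply: (measurableT_comp (measurable_expRN c)).
  exact: measurable_fst.
- by move=> q; rewrite mule_ge0// lee_fin expR_ge0.
transitivity (\int[lebP]_p ((if (0 < p.1)%R && (p.1 < a)%R then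
    expR (- (c * K p.1 p.2)) else 0)%:E * (f c / c)%:E))%E.
  apply: eq_integral => -[v w] _ /=; case: ifPn => va; last first.
    by rewrite mul0e integral0_eq// => t _; rewrite mule0.
  have mkern : measurable_fun setT
      (fun x : measurableTypeR R => (levy_kernel nubar x * expR (- (c * x)))%:E).
    apply/measurable_EFinP; apply: measurable_funM; last exact: measurable_expRN.
    exact: measurable_levy_kernel.
  have kern0 (x : measurableTypeR R) : (0 <= (levy_kernel nubar x * expR (- (c * x)))%:E)%E.
    by rewrite lee_fin mulr_ge0 ?expR_ge0 ?levy_kernel_ge0.
  rewrite -(laplace_levy_kernel hmin)// -ge0_integralZl//.
  pose g (x : R) := ((expR (- (c * K v w)))%:E * (levy_kernel nubar x * expR (- (c * x)))%:E)%E.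
  have mg : measurable_fun setT g by apply: emeasurable_funM.
  have g0 x : (0 <= g x)%E by rewrite mule_ge0// lee_fin expR_ge0.
  rewrite -[RHS](ge0_integral_shift (- K v w) mg g0).
  apply: eq_integral => t _; rewrite /g -!EFinM; congr EFin.
  rewrite mulrBr opprB expRD; move: (levy_kernel _ _) => k.
  rewrite [LHS]mulrC mulrCA; congr (k * _).
  by rewrite mulrA -expRD addNr expR0 mul1r.
have mexp : measurable_fun setT (fun p : measurableTypeR R * T =>
    (if (0 < p.1)%R && (p.1 < a)%R then expR (- (c * K p.1 p.2)) else 0)%:E).
  have m1 : measurable_fun setT (fun p : measurableTypeR R * T => p.1 : R) by exact: measurable_fst.
  apply/measurable_EFinP; apply: measurable_fun_ifT => //.
    by apply: measurable_and; exact: measurable_fun_ltr.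
  exact: (measurableT_comp (measurable_expRN c) (measurable_flow hK)).
have exp0 (p : measurableTypeR R * T) :
    (0 <= (if (0 < p.1)%R && (p.1 < a)%R then expR (- (c * K p.1 p.2)) else 0)%:E)%E.
  by rewrite lee_fin; case: ifP => // _; exact: expR_ge0.
rewrite ge0_integralZr//; last by rewrite lee_fin divr_ge0// ltW.
rewrite sigma_finite_product_tonelli1//.
transitivity ((\int[leb]_v (if (0 < v) && (v < a) then expR (- (f c * v)) else 0)%:E) * (f c / c)%:E)%E.
  congr (_ * _)%E; apply: eq_integral => v _ /=; case: ifPn => va.
    by rewrite (flow_laplace hK)// 1?mulrC// ltW//; case/andP: va.
  by rewrite integral0_eq.
rewrite integral_if (_ : [set _ | _] = `]0, a[%classic); last by apply/seteqP; split.
rewrite -(@integral_itv_bndoo _ 0 a _ true false)//; last first.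
  by apply: measurable_funTS; apply/measurable_EFinP; exact: measurable_expRN.
rewrite (_ : (\int[_]_(_ in _) _)%E = ((1 - expR (- (a * f c))) / f c)%:E).
  by rewrite -EFinM; congr EFin; field; rewrite !gt_eqF.
apply: (etrans (integral_expRN_itv (lt0r_neq0 fc0) a0)).
by rewrite mulr0 oppr0 expR0 mulrC [f c * a]mulrC mulrC.
Qed.

(** The probability of K_a > t, cut to 0 at t <= 0 where it would be 1 or undetermined by a
    one-sided Laplace transform. *)
Definition survival (a t : R) : \bar R :=
  (\int[P]_w (if (0 < t)%R && (t < K a w)%R then 1 else 0)%:E)%E.

Let msurv a : measurable_fun setT (fun q : measurableTypeR R * T =>
  (if (0 < q.1)%R && (q.1 < K a q.2)%R then 1 else 0 : R)%:E).
Proof.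
have m1 : measurable_fun setT (fun p : measurableTypeR R * T => p.1 : R) by exact: measurable_fst.
have m2 : measurable_fun setT (fun p : measurableTypeR R * T => K a p.2).
  exact: measurableT_comp.
by apply/measurable_EFinP; apply: measurable_fun_ifT => //;
  apply: measurable_and; exact: measurable_fun_ltr.
Qed.

Let surv0 a (q : measurableTypeR R * T) :
  (0 <= (if (0 < q.1)%R && (q.1 < K a q.2)%R then 1 else 0 : R)%:E)%E.
Proof. by rewrite lee_fin; case: ifP. Qed.

Lemma measurable_survival a : measurable_fun setT (survival a).
Proof.
exact: (measurable_fun_fubini_tonelli_F _ (msurv a) (surv0 a)).
Qed.

Lemma survival_ge0 a t : (0 <= survival a t)%E.
Proof. by apply: integral_ge0 => w _; exact: (surv0 a (t, w)). Qed.

Lemma laplace_survival a c : 0 <= a -> 0 < c ->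
  (\int[leb]_t ((expR (- (c * t)))%:E * survival a t) =
   ((1 - expR (- (a * f c))) / c)%:E)%E.
Proof.
move=> a0 c0.
have mexp : measurable_fun setT (fun q : measurableTypeR R * T => (expR (- (c * q.1)))%:E).
  apply/measurable_EFinP; apply: (measurableT_comp (measurable_expRN c)).
  exact: measurable_fst.
transitivity (\int[leb]_t \int[P]_w ((expR (- (c * t)))%:E *
    (if (0 < t)%R && (t < K a w)%R then 1 else 0 : R)%:E))%E.
  apply: eq_integral => t _; rewrite ge0_integralZl//.
  - exact: (measurableT_comp (msurv a) (measurable_pair1 t)).
  - by move=> w _; exact: (surv0 a (t, w)).
rewrite (fubini_tonelli (fun q : measurableTypeR R * T =>
  ((expR (- (c * q.1)))%:E * (if (0 < q.1)%R && (q.1 < K a q.2)%R then 1 else 0 : R)%:E)%E)); last 2 first.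
- exact: emeasurable_funM.
- by move=> q; rewrite mule_ge0// lee_fin expR_ge0.
transitivity (\int[P]_w ((1 - expR (- (c * K a w)))%:E * (c^-1)%:E))%E.
  apply: eq_integral => w _ /=.
  under eq_integral => t _.
    rewrite -EFinM (_ : _ * _ = if (0 < t) && (t < K a w) then expR (- (c * t)) else 0); last first.
      by case: ifP; rewrite ?mulr1 ?mulr0.
    over.
  rewrite integral_if (_ : [set _ | _] = `]0, (K a w)[%classic); last by apply/seteqP; split.
  rewrite -(@integral_itv_bndoo _ 0 (K a w) _ true false)//; last first.
    by apply: measurable_funTS; apply/measurable_EFinP; exact: measurable_expRN.
  apply: (etrans (integral_expRN_itv (lt0r_neq0 c0) (K0 a w))).
  by rewrite mulr0 oppr0 expR0 EFinM.
have mek : measurable_fun setT (fun w => expR (- (c * K a w))) := measurable_exp_flow hK c a.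
rewrite ge0_integralZr//; last 3 first.
- by apply/measurable_EFinP; apply: measurable_funB.
- by move=> w _; rewrite lee_fin; have /andP[] := expR_sub_ge0 (ltW c0) (K0 a w).
- by rewrite lee_fin invr_ge0 ltW.
rewrite EFinM; congr (_ * _)%E.
under eq_integral do rewrite EFinB.
rewrite (@integralB_EFin _ _ _ _ _ (cst 1))//.
- rewrite (flow_laplace hK)// (_ : (\int[P]_x (cst 1 x)%:E)%E = 1%E)//.
  by apply: (etrans (integral_cst P measurableT 1%E)); rewrite mul1e; exact: probability_setT.
- exact: finite_measure_integrable_cst.
- apply: measurable_bounded_integrable => //.
    exact: (le_lt_trans (probability_le1 P measurableT) (ltry 1)).
  exists 1; split => // M M1 w _; rewrite /= ger0_norm ?expR_ge0//.
  by rewrite (le_trans _ (ltW M1))// -expR0 ler_expR oppr_le0 mulr_ge0// ltW.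
Qed.

Lemma potential_kernel_neg a b t : t <= 0 -> potential_kernel a b t = 0%E.
Proof.
move=> t0; apply: integral0_eq => -[v w] _ /=; case: ifP => // _.
by rewrite /levy_kernel ifF//; apply/negbTE; rewrite -leNgt subr_le0 (le_trans t0).
Qed.

Lemma survival_neg a t : t <= 0 -> survival a t = 0%E.
Proof.
by move=> t0; apply: integral0_eq => w _ /=; rewrite ifF// ltNge t0.
Qed.

(** Both functions have the same Laplace transform. The exceptional set is exhibited as a measurable
    set because its preimage under t - K_s is taken later. *)
Lemma potential_kernel_ae a : 0 <= a -> exists N : set (measurableTypeR R),
  [/\ measurable N, leb N = 0%E &
    forall t, ~ N t -> potential_kernel 0 a t = survival a t].
Proof.
move=> a0.
(* The weight e^{-t} makes the mass finite and shifts the integer n to c = n + 1 > 0. *)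
pose e (t : R) : \bar R := (expR (- t))%:E.
have me : measurable_fun setT e by apply/measurable_EFinP; exact: measurableT_comp.
have e0 t : (0 <= e t)%E by rewrite lee_fin expR_ge0.
pose w1 (t : measurableTypeR R) : \bar R := (e t * survival a t)%E.
pose w2 (t : measurableTypeR R) : \bar R := (e t * potential_kernel 0 a t)%E.
have mw1 : measurable_fun setT w1 by apply: emeasurable_funM => //; exact: measurable_survival.
have mw2 : measurable_fun setT w2.
  by apply: emeasurable_funM => //; exact: measurable_potential_kernel.
have w10 t : (0 <= w1 t)%E by rewrite mule_ge0// survival_ge0.
have w20 t : (0 <= w2 t)%E by rewrite mule_ge0// potential_kernel_ge0.
pose X (t : measurableTypeR R) : R := Num.max t 0.
have mX : measurable_fun setT X by exact: measurable_maxr.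
have X0 t : 0 <= X t by rewrite le_max lexx orbT.
have lap1 (n : nat) (c : R) : 0 < c -> n%:R = c - 1 ->
    (\int[leb]_t (w1 t * (expR (- (n%:R * X t)))%:E) = ((1 - expR (- (a * f c))) / c)%:E)%E.
  move=> c0 ->; rewrite -laplace_survival//; apply: eq_integral => t _.
  rewrite /w1 /X; have [t0|t0] := leP t 0; first by rewrite survival_neg// !mule0 mul0e.
  rewrite -muleA [(survival _ _ * _)%E]muleC muleA; congr (_ * _)%E.
  by rewrite /e -EFinM -expRD; congr (expR _)%:E; ring.
have lap2 (n : nat) (c : R) : 0 < c -> n%:R = c - 1 ->
    (\int[leb]_t (w2 t * (expR (- (n%:R * X t)))%:E) = ((1 - expR (- (a * f c))) / c)%:E)%E.
  move=> c0 ->; rewrite -laplace_potential_kernel//; apply: eq_integral => t _.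
  rewrite /w2 /X; have [t0|t0] := leP t 0; first by rewrite potential_kernel_neg// !mule0 mul0e.
  rewrite -muleA [(potential_kernel _ _ _ * _)%E]muleC muleA; congr (_ * _)%E.
  by rewrite /e -EFinM -expRD; congr (expR _)%:E; ring.
have nE (n : nat) : n%:R = n.+1%:R - 1 :> R by rewrite -natr1 addrK.
have w1oo : (\int[leb]_t w1 t < +oo)%E.
  rewrite (_ : (\int[leb]_t w1 t)%E = (\int[leb]_t (w1 t * (expR (- (0%N%:R * X t)))%:E))%E).
    by rewrite (lap1 0%N 1) ?ltry// subrr.
  by apply: eq_integral => w _; rewrite mul0r oppr0 expR0 mule1.
have lap n : (\int[leb]_t (w1 t * (expR (- (n%:R * X t)))%:E) =
    \int[leb]_t (w2 t * (expR (- (n%:R * X t)))%:E))%E.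
  by rewrite (lap1 n _ (ltr0Sn R n) (nE n)) (lap2 n _ (ltr0Sn R n) (nE n)).
have ind (E : set (measurableTypeR R)) (w : measurableTypeR R -> \bar R) :
    (forall t, t <= 0 -> w t = 0%E) ->
    (\int[leb]_(t in E) w t = \int[leb]_t (w t * (\1_E (X t))%:E))%E.
  move=> wneg; rewrite integral_mkcond; apply: eq_integral => t _.
  rewrite patchE /X; have [t0|t0] := leP t 0.
    by rewrite wneg// mul0e; case: ifP.
  by rewrite indicE; case: ifP => _; rewrite ?mule1 ?mule0.
have : ae_eq leb setT w1 w2.
  apply: integral_ae_eq => //.
    apply/integrableP; split => //.
    by under eq_integral do rewrite gee0_abs//.
  have w1neg t : t <= 0 -> w1 t = 0%E by move=> t0; rewrite /w1 survival_neg// mule0.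
  have w2neg t : t <= 0 -> w2 t = 0%E.
    by move=> t0; rewrite /w2 potential_kernel_neg// mule0.
  move=> E _ mE; rewrite (ind E w1 w1neg) (ind E w2 w2neg).
  apply: (laplace_law_unique w10 w20 mw1 mw2 mX mX X0 X0 w1oo lap (f := fun y => (\1_E y)%:E)).
    exact/measurable_EFinP.
  by move=> y; rewrite lee_fin.
move=> [N [mN N0 hN]]; exists N; split => // t nNt.
have : w1 t = w2 t by apply: contrapT => h; apply: nNt; apply: hN => /(_ Logic.I).
move/(congr1 (fun z => (expR t)%:E * z)%E); rewrite /w1 /w2 /e !muleA -!EFinM.
by rewrite -expRD subrr expR0 !mul1e.
Qed.

End potential_kernel_section.

Section flow_semigroup_section.
Context (R : realType) d (T : measurableType d) (P : probability T R).
Variable nubar : {measure set (measurableTypeR R) -> \bar R}.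
Notation leb := (@lebesgue_measure R).
Hypothesis hmin : levy_integrable nubar.
Notation f := (bernstein nubar).
Variable K : R -> T -> R.
Hypothesis hK : subordinator_flow P f K.

Let mK v : measurable_fun setT (K v) := flow_measurable hK v.
Let K0 v w : 0 <= K v w := flow_ge0 hK v w.

Notation potential_kernel := (potential_kernel P nubar K).

(** The exponents s f and v f add up, so the law of K at time s + v is that of a sum of independent
    copies, realized on the product of [P] with itself. *)
Lemma flow_semigroup s v (h : R -> \bar R) : 0 <= s -> 0 <= v ->
  measurable_fun setT h -> (forall y, 0 <= h y)%E ->
  (\int[P]_w h (K (s + v) w) = \int[P]_w \int[P]_u h (K s w + K v u)%R)%E.
Proof.
move=> s0 v0 mh h0.
have mX2 : measurable_fun setT (fun p : T * T => K s p.1 + K v p.2).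
  apply: measurable_funD; first exact: (measurableT_comp (mK s) (@measurable_fst _ _ _ _)).
  exact: (measurableT_comp (mK v) (@measurable_snd _ _ _ _)).
have mc (d' : measure_display) (U : measurableType d') :
  measurable_fun setT (cst 1%E : U -> \bar R) by [].
have c0 (U : Type) (u : U) : (0 <= (cst 1%E : U -> \bar R) u)%E by exact: lee01.
have X20 (p : T * T) : 0 <= K s p.1 + K v p.2 by rewrite addr_ge0.
have E1 (n : nat) : n != 0%N -> (\int[P]_w (expR (- (n%:R * K (s + v) w)))%:E =
    (expR (- ((s + v) * f n%:R)))%:E)%E.
  by move=> n0; apply: (flow_laplace hK); rewrite ?addr_ge0// ltr0n lt0n.
have E2 (n : nat) : n != 0%N -> (\int[sigma_finite_product P P]_p
    (expR (- (n%:R * (K s p.1 + K v p.2))))%:E = (expR (- ((s + v) * f n%:R)))%:E)%E.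
  move=> n0; have n1 : 0 < n%:R :> R by rewrite ltr0n lt0n.
  rewrite sigma_finite_product_tonelli1; last 2 first.
  - by apply/measurable_EFinP; apply: (measurableT_comp (measurable_expRN n%:R)).
  - by move=> p; rewrite lee_fin expR_ge0.
  have hs := flow_laplace hK s0 n1; have hv := flow_laplace hK v0 n1.
  transitivity (\int[P]_w ((expR (- (n%:R * K s w)))%:E * (expR (- (v * f n%:R)))%:E))%E.
    apply: eq_integral => w _; rewrite -hv -ge0_integralZl//; last first.
      by apply/measurable_EFinP; exact: (measurable_exp_flow hK).
    by apply: eq_integral => u _; rewrite -EFinM -expRD /= mulrDr opprD.
  rewrite ge0_integralZr//; last first.
    by apply/measurable_EFinP; exact: (measurable_exp_flow hK).
  by rewrite hs -EFinM -expRD mulrDl opprD.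
transitivity (\int[P]_w (cst 1 w * h (K (s + v) w)))%E.
  by apply: eq_integral => w _; rewrite mul1e.
rewrite (@laplace_law_unique _ _ T (T * T)%type R P (sigma_finite_product P P)
  (cst 1%E) (cst 1%E) (K (s + v)) (fun p : T * T => K s p.1 + K v p.2))//.
- rewrite sigma_finite_product_tonelli1.
  + by apply: eq_integral => w _; apply: eq_integral => u _; rewrite mul1e.
  + by apply: emeasurable_funM => //; exact: measurableT_comp.
  + by move=> p; rewrite mule_ge0.
- by rewrite integral_cst// mul1e (le_lt_trans (probability_le1 P measurableT))// ltry.
move=> n; under eq_integral do rewrite mul1e.
under [RHS]eq_integral do rewrite mul1e.
(* [flow_laplace] covers x > 0 only; at n = 0 both sides are the total mass 1. *)
have [->|n0] := eqVneq n 0%N; last by rewrite E1// E2.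
under eq_integral do rewrite mul0r oppr0 expR0.
under [RHS]eq_integral do rewrite mul0r oppr0 expR0.
rewrite sigma_finite_product_tonelli1//.
have i1 : (\int[P]_w 1 = 1)%E.
  by apply: (etrans (integral_cst P measurableT 1%E)); rewrite mul1e; exact: probability_setT.
transitivity (1%E : \bar R); first exact: i1.
symmetry; transitivity (\int[P]_(w in [set: T]) 1)%E; last exact: i1.
by apply: eq_integral => w _; exact: i1.
Qed.

(** Translate v by s in the time integral, then split K at time s + v by the semigroup property. *)
Lemma potential_kernel_shift s a t : 0 <= s -> 0 <= a ->
  potential_kernel s (s + a) t = (\int[P]_w potential_kernel 0 a (t - K s w)%R)%E.
Proof.
move=> s0 a0; rewrite /potential_kernel.
have m1 : measurable_fun setT (fun p : measurableTypeR R * T => p.1 : R) by exact: measurable_fst.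
have mg (b c : R) : measurable_fun setT (fun p : measurableTypeR R * T =>
   (if (b < p.1)%R && (p.1 < c)%R then levy_kernel nubar (t - K p.1 p.2) else 0)%:E).
  apply/measurable_EFinP; apply: measurable_fun_ifT => //.
    by apply: measurable_and; exact: measurable_fun_ltr.
  apply: (measurableT_comp (measurable_levy_kernel hmin)).
  by apply: measurable_funB => //; exact: measurable_flow hK.
have g0 (b c : R) (p : measurableTypeR R * T) :
    (0 <= (if (b < p.1)%R && (p.1 < c)%R then levy_kernel nubar (t - K p.1 p.2) else 0)%:E)%E.
  by rewrite lee_fin; case: ifP => // _; exact: levy_kernel_ge0.
rewrite sigma_finite_product_tonelli1//.
have mF := measurable_fun_fubini_tonelli_F (m2 := P) _ (mg s (s + a)) (g0 s (s + a)).
have F0 (v : R) : (0 <= fubini_F P (fun p : measurableTypeR R * T =>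
   (if (s < p.1)%R && (p.1 < s + a)%R then levy_kernel nubar (t - K p.1 p.2) else 0)%:E) v)%E.
  by apply: integral_ge0 => w _; exact: (g0 s (s + a) (v, w)).
rewrite -[LHS](ge0_integral_shift s mF F0) /fubini_F /=.
pose G (q : (measurableTypeR R * T) * T) : \bar R :=
  (if (0 < q.1.1)%R && (q.1.1 < a)%R then
     levy_kernel nubar (t - (K s q.1.2 + K q.1.1 q.2)) else 0)%:E.
have mG : measurable_fun setT G.
  have m11 : measurable_fun setT (fun q : (measurableTypeR R * T) * T => q.1.1 : R).
    exact: (measurableT_comp (@measurable_fst _ _ _ _) (@measurable_fst _ _ _ _)).
  have m12 : measurable_fun setT (fun q : (measurableTypeR R * T) * T => q.1.2).
    exact: (measurableT_comp (@measurable_snd _ _ _ _) (@measurable_fst _ _ _ _)).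
  have m2 : measurable_fun setT (fun q : (measurableTypeR R * T) * T => (q.1.1, q.2)).
    by apply: measurable_fun_pair => //; exact: measurable_snd.
  apply/measurable_EFinP; apply: measurable_fun_ifT => //.
    by apply: measurable_and; exact: measurable_fun_ltr.
  apply: (measurableT_comp (measurable_levy_kernel hmin)).
  apply: measurable_funB => //; apply: measurable_funD.
    exact: (measurableT_comp (mK s) m12).
  exact: (measurableT_comp (measurable_flow hK) m2).
have G0 q : (0 <= G q)%E.
  by rewrite lee_fin; case: ifP => // _; exact: levy_kernel_ge0.
transitivity (\int[leb]_v \int[P]_w \int[P]_u G ((v, w), u))%E.
  apply: eq_integral => v _; rewrite /G /= -{1}[s]add0r ltrD2r [s + a]addrC ltrD2r.
  case: (boolP ((0 < v)%R && (v < a)%R)) => va; last by rewrite !integral0_eq// => w _; rewrite integral0_eq.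
  rewrite addrC (@flow_semigroup s v (fun y => (levy_kernel nubar (t - y))%:E))//.
  - by apply: ltW; case/andP: va.
  - apply/measurable_EFinP; apply: (measurableT_comp (measurable_levy_kernel hmin)).
    exact: measurable_funB.
  - by move=> y; rewrite lee_fin levy_kernel_ge0.
rewrite (@fubini_tonelli _ _ _ _ _ leb P (fun p => \int[P]_u G (p, u))%E); last 2 first.
- exact: (measurable_fun_fubini_tonelli_F (m2 := P) _ mG G0).
- by move=> p; exact: integral_ge0.
apply: eq_integral => w _; rewrite sigma_finite_product_tonelli1; last 2 first.
- apply/measurable_EFinP; apply: measurable_fun_ifT => //.
    by apply: measurable_and; exact: measurable_fun_ltr.
  apply: (measurableT_comp (measurable_levy_kernel hmin)).
  by apply: measurable_funB => //; exact: measurable_flow hK.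
- by move=> p; rewrite lee_fin; case: ifP => // _; exact: levy_kernel_ge0.
apply: eq_integral => v _; apply: eq_integral => u _ /=.
by rewrite /G /= opprD addrA.
Qed.

End flow_semigroup_section.

Section flow_resolvent_section.
Context (R : realType) d (T : measurableType d) (P : probability T R).
Variable nubar : {measure set (measurableTypeR R) -> \bar R}.
Notation leb := (@lebesgue_measure R).
Hypothesis hmin : levy_integrable nubar.
Hypothesis hinf : nubar `]0, +oo[%classic = +oo%E.
Hypothesis hac : forall a b : R, 0 < a -> a <= b ->
  abs_continuous_on a b (levy_tail nubar).
Notation lebP := (sigma_finite_product leb P).
Notation f := (bernstein nubar).
Variable K : R -> T -> R.
Hypothesis hK : subordinator_flow P f K.

Let mK v : measurable_fun setT (K v) := flow_measurable hK v.
Let K0 v w : 0 <= K v w := flow_ge0 hK v w.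

Notation potential_kernel := (potential_kernel P nubar K).
Notation survival := (survival P K).

Let mKset (v : R) (A : set (measurableTypeR R)) : measurable A -> measurable (K v @^-1` A).
Proof. by move=> mA; rewrite -[X in measurable X]setTI; exact: mK. Qed.

Let P_le_integral (v t : R) :
  (\int[P]_w (if K v w <= t then 1 else 0 : R)%:E = P [set w | (K v w <= t)%R])%E.
Proof. by rewrite integral_if (integral_cst P (flow_event_measurable hK v t) 1%E) mul1e. Qed.

Lemma lebesgue_reflect0 (B : set (measurableTypeR R)) (t : R) : measurable B ->
  leb B = 0%E -> leb [set s | B (t - s)] = 0%E.
Proof.
move=> mB B0.
have mBy : measurable [set s : measurableTypeR R | B (t - s)].
  rewrite -[X in measurable X]setTI.
  by apply: (measurable_funB (@measurable_cst _ _ _ _ setT t) (@measurable_id _ _ setT)).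
rewrite -[LHS]mul1e -integral_cst// integral_mkcond.
transitivity (\int[leb]_s (\1_B s)%:E)%E; last by rewrite integral_indic// setIT.
rewrite -(@ge0_integral_reflect R t (fun s => (\1_B s)%:E)).
- apply: eq_integral => s _; rewrite patchE indicE.
  have [h|h] := boolP (t - s \in B); first by rewrite mem_set //; exact/set_mem.
  by rewrite memNset// => /mem_set; exact/negP.
- exact/measurable_EFinP.
- by move=> s; rewrite lee_fin.
Qed.

(** After the shift, the kernel is evaluated at t - K_s, whose law is absolutely continuous, so it
    may be replaced by [survival] almost surely. What remains splits the event K_s <= t according to
    whether the next independent increment crosses t. *)
Lemma flow_increment s a t : 0 < s -> 0 <= a ->
  (potential_kernel s (s + a) t + P [set w | (K (s + a) w <= t)%R] =
   P [set w | (K s w <= t)%R])%E.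
Proof.
move=> s0 a0; rewrite potential_kernel_shift ?(ltW s0)//.
have [N [mN N0 hN]] := potential_kernel_ae hmin hinf hK a0.
have mpk : measurable_fun setT (fun w => potential_kernel 0 a (t - K s w)).
  apply: (measurableT_comp (measurable_potential_kernel hmin hK 0 a)).
  exact: measurable_funB.
have msv : measurable_fun setT (fun w => survival a (t - K s w)).
  apply: (measurableT_comp (measurable_survival hK a)).
  exact: measurable_funB.
have mtK : measurable_fun setT (fun w => t - K s w) by exact: measurable_funB.
rewrite (ge0_ae_eq_integral measurableT mpk msv); last 3 first.
- by move=> w _; exact: potential_kernel_ge0.
- by move=> w _; exact: survival_ge0.
- exists (K s @^-1` [set y | N (t - y)]); split.
  + apply: mKset; rewrite -[X in measurable X]setTI.
    by apply: (measurable_funB (@measurable_cst _ _ _ _ setT t) (@measurable_id _ _ setT)).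
  + apply: (flow_dominated hmin hinf hac hK s0).
      rewrite -[X in measurable X]setTI.
      by apply: (measurable_funB (@measurable_cst _ _ _ _ setT t) (@measurable_id _ _ setT)).
    exact: lebesgue_reflect0.
  + move=> w /= h; apply: contrapT => nN; apply: h => _; exact: hN.
rewrite -!P_le_integral.
pose h (y : R) : \bar R := (if y <= t then 1 else 0 : R)%:E.
have mh : measurable_fun setT h.
  by apply/measurable_EFinP; apply: measurable_fun_ifT => //; exact: measurable_fun_ler.
have h0 y : (0 <= h y)%E by rewrite lee_fin; case: ifP.
rewrite (@flow_semigroup _ _ _ P nubar K hK s a h (ltW s0) a0 mh h0).
have mhh : measurable_fun setT (fun q : T * T => h (K s q.1 + K a q.2)).
  apply: (measurableT_comp mh); apply: measurable_funD.
    exact: (measurableT_comp (mK s) (@measurable_fst _ _ _ _)).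
  exact: (measurableT_comp (mK a) (@measurable_snd _ _ _ _)).
have mhP := measurable_fun_fubini_tonelli_F (m2 := P) _ mhh (fun q => h0 _).
rewrite -ge0_integralD//; last 2 first.
- by move=> w _; exact: survival_ge0.
- by move=> w _; exact: integral_ge0.
apply: ge0_ae_eq_integral => //.
- exact: emeasurable_funD.
- exact: (measurableT_comp mh).
- by move=> w _; rewrite adde_ge0 ?survival_ge0//; exact: integral_ge0.
- by move=> w _; exact: h0.
(* At K_s = t the pointwise splitting fails because [survival] is cut to 0 there; this event is
   null. *)
exists (K s @^-1` [set t]); split; first exact: mKset.
  by apply: (flow_dominated hmin hinf hac hK s0) => //; exact: lebesgue_measure_set1.
move=> w /= H; apply: contrapT => /eqP Kst; apply: H => _.
rewrite /survival -ge0_integralD//; last 3 first.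
- by move=> u _; rewrite lee_fin; case: ifP.
- apply/measurable_EFinP; apply: measurable_fun_ifT => //.
  by apply: measurable_and => //; exact: measurable_fun_ltr.
- exact: (measurableT_comp mhh (measurable_pair1 w)).
transitivity (\int[P]_(u in [set: T]) h (K s w))%E; last first.
  by rewrite (integral_cst P measurableT (h (K s w))) -[RHS]mule1; congr (_ * _)%E;
     exact: probability_setT.
apply: eq_integral => u _; rewrite /h -EFinD; congr EFin.
have Kau := K0 a u; rewrite subr_gt0 ltrBlDl ltNge.
have [Kt|Kt|Kt] := ltgtP (K s w) t.
- by rewrite /= ltNge; case: (K s w + K a u <= t) => /=; rewrite ?add0r ?addr0.
- rewrite /= add0r ifF//; apply/negbTE; rewrite -ltNge.
  by rewrite (lt_le_trans Kt)// lerDl.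
- by move: Kst; rewrite Kt eqxx.
Qed.

(** Valid at every t: in [flow_increment] with s + a = b fixed, s decreases to 0. The kernel grows
    to its full integral, and P(K_s <= t) tends to 1 by right-continuity at 0, as t > 0. *)
Lemma flow_resolvent t b : 0 < t -> 0 < b ->
  (potential_kernel 0 b t + P [set w | (K b w <= t)%R] = 1)%E.
Proof.
move=> t0 b0.
pose s (n : nat) : R := n.+1%:R^-1.
have s0 n : 0 < s n by rewrite invr_gt0.
have sle m n : (m <= n)%N -> s n <= s m.
  by move=> mn; rewrite lef_pV2 ?posrE// ler_nat.
have slt c : 0 < c -> \forall n \near \oo, s n < c.
  move=> c0; exists (Num.truncn c^-1) => // n /= cn.
  rewrite invf_plt ?posrE//; apply: (lt_le_trans (truncnS_gt _)).
  by rewrite ler_nat ltnS.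
pose g n (p : measurableTypeR R * T) : \bar R :=
  (if (s n < p.1)%R && (p.1 < b)%R then levy_kernel nubar (t - K p.1 p.2) else 0)%:E.
have cvg1 : potential_kernel (s n) b t @[n --> \oo] --> potential_kernel 0 b t.
  rewrite /potential_kernel (_ : (\int[lebP]_p _)%E = (\int[lebP]_p limn (g ^~ p))%E).
    apply: cvg_monotone_convergence => //.
    - move=> n; apply/measurable_EFinP; apply: measurable_fun_ifT => //.
        have m1 : measurable_fun setT (fun p : measurableTypeR R * T => p.1 : R) by exact: measurable_fst.
        by apply: measurable_and; exact: measurable_fun_ltr.
      apply: (measurableT_comp (measurable_levy_kernel hmin)).
      by apply: measurable_funB => //; exact: measurable_flow hK.
    - by move=> n p _; rewrite lee_fin; case: ifP => // _; exact: levy_kernel_ge0.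
    - move=> p _ m n mn; rewrite /g lee_fin.
      case: ifPn => [/andP[sp pb]|_]; last by case: ifP => // _; exact: levy_kernel_ge0.
      by rewrite (le_lt_trans (sle _ _ mn) sp) pb.
  apply: eq_integral => -[v w] _ /=; apply/esym/cvg_lim => //.
  apply: cvg_near_cst; have [v0|v0] := ltP 0 v.
    by near=> n; rewrite /g /= (_ : s n < v)//; near: n; exact: slt.
  by near=> n; rewrite /g /= ltNge (le_trans v0 (ltW (s0 n))).
have cvg2 : P [set w | K (s n) w <= t] @[n --> \oo] --> (1%E : \bar R).
  rewrite (_ : 1%E = P (\bigcup_n [set w | K (s n) w <= t])).
    have mS n : measurable [set w | K (s n) w <= t] by exact: (flow_event_measurable hK).
    apply: nondecreasing_cvg_mu => //; first exact: bigcupT_measurable.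
    move=> m n mn; apply/subsetPset => w /=; apply: le_trans.
    exact/(flow_nondecreasing hK)/sle.
  rewrite -[LHS](probability_setT P); congr (P _); apply/seteqP; split => // w _.
  have : K 0 w < t by rewrite (flow_start hK).
  move=> /(flow_right_continuous hK)[u u0 Kut].
  have [n _ /(_ n (leqnn _)) /= snu] := slt _ u0.
  by exists n => //=; apply: le_trans (ltW Kut); exact/(flow_nondecreasing hK)/ltW.
have cvg3 : (potential_kernel (s n) b t + P [set w | (K b w <= t)%R])%E @[n --> \oo] -->
    (potential_kernel 0 b t + P [set w | (K b w <= t)%R])%E.
  apply: cvgeD => //; last exact: cvg_cst.
  by rewrite ge0_adde_def// inE ?potential_kernel_ge0// measure_ge0.
apply: (cvg_unique _ cvg3) => //.
apply: cvg_trans cvg2; apply: near_eq_cvg; near=> n.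
have snb : s n < b by near: n; exact: slt.
have bE : b = s n + (b - s n) by rewrite addrC subrK.
by rewrite [in RHS]bE flow_increment// subr_ge0 ltW.
Unshelve. all: by end_near. Qed.

End flow_resolvent_section.

(** * Law of the first passage time *)

Section first_passage_law_section.
Context (R : realType) d (T : measurableType d) (P : probability T R).
Variable nubar : {measure set (measurableTypeR R) -> \bar R}.
Notation leb := (@lebesgue_measure R).
Hypothesis hmin : levy_integrable nubar.
Hypothesis hinf : nubar `]0, +oo[%classic = +oo%E.
Hypothesis hac : forall a b : R, 0 < a -> a <= b ->
  abs_continuous_on a b (levy_tail nubar).
Notation lebP := (sigma_finite_product leb P).
Notation f := (bernstein nubar).
Variable K : R -> T -> R.
Hypothesis hK : subordinator_flow P f K.

Let mK v : measurable_fun setT (K v) := flow_measurable hK v.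

Notation potential_kernel := (potential_kernel P nubar K).

Let m1 : measurable_fun setT (fun p : measurableTypeR R * T => p.1 : R).
Proof. exact: measurable_fst. Qed.

Let mkern t : measurable_fun setT (fun p : measurableTypeR R * T =>
  levy_kernel nubar (t - K p.1 p.2)).
Proof.
apply: (measurableT_comp (measurable_levy_kernel hmin)).
by apply: measurable_funB => //; exact: measurable_flow hK.
Qed.

(** Duality and [flow_resolvent] give P(Y < b) = [potential_kernel 0 b t], so the two measures agree
    on half-lines, hence everywhere: v -> E nu(t - K_v) is the density of Y. *)
Lemma integral_first_passage t (Y : T -> R) (h : R -> \bar R) : 0 < t ->
  measurable_fun setT Y ->
  P [set w | Y w <= 0] = 0%E ->
  (forall b : R, (0 < b)%R -> P [set w | (Y w < b)%R] + P [set w | (K b w <= t)%R] = 1)%E ->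
  measurable_fun setT h -> (forall y, 0 <= h y)%E ->
  (\int[P]_w h (Y w) =
   \int[lebP]_p ((if 0 < p.1 then levy_kernel nubar (t - K p.1 p.2) else 0)%:E * h p.1))%E.
Proof.
move=> t0 mY Y0 hY mh h0.
have mYlt (b : R) : measurable [set w | Y w < b].
  rewrite (_ : [set _ | _] = Y @^-1` `]-oo, b[%classic).
    by rewrite -[X in measurable X]setTI; apply: mY => //; exact: measurable_itv.
  by apply/seteqP; split => w /=; rewrite in_itv.
have mYle (b : R) : measurable [set w | Y w <= b].
  rewrite (_ : [set _ | _] = Y @^-1` `]-oo, b]%classic).
    by rewrite -[X in measurable X]setTI; apply: mY => //; exact: measurable_itv.
  by apply/seteqP; split => w /=; rewrite in_itv.
pose w2 (p : measurableTypeR R * T) : \bar R :=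
  (if 0 < p.1 then levy_kernel nubar (t - K p.1 p.2) else 0)%:E.
have mw2 : measurable_fun setT w2.
  apply/measurable_EFinP; apply: measurable_fun_ifT => //.
  exact: measurable_fun_ltr.
have w20 p : (0 <= w2 p)%E.
  by rewrite lee_fin; case: ifP => // _; exact: levy_kernel_ge0.
have mw1 : measurable_fun setT (cst 1%E : T -> \bar R) by [].
have w10 (w : T) : (0 <= (cst 1%E : T -> \bar R) w)%E by exact: lee01.
pose M1 : {measure set (measurableTypeR R) -> \bar R} :=
  @weighted_law _ _ T (measurableTypeR R) R P (cst 1%E) Y w10 mw1 mY.
pose M2 : {measure set (measurableTypeR R) -> \bar R} :=
  @weighted_law _ _ (measurableTypeR R * T)%type (measurableTypeR R) R lebP w2 fst
    w20 mw2 m1.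
transitivity (\int[M1]_y h y)%E.
  transitivity (\int[P]_w (cst 1%E w * h (Y w)))%E.
    by apply: eq_integral => w _; rewrite mul1e.
  by symmetry; exact: (@ge0_integral_weighted_law _ _ T (measurableTypeR R) R P _ Y w10 mw1 mY).
transitivity (\int[M2]_y h y)%E; last first.
  exact: (@ge0_integral_weighted_law _ _ (measurableTypeR R * T)%type (measurableTypeR R) R lebP _
    fst w20 mw2 m1).
have M1E b : M1 `]-oo, b[%classic = P [set w | Y w < b].
  rewrite [LHS](weighted_lawE P w10 mw1 mY) integral_cst ?mul1e.
    by congr (P _); apply/seteqP; split => w /=; rewrite in_itv.
  by rewrite (_ : _ @^-1` _ = [set w | Y w < b])//; apply/seteqP; split => w /=; rewrite in_itv.
have M2E b : M2 `]-oo, b[%classic = potential_kernel 0 b t.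
  rewrite [LHS](weighted_lawE lebP w20 mw2 m1) integral_mkcond.
  apply: eq_integral => -[v w] _; rewrite patchE /w2 /=.
  have [vb|vb] := ltP v b.
    by rewrite mem_set /= ?in_itv//= andbT.
  by rewrite memNset /= ?in_itv/= ?andbF//; apply/negP; rewrite -leNgt.
have M12 b : M1 `]-oo, b[%classic = M2 `]-oo, b[%classic.
  rewrite M1E M2E; have [b0|b0] := ltP 0 b.
    have := hY b b0; rewrite -(flow_resolvent hmin hinf hac hK t0 b0).
    have Pfin : P [set w | K b w <= t] \is a fin_num.
      by apply: fin_num_measure; exact: (flow_event_measurable hK).
    by move/(congr1 (fun z => z - P [set w | (K b w <= t)%R])%E); rewrite !addeK.
  rewrite (_ : potential_kernel 0 b t = 0%E).
    apply/eqP; rewrite eq_le measure_ge0 andbT -Y0; apply: le_measure; rewrite ?inE.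
    - exact: mYlt.
    - exact: mYle.
    - by move=> w /= /ltW /le_trans; apply.
  apply: integral0_eq => -[v w] _ /=; rewrite ifF//; apply/negbTE/negP => /andP[v0 vb].
  by have := lt_le_trans (lt_trans v0 vb) b0; rewrite ltxx.
apply: eq_measure_integral => A mA _.
apply: (@measure_unique _ R (measurableTypeR R) (@RGenInftyO.G R)
  (fun n : nat => `]-oo, (n%:R : R)[%classic) _ _ _ _ M1 M2).
- exact: RGenInftyO.measurableE.
- move=> _ _ [x ->] [y ->]; exists (Num.min x y); apply/seteqP; split => z /=;
    by rewrite !in_itv/= lt_min => /andP.
- by move=> n; exists n%:R.
- apply/seteqP; split => // x _; exists (Num.truncn x).+1 => //=.
  by rewrite in_itv/= truncnS_gt.
- by move=> _ [x ->].
- by move=> k; rewrite M1E (le_lt_trans (probability_le1 P (mYlt _))) ?ltry.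
- exact: mA.
Qed.

(** Choosing x with f(x) >= c + 1 in Chernoff's bound leaves the integrand below e^{xt} e^{-v}. *)
Lemma potential_exp_finite c t : 0 <= c -> 0 <= t ->
  (\int[lebP]_p (if (0 < p.1)%R && (K p.1 p.2 <= t)%R then expR (c * p.1) else 0)%:E < +oo)%E.
Proof.
move=> c0 t0.
have [x x0 fx] := bernstein_unbounded hmin (c + 1) hinf.
have mg : measurable_fun setT (fun p : measurableTypeR R * T =>
  (if (0 < p.1)%R && (K p.1 p.2 <= t)%R then expR (c * p.1) else 0)%:E).
  apply/measurable_EFinP; apply: measurable_fun_ifT => //.
    apply: measurable_and; first exact: measurable_fun_ltr.
    by apply: measurable_fun_ler => //; exact: measurable_flow hK.
  by apply: measurableT_comp => //; exact: measurable_funM.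
have g0 (p : measurableTypeR R * T) :
    (0 <= (if (0 < p.1)%R && (K p.1 p.2 <= t)%R then expR (c * p.1) else 0)%:E)%E.
  by rewrite lee_fin; case: ifP => // _; exact: expR_ge0.
rewrite sigma_finite_product_tonelli1//.
apply: (@le_lt_trans _ _ (\int[leb]_v ((expR (x * t))%:E * (if 0 < v then expR (- (1 * v)) else 0)%:E))%E).
  apply: ge0_le_integral => //.
  - by move=> v _; apply: integral_ge0 => w _; exact: (g0 (v, w)).
  - exact: (measurable_fun_fubini_tonelli_F (m2 := P) _ mg g0).
  - apply: emeasurable_funM => //; apply/measurable_EFinP; apply: measurable_fun_ifT => //.
      exact: measurable_fun_ltr.
    exact: measurable_expRN.
  - move=> v _ /=; have [v0|v0] := ltP 0 v; last first.
      by rewrite integral0_eq// mule_ge0// lee_fin expR_ge0.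
    rewrite (eq_integral (fun w => (expR (c * v))%:E * (if K v w <= t then 1 else 0 : R)%:E)%E); last first.
      by move=> w _; rewrite -EFinM /=; case: (K v w <= t); rewrite ?mulr1 ?mulr0.
    have mle : measurable_fun setT (fun w => (if K v w <= t then 1 else 0 : R)%:E).
      apply/measurable_EFinP; apply: measurable_fun_ifT => //.
      exact: measurable_fun_ler.
    rewrite ge0_integralZl//; last by move=> w _; rewrite lee_fin; case: ifP.
    rewrite integral_if (integral_cst P (flow_event_measurable hK v t) 1%E) mul1e.
    apply: (le_trans (lee_wpmul2l _ (flow_chernoff hK t (ltW v0) x0))).
      by rewrite lee_fin expR_ge0.
    rewrite -!EFinM lee_fin mulrCA ler_wpM2l ?expR_ge0// -expRD ler_expR mul1r.
    have : v * (c + 1) <= v * f x by rewrite ler_wpM2l// ltW.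
    rewrite mulrDr mulr1 [v * c]mulrC; lra.
rewrite ge0_integralZl//; last 2 first.
- apply/measurable_EFinP; apply: measurable_fun_ifT => //.
    exact: measurable_fun_ltr.
  exact: measurable_expRN.
- by move=> v _; rewrite lee_fin; case: ifP => // _; exact: expR_ge0.
rewrite integral_if (_ : [set _ | _] = `]0, +oo[%classic); last first.
  by apply/seteqP; split => v /=; rewrite in_itv/= andbT.
rewrite integral_itv_obnd_cbnd; last first.
  by apply: measurable_funTS; apply/measurable_EFinP; exact: measurable_expRN.
apply: (@le_lt_trans _ _ ((expR (x * t))%:E * (expR (- (1 * 0)) / 1)%:E)%E); last first.
  by rewrite -EFinM ltry.
by rewrite (_ : (\int[_]_(_ in _) _)%E = (expR (- (1 * 0)) / 1)%:E)//; exact: integral_expRN_ge.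
Qed.

End first_passage_law_section.

(** * Potential measures and their densities *)

Section finite_copy.
Context d (T : measurableType d) (R : realType) (M : {measure set T -> \bar R}).

(** Carries the proof of finiteness so that the finite-measure structure can be attached. *)
Definition finite_copy (_ : (M setT < +oo)%E) : set T -> \bar R := M.

Variable Moo : (M setT < +oo)%E.

HB.instance Definition _ := Measure.copy (finite_copy Moo) M.

Let finite_copy_fin : fin_num_fun (finite_copy Moo).
Proof.
move=> A mA; rewrite ge0_fin_numE//; apply: le_lt_trans Moo.
by apply: le_measure; rewrite ?inE.
Qed.

HB.instance Definition _ := @Measure_isFinite.Build _ _ _ (finite_copy Moo) finite_copy_fin.

End finite_copy.

Lemma density_of_dominated (R : realType)
    (M : {measure set (measurableTypeR R) -> \bar R}) :
  (M setT < +oo)%E ->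
  (forall A, measurable A -> lebesgue_measure A = 0%E -> M A = 0%E) ->
  exists rho : R -> R, [/\ measurable_fun setT rho, forall y, 0 <= rho y &
    forall phi : R -> \bar R, measurable_fun setT phi -> (forall y, 0 <= phi y)%E ->
      (\int[M]_y phi y = \int[lebesgue_measure]_y ((rho y)%:E * phi y))%E].
Proof.
move=> Moo Mleb.
pose M' : {finite_measure set (measurableTypeR R) -> \bar R} := finite_copy Moo.
have dom : M' `<< @lebesgue_measure R.
  move=> N N0 A mA AN; apply: Mleb => //; exact: N0.
have [g [g0 gfin gint gE]] := radon_nikodym_sigma_finite dom.
have mg : measurable_fun setT g := measurable_int _ gint.
exists (fine \o g); split.
- exact: measurableT_comp.
- by move=> y; apply: fine_ge0.
move=> phi mphi phi0.
transitivity (\int[weighted_measure lebesgue_measure g0 mg]_y phi y)%E.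
  by apply: eq_measure_integral => A mA _; rewrite -[RHS]/(\int[lebesgue_measure]_(x in A) g x)%E -gE.
rewrite ge0_integral_weighted_measure//; apply: eq_integral => y _.
by rewrite /= fineK.
Qed.

Section flow_potential_section.
Context (R : realType) d (T : measurableType d) (P : probability T R).
Variable nubar : {measure set (measurableTypeR R) -> \bar R}.
Notation leb := (@lebesgue_measure R).
Hypothesis hmin : levy_integrable nubar.
Hypothesis hinf : nubar `]0, +oo[%classic = +oo%E.
Hypothesis hac : forall a b : R, 0 < a -> a <= b ->
  abs_continuous_on a b (levy_tail nubar).
Notation lebP := (sigma_finite_product leb P).
Notation f := (bernstein nubar).
Variable K : R -> T -> R.
Hypothesis hK : subordinator_flow P f K.

Let mK v : measurable_fun setT (K v) := flow_measurable hK v.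
Let K0 v w : 0 <= K v w := flow_ge0 hK v w.

Let m1 : measurable_fun setT (fun p : measurableTypeR R * T => p.1 : R).
Proof. exact: measurable_fst. Qed.

Section potential_density.
Variables (h : R -> R) (c C t : R).
Hypotheses (mh : measurable_fun setT h) (h0 : forall v, 0 <= h v).
Hypotheses (c0 : 0 <= c) (C0 : 0 <= C) (t0 : 0 <= t).
Hypothesis hle : forall v, 0 < v -> h v <= C * expR (c * v).

(** Cutting off at K <= t makes the potential measure finite, as Radon-Nikodym requires. *)
Let wh (p : measurableTypeR R * T) : \bar R :=
  (if (0 < p.1)%R && (K p.1 p.2 <= t)%R then h p.1 else 0)%:E.

Let mcond : measurable_fun setT (fun p : measurableTypeR R * T =>
  (0 < p.1)%R && (K p.1 p.2 <= t)%R).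
Proof.
apply: measurable_and; first exact: measurable_fun_ltr.
by apply: measurable_fun_ler => //; exact: measurable_flow hK.
Qed.

Let mwh : measurable_fun setT wh.
Proof.
apply/measurable_EFinP; apply: measurable_fun_ifT => //.
exact: (measurableT_comp mh m1).
Qed.

Let wh0 p : (0 <= wh p)%E.
Proof. by rewrite lee_fin; case: ifP. Qed.

Lemma potential_fin : (\int[lebP]_p wh p < +oo)%E.
Proof.
apply: (@le_lt_trans _ _ (\int[lebP]_p (C%:E *
    (if (0 < p.1)%R && (K p.1 p.2 <= t)%R then expR (c * p.1) else 0)%:E))%E).
  apply: ge0_le_integral => //.
  - apply: emeasurable_funM => //; apply/measurable_EFinP; apply: measurable_fun_ifT => //.
    by apply: measurableT_comp => //; exact: measurable_funM.
  - move=> p _; rewrite /wh -EFinM lee_fin; case: ifPn => [/andP[p0 _]|_].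
      exact: hle.
    by rewrite mulr0.
rewrite ge0_integralZl//; last 2 first.
- apply/measurable_EFinP; apply: measurable_fun_ifT => //.
  by apply: measurableT_comp => //; exact: measurable_funM.
- by move=> p _; rewrite lee_fin; case: ifP => // _; exact: expR_ge0.
rewrite lte_mul_pinfty//.
exact: (potential_exp_finite hmin hinf hK c0 t0).
Qed.

(** The measure is a mixture over v > 0 of the laws of K_v, each null on Lebesgue null sets. *)
Lemma potential_density : exists rho : R -> R,
  [/\ measurable_fun setT rho, forall y, 0 <= rho y &
    forall phi : R -> \bar R, measurable_fun setT phi -> (forall y, 0 <= phi y)%E ->
    (\int[lebP]_p (wh p * phi (K p.1 p.2)) = \int[leb]_y ((rho y)%:E * phi y))%E].
Proof.
have mKp := measurable_flow hK.
pose M : {measure set (measurableTypeR R) -> \bar R} :=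
  @weighted_law _ _ (measurableTypeR R * T)%type (measurableTypeR R) R lebP wh _ wh0 mwh mKp.
have mKpA (A : set (measurableTypeR R)) : measurable A ->
    measurable ((fun p : measurableTypeR R * T => K p.1 p.2) @^-1` A).
  by move=> mA; rewrite -[X in measurable X]setTI; have := mKp measurableT _ mA; apply.
have Moo : (M setT < +oo)%E.
  by rewrite [M _](weighted_lawE lebP wh0 mwh mKp); exact: potential_fin.
have Mdom (A : set (measurableTypeR R)) : measurable A -> leb A = 0%E -> M A = 0%E.
  move=> mA A0; rewrite [LHS](weighted_lawE lebP wh0 mwh mKp) integral_mkcond.
  rewrite sigma_finite_product_tonelli1; last 2 first.
  - apply/(measurable_restrictT _ _).1; first exact: mKpA.
    exact: measurable_funTS.
  - by move=> p; rewrite patchE; case: ifP.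
  apply: integral0_eq => v _; have [v0|v0] := ltP 0 v; last first.
    by apply: integral0_eq => w _; rewrite patchE /wh /= ltNge v0 /=; case: ifP.
  have mKA : measurable (K v @^-1` A).
    by rewrite -[X in measurable X]setTI; exact: mK.
  rewrite (@ge0_negligible_integral _ _ _ P setT (K v @^-1` A))//.
  - apply: integral0_eq => w [_ nA]; rewrite patchE memNset//.
  - have mpatch : measurable_fun setT (wh \_ ((fun p : measurableTypeR R * T => K p.1 p.2) @^-1` A)).
      apply/(measurable_restrictT _ _).1; first exact: mKpA.
      exact: measurable_funTS.
    exact: (measurableT_comp mpatch (measurable_pair1 v)).
  - by move=> w _; rewrite patchE; case: ifP.
  - exact: (flow_dominated hmin hinf hac hK v0).
have [rho [mrho rho0 hrho]] := density_of_dominated Moo Mdom.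
exists rho; split => // phi mphi phi0; rewrite -hrho//.
by symmetry; exact: (@ge0_integral_weighted_law _ _ (measurableTypeR R * T)%type (measurableTypeR R)
  R lebP wh _ wh0 mwh mKp).
Qed.

End potential_density.

End flow_potential_section.

(** * Caputo-Djrbashian derivative of a primitive *)

Lemma bigcapT_measurable_rat d (T : measurableType d) (F : rat -> set T) :
  (forall q, measurable (F q)) -> measurable (\bigcap_q F q).
Proof.
move=> mF; rewrite -[X in measurable X]setCK setC_bigcap.
by apply/measurableC/bigcupT_measurable_rat => q; exact/measurableC.
Qed.

Lemma le_on_rat_le (R : realType) (O : set R) (g : R -> R) (e : R) :
  open O -> (forall x, O x -> {for x, continuous g}) ->
  (forall q : rat, O (ratr q) -> g (ratr q) <= e) ->
  forall x, O x -> g x <= e.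
Proof.
move=> oO cg gq x Ox; rewrite leNgt; apply/negP => egx.
have : \forall y \near x, O y /\ e < g y.
  near=> y; split; near: y; first exact: open_nbhs_nbhs.
  exact: (cg x Ox (fun z => e < z) (lt_nbhsr egx)).
move=> /nbhs_ballP[r /= r0 xr].
have [q] := @rat_in_itvoo R x (x + r) (ltac:(by rewrite ltrDl)).
rewrite in_itv/= => /andP[xq qr].
have [|/gq geq] := xr (ratr q).
  by rewrite /ball /= distrC gtr0_norm ?subr_gt0// ltrBlDl.
by rewrite ltNge geq.
Unshelve. all: by end_near. Qed.

(** * Measurability of the derivative of a continuous function *)

Section measurable_derive1.
Context (R : realType).
Variable W : R -> R.
Hypothesis cW : continuous W.

Let Q (h x : R) : R := h^-1 * (W (h + x) - W x).

Let cQ h x : h != 0 -> {for h, continuous (Q ^~ x)}.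
Proof.
move=> h0; apply: cvgM; first exact: cvgV.
apply: cvgB; last exact: cvg_cst.
apply: (@continuous_comp _ _ _ (fun h => h + x) W); last exact: cW.
by apply: cvgD; [exact: cvg_id|exact: cvg_cst].
Qed.

Let mQ h : measurable_fun setT (Q h).
Proof.
have mW : measurable_fun setT W by exact: continuous_measurable_fun.
apply: measurable_funM => //; apply: measurable_funB => //.
by apply: (measurableT_comp mW); exact: measurable_funD.
Qed.

Let small (m : nat) (h : R) := (0 < `|h|) && (`|h| < m.+1%:R^-1).

(* The points of differentiability, as a Cauchy condition on the difference
   quotients along rational increments. *)
Let E := \bigcap_k \bigcup_m \bigcap_p \bigcap_q
  [set x | small m (ratr p) -> small m (ratr q) ->
           `|Q (ratr p) x - Q (ratr q) x| <= k.+1%:R^-1].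

Let mE : measurable (E : set R).
Proof.
apply: bigcapT_measurable => k; apply: bigcupT_measurable => m.
apply: bigcapT_measurable_rat => p; apply: bigcapT_measurable_rat => q.
have [sp|/negP sp] := boolP (small m (ratr p)); last first.
  by rewrite (_ : [set _ | _] = setT)//; apply/seteqP; split => // x _ /= /sp.
have [sq|/negP sq] := boolP (small m (ratr q)); last first.
  by rewrite (_ : [set _ | _] = setT)//; apply/seteqP; split => // x _ /= _ /sq.
rewrite (_ : [set _ | _] =
    (fun x => `|Q (ratr p) x - Q (ratr q) x|) @^-1` `]-oo, k.+1%:R^-1]); last first.
  by apply/seteqP; split => x /=; rewrite in_itv/= => h; [exact: h|move=> _ _].
rewrite -[X in measurable X]setTI.
have : measurable_fun setT (fun x => `|Q (ratr p) x - Q (ratr q) x|).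
  by apply: measurableT_comp => //; exact: measurable_funB.
by apply => //; exact: measurable_itv.
Qed.

Let open_small m : open [set h : R | small m h].
Proof.
rewrite (_ : [set _ | _] = (fun h : R => `|h|) @^-1` `]0, m.+1%:R^-1[%classic).
  by apply: open_comp; [move=> x _; exact: norm_continuous|exact: itv_open].
by apply/seteqP; split => h /=; rewrite in_itv.
Qed.

(** For h different from 0 the quotient is continuous in h, so the bound on rational increments
    extends to all small increments, one variable at a time. *)
Let EP x : E x <-> cvg (Q h x @[h --> 0^']).
Proof.
split => [Ex|/cvg_ex[/= l Ql]].
  apply: cauchy_cvg; apply/cauchy_ballP => e e0.
  have [m _ Em] := Ex (Num.truncn e^-1) Logic.I.
  have ke : (Num.truncn e^-1).+1%:R^-1 < e by rewrite invf_plt ?posrE// truncnS_gt.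
  have step (p : rat) : small m (ratr p) -> forall h', small m h' ->
      `|Q (ratr p) x - Q h' x| <= (Num.truncn e^-1).+1%:R^-1.
    move=> sp; apply: (@le_on_rat_le _ _ (fun h' => `|Q (ratr p) x - Q h' x|) _ (@open_small m)); last first.
      by move=> q /= sq; exact: (Em p Logic.I q Logic.I).
    move=> h' /andP[h'0 _]; apply: cvg_norm; apply: cvgB; first exact: cvg_cst.
    by apply: cQ; rewrite -normr_gt0.
  have step2 h h' : small m h -> small m h' ->
      `|Q h x - Q h' x| <= (Num.truncn e^-1).+1%:R^-1.
    move=> sh sh'; move: h sh; apply: (@le_on_rat_le _ _ (fun h => `|Q h x - Q h' x|) _ (@open_small m)); last first.
      by move=> q /= sq; exact: step.
    move=> h /andP[h0 _]; apply: cvg_norm; apply: cvgB; last exact: cvg_cst.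
    by apply: cQ; rewrite -normr_gt0.
  have nsmall : \forall h \near 0^', small m h.
    near=> h; apply/andP; split.
      by rewrite normr_gt0; near: h; exact: nbhs_dnbhs_neq.
    by near: h; apply: dnbhs0_lt; rewrite invr_gt0.
  exists ((Q ^~ x) @` [set h | small m h], (Q ^~ x) @` [set h | small m h]).
    by split => /=; apply: filterS nsmall => h sh; exists h.
  move=> [_ _] /= [[h sh <-] [h' sh' <-]].
  by rewrite /ball /= (le_lt_trans (step2 _ _ sh sh')).
move=> k _.
have k0 : 0 < k.+1%:R^-1 / 2 :> R by rewrite divr_gt0// invr_gt0.
have /cvgrPdist_lt/(_ _ k0) := Ql.
move=> /nbhs_ballP[r /= r0 hr].
exists (Num.truncn r^-1) => // p _ q _ /= /andP[p0 pr] /andP[q0 qr].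
have rr : (Num.truncn r^-1).+1%:R^-1 < r by rewrite invf_plt ?posrE// truncnS_gt.
have hp : `|l - Q (ratr p) x| < k.+1%:R^-1 / 2.
  by apply: hr; rewrite -?normr_gt0// /ball /= sub0r normrN (lt_trans pr).
have hq : `|l - Q (ratr q) x| < k.+1%:R^-1 / 2.
  by apply: hr; rewrite -?normr_gt0// /ball /= sub0r normrN (lt_trans qr).
rewrite (_ : _ - _ = (l - Q (ratr q) x) - (l - Q (ratr p) x)); last by ring.
by rewrite (le_trans (ler_normB _ _))// [leRHS]splitr lerD// ltW.
Unshelve. all: by end_near. Qed.

(** On the measurable set [E] the derivative is the limit of quotients along 1/(n+1); elsewhere
    [derive1] takes its default value, the one that restriction to [E] also assigns. *)
Lemma measurable_derive1 : measurable_fun setT (derive1 W).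
Proof.
pose D x : \bar R := limn_esup (fun n => (Q n.+1%:R^-1 x)%:E).
have mD : measurable_fun setT D.
  by apply: measurable_fun_limn_esup => n; apply/measurable_EFinP; exact: mQ.
rewrite (_ : derive1 W = (fine \o D) \_ E).
  by apply/(measurable_restrictT _ _).1 => //; apply: measurable_funTS; exact: measurableT_comp.
apply/funext => x; rewrite patchE; case: ifPn => [/set_mem/EP Ex|/negP nE]; last first.
  by apply: dvgP => h; apply: nE; apply/mem_set/EP.
have [l Ql] := (cvg_ex _).1 Ex.
have -> : derive1 W x = l by apply/cvg_lim => //; exact: Ql.
have Qn : (Q n.+1%:R^-1 x)%:E @[n --> \oo] --> l%:E.
  apply/fine_cvgP; split; first exact: nearW.
  have /cvgr_dnbhsP := Ql; apply; split.
    by move=> n; rewrite invr_neq0.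
  exact: cvg_harmonic.
by rewrite /= /D (cvg_limn_einf_sup Qn).
Qed.

End measurable_derive1.

(** * Primitives of integrable densities *)

Section caputo_primitive.
Context (R : realType).
Notation leb := (@lebesgue_measure R).
Variable rho : R -> R.
Hypothesis irho : leb.-integrable [set: R] (EFin \o rho).

Let F (y : R) : R := \int[leb]_(z in `]-oo, y]) rho z.

Let mrho : measurable_fun setT rho.
Proof. by apply/measurable_EFinP; exact: measurable_int irho. Qed.

Let irhoS (A : set (measurableTypeR R)) : measurable A -> leb.-integrable A (EFin \o rho).
Proof. by move=> mA; apply: integrableS irho. Qed.

Let inrho (A : set (measurableTypeR R)) : measurable A ->
  leb.-integrable A (EFin \o (fun x => `|rho x|)).
Proof. by move=> mA; apply: integrable_norm; exact: irhoS. Qed.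

Lemma primitive_dist (x y : R) : x <= y -> `|F y - F x| <= \int[leb]_(z in `]x, y[) `|rho z|.
Proof.
move=> xy; rewrite /F Rintegral_itvB//; last by exact: (irhoS (measurable_itv _)).
have mI : measurable (`]x, y]%classic : set (measurableTypeR R)) by exact: measurable_itv.
apply: (le_trans (le_normr_Rintegral mI (irhoS mI))).
rewrite le_eqVlt; apply/orP; left; apply/eqP; congr fine.
rewrite -[RHS](@integral_itv_bndoo _ x y _ false false)//.
by apply: measurable_funTS; apply/measurable_EFinP; exact: measurableT_comp.
Qed.

(** The sum of increments is at most the integral of |rho| over the union of the disjoint intervals,
    and this integral is small when the union has small measure. *)
Lemma primitive_abs_continuous (a b : R) : abs_continuous_on a b F.
Proof.
move=> e e0; have [del [del0 hdel]] := integral_normr_continuous irho e0.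
exists del => // n x y hxy tI sdel.
have mI (i : 'I_n) : measurable (`]x i, y i[%classic : set (measurableTypeR R)).
  exact: measurable_itv.
pose A : set (measurableTypeR R) := \big[setU/set0]_(i <- index_enum 'I_n) `]x i, y i[%classic.
have mA : measurable A by apply: bigsetU_measurable => i _; exact: mI.
have intA (g : measurableTypeR R -> \bar R) : measurable_fun setT g -> (forall z, 0 <= g z)%E ->
    (\int[leb]_(z in A) g z = \sum_(i < n) \int[leb]_(z in `]x i, y i[) g z)%E.
  move=> mg g0; apply: ge0_integral_bigsetU => //.
  - exact: index_enum_uniq.
  - by move=> k l _ _; exact: tI.
  - exact: measurable_funTS.
have lA : (leb A < del%:E)%E.
  rewrite -[ltLHS]mul1e -integral_cst// intA//.
  apply: le_lt_trans _ (_ : ((\sum_(i < n) (y i - x i))%:E < del%:E)%E); last by rewrite lte_fin.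
  rewrite -sumEFin; apply: lee_sum => i _; rewrite integral_cst// mul1e.
  have /and3P[_ xy _] := hxy i.
  rewrite [leLHS](lebesgue_measure_itv `]x i, y i[)/= lte_fin.
  case: ifP => _; first by rewrite EFinB.
  by rewrite lee_fin subr_ge0.
apply: le_lt_trans (hdel A mA lA).
have nfin (B : set (measurableTypeR R)) : measurable B ->
    ((\int[leb]_(z in B) `|rho z|)%:E = \int[leb]_(z in B) (`|rho z|)%:E)%E.
  by move=> mB; rewrite /Rintegral fineK//; apply: integrable_fin_num => //; exact: inrho.
rewrite -lee_fin -sumEFin nfin// intA; last 2 first.
- by apply/measurable_EFinP; exact: measurableT_comp.
- by move=> z; rewrite lee_fin.
apply: lee_sum => i _; have /and3P[_ xy _] := hxy i.
by rewrite -nfin// lee_fin; exact: primitive_dist.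
Qed.

Lemma primitive_continuous : continuous F.
Proof.
move=> x; apply/cvgrPdist_lt => e e0.
have [del [del0 hdel]] := integral_normr_continuous irho e0.
near=> y; have xydel : `|x - y| < del.
  by near: y; apply: cvgr_dist_lt => //; exact: cvg_id.
have key (u v : R) : u <= v -> v - u < del -> `|F v - F u| < e.
  move=> uv vu; apply: (le_lt_trans (primitive_dist uv)); apply: hdel.
    exact: measurable_itv.
  rewrite [ltLHS](lebesgue_measure_itv `]u, v[)/= lte_fin.
  case: ifP => _; last by rewrite lte_fin.
  by rewrite -EFinB lte_fin.
have [xy|yx] := leP x y.
  rewrite distrC; apply: key => //; apply: le_lt_trans xydel.
  by rewrite distrC ler_norm.
by apply: key; [exact: ltW|exact: (le_lt_trans (ler_norm _) xydel)].
Unshelve. all: by end_near. Qed.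

Let lebpt : {ae leb, forall x, lebesgue_pt rho x}.
Proof.
apply: lebesgue_differentiation; apply: open_integrable_locally; [exact: openT|exact: irho].
Qed.

(** Lebesgue differentiation gives W' = rho almost everywhere, and s -> t - s preserves null sets,
    so the integrand is rho(t - s) nu(s) for almost every s. *)
Lemma caputo_primitive (nu W : R -> R) (c0 t : R) : 0 < t ->
  (forall y, 0 <= y <= t -> W y = c0 + F y) ->
  measurable_fun (`]0, t[%classic : set (measurableTypeR R)) nu ->
  leb.-integrable (`]0, t[%classic : set R) (fun s => (rho (t - s) * nu s)%:E) ->
  caputo_djrbashian_eq nu W t (\int[leb]_(s in `]0, t[) (rho (t - s) * nu s)).
Proof.
move=> t0 WF mnu inu.
have WFn y : 0 < y < t -> \forall z \near y, W z = c0 + F z.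
  move=> /andP[y0 yt]; near=> z; apply: WF; apply/andP; split; apply: ltW; near: z.
    exact: lt_nbhsr.
  exact: lt_nbhsl.
(* [W] is controlled on [0, t] only. For 0 < s < t the point t - s is interior, so the derivative
   may be computed from the globally continuous [W1]. *)
pose W1 := fun y => c0 + F y.
have cW1 : continuous W1 by move=> y; apply: cvgD; [exact: cvg_cst|exact: primitive_continuous].
have dE (s : R) : 0 < s < t -> derive1 (fun x => W (x - s)) t = derive1 W1 (t - s).
  move=> /andP[s0 st].
  transitivity (derive1 (fun x => W1 (x - s)) t); last first.
    rewrite /derive1 (_ : (fun h : R => h^-1 *: (W1 (h + t - s) - W1 (t - s))) =
      (fun h : R => h^-1 *: (W1 (h + (t - s)) - W1 (t - s))))//.
    by apply/funext => h; rewrite addrA.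
  rewrite !derive1E; apply: near_eq_derive.
  have /WFn : 0 < t - s < t by rewrite subr_gt0 st/= ltrBlDr ltrDl.
  have : (fun x => x - s) x @[x --> t] --> t - s by apply: cvgB; [exact: cvg_id|exact: cvg_cst].
  by move=> h1 h2; exact: h1 h2.
have mD : measurable_fun (`]0, t[%classic : set (measurableTypeR R))
    (fun s : measurableTypeR R => (derive1 (fun x : R => W (x - s)) t * nu s)%:E).
  apply/measurable_EFinP; apply: measurable_funM => //.
  apply: (eq_measurable_fun (fun s : measurableTypeR R => derive1 W1 (t - s))).
    by move=> s; rewrite inE /= in_itv/= => /dE.
  apply: measurable_funTS; apply: (measurableT_comp (measurable_derive1 cW1)).
  exact: measurable_funB.
have ae : ae_eq leb (`]0, t[%classic : set (measurableTypeR R)) (fun s : measurableTypeR R => (derive1 (fun x : R => W (x - s)) t * nu s)%:E)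
    (fun s : measurableTypeR R => (rho (t - s) * nu s)%:E).
  have [N [mN N0 hN]] := lebpt.
  exists [set s | N (t - s)]; split.
  - rewrite -[X in measurable X]setTI.
    by apply: (measurable_funB (@measurable_cst _ _ _ _ setT t) (@measurable_id _ _ setT)).
  - exact: lebesgue_reflect0.
  - move=> s /= h; apply: hN => /= lpt; apply: h; rewrite in_itv/= => st.
    rewrite dE//; congr (_ * _)%:E; move/andP: st => [s0 st].
    have tst : t - s < t by rewrite ltrBlDr ltrDl.
    have [dF FE] := FTC1_lebesgue_pt tst (irhoS (measurable_itv `]-oo, t])) (ltNyr _) lpt.
    rewrite derive1E (_ : W1 = cst c0 + F)// deriveD//.
    by rewrite derive_cst add0r -derive1E.
split.
- move=> e e0; have [del del0 hdel] := primitive_abs_continuous 0 t e0.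
  exists del => // n x y hxy tI sdel.
  rewrite (eq_bigr (fun i => `|F (y i) - F (x i)|)); first exact: hdel.
  move=> i _; have /and3P[x0 xy yt] := hxy i.
  rewrite !WF ?x0 ?(le_trans xy yt) ?(le_trans x0 xy)//.
  by congr (`|_|); ring.
- apply/integrableP; split => //.
  rewrite (_ : (\int[_]_(_ in _) _)%E = (\int[leb]_(s in `]0%R, t[) `|(rho (t - s) * nu s)%:E|)%E).
    by case/integrableP: inu.
  apply: ge0_ae_eq_integral => //.
  + exact: measurableT_comp.
  + by apply: measurableT_comp => //; exact: measurable_int inu.
  + have [N [mN N0 hN]] := ae; exists N; split => // s /= h; apply: hN => /= h'.
    by apply: h => /h' [->].
- rewrite /caputo_djrbashian /Rintegral; congr fine; apply: ae_eq_integral => //.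
  exact: measurable_int inu.
Unshelve. all: by end_near. Qed.

End caputo_primitive.

(** * The derivative of a potential *)

Section caputo_of_potential_section.
Context (R : realType) d (T : measurableType d) (P : probability T R).
Variable nubar : {measure set (measurableTypeR R) -> \bar R}.
Notation leb := (@lebesgue_measure R).
Hypothesis hmin : levy_integrable nubar.
Hypothesis hinf : nubar `]0, +oo[%classic = +oo%E.
Hypothesis hac : forall a b : R, 0 < a -> a <= b ->
  abs_continuous_on a b (levy_tail nubar).
Notation lebP := (sigma_finite_product leb P).
Notation f := (bernstein nubar).
Variable K : R -> T -> R.
Hypothesis hK : subordinator_flow P f K.

Let mK v : measurable_fun setT (K v) := flow_measurable hK v.

Definition potential (h : R -> R) (y : R) : \bar R :=
  (\int[lebP]_p (if (0 < p.1)%R && (K p.1 p.2 <= y)%R then h p.1 else 0)%:E)%E.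

Section caputo_potential.
Variables (t : R) (Y : T -> R).
Hypotheses (t0 : 0 < t) (mY : measurable_fun setT Y).
Hypothesis Y0 : P [set w | Y w <= 0] = 0%E.
Hypothesis hY : forall b : R, 0 < b ->
  (P [set w | (Y w < b)%R] + P [set w | (K b w <= t)%R] = 1)%E.

(** Let rho be the density of the measure obtained by integrating h(v) mu_v over v > 0. Tested
    against the indicator of [0, y] it gives the potential at y; tested against nu(t - .) it gives E
    h(Y), by [integral_first_passage]. *)
Lemma potential_primitive (h : R -> R) (c C : R) :
  measurable_fun setT h -> (forall v, 0 <= h v) -> 0 <= c -> 0 <= C ->
  (forall v, 0 < v -> h v <= C * expR (c * v)) ->
  (\int[P]_w (h (Y w))%:E < +oo)%E ->
  exists rho : R -> R, [/\ leb.-integrable [set: R] (EFin \o rho),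
    forall y, 0 <= y <= t ->
      fine (potential h y) = \int[leb]_(z in `]-oo, y]) rho z,
    leb.-integrable (`]0, t[%classic : set (measurableTypeR R))
      (fun s : measurableTypeR R => (rho (t - s) * levy_tail nubar s)%:E) &
    \int[leb]_(s in `]0, t[) (rho (t - s) * levy_tail nubar s) =
      fine (\int[P]_w (h (Y w))%:E)%E].
Proof.
move=> mh h0 c0 C0 hle hoo.
have [r [mr r0 hr]] := potential_density hmin hinf hac hK mh h0 c0 C0 (ltW t0) hle.
have hfin := potential_fin hmin hinf hK mh h0 c0 C0 (ltW t0) hle.
(* The measure sits on [0, +oo[, but its density is determined only almost everywhere; the cut makes
   it vanish at every negative point. *)
pose rho (y : R) : R := if 0 <= y then r y else 0.
have mrho : measurable_fun setT rho.
  by apply: measurable_fun_ifT => //; exact: measurable_fun_ler.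
have rho0 y : 0 <= rho y by rewrite /rho; case: ifP.
have rint : (\int[leb]_y (r y)%:E < +oo)%E.
  apply: le_lt_trans hfin; rewrite le_eqVlt; apply/orP; left; apply/eqP.
  transitivity (\int[leb]_y ((r y)%:E * cst 1 y))%E.
    by apply: eq_integral => y _; rewrite mule1.
  by rewrite -hr//; apply: eq_integral => p _; rewrite mule1.
have irho : leb.-integrable [set: R] (EFin \o rho).
  apply/integrableP; split; first exact/measurable_EFinP.
  apply: le_lt_trans rint; apply: ge0_le_integral => //.
  - by apply: measurableT_comp => //; exact/measurable_EFinP.
  - exact/measurable_EFinP.
  - by move=> y _; rewrite /= lee_fin ger0_norm// /rho; case: ifP.
have tailE s : 0 < s -> levy_kernel nubar s = levy_tail nubar s.
  by move=> s0; rewrite /levy_kernel s0.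
have mtail : measurable_fun (`]0, t[%classic : set (measurableTypeR R))
    (levy_tail nubar : measurableTypeR R -> R).
  apply: (eq_measurable_fun (levy_kernel nubar : measurableTypeR R -> R)).
    by move=> s; rewrite inE /= in_itv/= => /andP[s0 _]; rewrite tailE.
  by apply: measurable_funTS; exact: measurable_levy_kernel hmin.
have mconv : measurable_fun (`]0, t[%classic : set (measurableTypeR R))
    (fun s : measurableTypeR R => (rho (t - s) * levy_tail nubar s)%:E).
  apply/measurable_EFinP; apply: measurable_funM => //.
  by apply: measurable_funTS; apply: (measurableT_comp mrho); exact: measurable_funB.
have convE : (\int[leb]_(s in `]0%R, t[) (rho (t - s) * levy_tail nubar s)%:E =
    \int[P]_w (h (Y w))%:E)%E.
  transitivity (\int[leb]_(s in `]0%R, t[) (rho (t - s) * levy_kernel nubar s)%:E)%E.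
    by apply: eq_integral => s; rewrite inE /= in_itv/= => /andP[s0 _]; rewrite tailE.
  rewrite -(@integral_itv_bndoo _ 0 t _ false false); last first.
    apply: (eq_measurable_fun (fun s : measurableTypeR R => (rho (t - s) * levy_tail nubar s)%:E)) => //.
    by move=> s; rewrite inE /= in_itv/= => /andP[s0 _]; rewrite tailE.
  pose G (z : R) : \bar R := ((r z)%:E * (if 0 <= z then levy_kernel nubar (t - z) else 0)%:E)%E.
  have mphi : measurable_fun setT (fun z : R => (if 0 <= z then levy_kernel nubar (t - z) else 0)%:E).
    apply/measurable_EFinP; apply: measurable_fun_ifT => //; first exact: measurable_fun_ler.
    apply: (measurableT_comp (measurable_levy_kernel hmin)); exact: measurable_funB.
  have phi0 (z : R) : (0 <= (if 0 <= z then levy_kernel nubar (t - z) else 0)%:E)%E.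
    by rewrite lee_fin; case: ifP => // _; exact: levy_kernel_ge0.
  have mG : measurable_fun setT G.
    by apply: emeasurable_funM => //; exact/measurable_EFinP.
  have G0 z : (0 <= G z)%E by rewrite mule_ge0// lee_fin.
  transitivity (\int[leb]_s G (t - s)%R)%E.
    rewrite integral_mkcond; apply: eq_integral => s _; rewrite patchE /G /rho.
    case: ifPn => [|/negP sI].
      rewrite inE /= in_itv/= => /andP[s0 st].
      by rewrite subr_ge0 st subKr EFinM.
    rewrite subr_ge0 subKr; case: ifPn => [st|_]; last by rewrite mule0.
    rewrite /levy_kernel ifF ?mule0//; apply/negP => s0; apply: sI.
    by rewrite inE /= in_itv/= s0.
  rewrite ge0_integral_reflect// /G -hr//.
  rewrite (integral_first_passage hmin hinf hac hK t0 mY Y0 hY (h := fun y => (h y)%:E)); last 2 first.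
  - exact/measurable_EFinP.
  - by move=> y; rewrite lee_fin.
  apply: eq_integral => -[v w] _ /=; rewrite (flow_ge0 hK) -!EFinM; congr EFin.
  rewrite /levy_kernel subr_gt0; case: (ltP 0 v) => v0 /=; last by rewrite !mul0r.
  have [Kt|Kt] := leP (K v w) t; first by rewrite mulrC.
  by rewrite ltNge (ltW Kt) /= mul0r mul0r.
exists rho; split => //.
- move=> y /andP[y0 yt]; rewrite /Rintegral; congr fine.
  rewrite integral_mkcond /potential.
  transitivity (\int[leb]_z ((r z)%:E * (if (0 <= z) && (z <= y) then 1 else 0 : R)%:E))%E; last first.
    apply: eq_integral => z _; rewrite patchE /rho -EFinM.
    have [zy|zy] := leP z y.
      by rewrite mem_set ?in_itv//= andbT; case: ifP; rewrite ?mulr1 ?mulr0.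
    by rewrite memNset /= ?in_itv/= ?andbF ?mulr0//; apply/negP; rewrite -ltNge.
  rewrite -(hr (fun z => (if (0 <= z) && (z <= y) then 1 else 0 : R)%:E)); last 2 first.
  - apply/measurable_EFinP; apply: measurable_fun_ifT => //.
    by apply: measurable_and; exact: measurable_fun_ler.
  - by move=> z; rewrite lee_fin; case: ifP.
  apply: eq_integral => -[v w] _ /=; rewrite (flow_ge0 hK) -EFinM; congr EFin => /=.
  case: (0 < v) => /=; last by rewrite mul0r.
  have [Ky|Ky] := leP (K v w) y; last by rewrite mulr0.
  by rewrite (le_trans Ky yt) mulr1.
- apply/integrableP; split => //.
  rewrite (_ : (\int[_]_(_ in _) _)%E = (\int[P]_w (h (Y w))%:E)%E)// -convE.
  apply: eq_integral => s _; rewrite gee0_abs// lee_fin mulr_ge0//; exact: levy_tail_ge0.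
- by rewrite /Rintegral convE.
Qed.

Lemma caputo_potential (W h1 h2 : R -> R) (c C c0 : R) :
  measurable_fun setT h1 -> measurable_fun setT h2 ->
  (forall v, 0 <= h1 v) -> (forall v, 0 <= h2 v) -> 0 <= c -> 0 <= C ->
  (forall v, 0 < v -> h1 v <= C * expR (c * v)) ->
  (forall v, 0 < v -> h2 v <= C * expR (c * v)) ->
  (\int[P]_w (h1 (Y w))%:E < +oo)%E -> (\int[P]_w (h2 (Y w))%:E < +oo)%E ->
  (forall y, 0 <= y <= t -> W y = c0 + (fine (potential h1 y) - fine (potential h2 y))) ->
  caputo_djrbashian_eq (levy_tail nubar) W t
    (fine (\int[P]_w (h1 (Y w))%:E)%E - fine (\int[P]_w (h2 (Y w))%:E)%E).
Proof.
move=> mh1 mh2 h10 h20 c_ge0 C0 hle1 hle2 hoo1 hoo2 WE.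
have [r1 [i1 p1 n1 <-]] := potential_primitive mh1 h10 c_ge0 C0 hle1 hoo1.
have [r2 [i2 p2 n2 <-]] := potential_primitive mh2 h20 c_ge0 C0 hle2 hoo2.
have mI : measurable (`]0, t[%classic : set (measurableTypeR R)) by exact: measurable_itv.
rewrite -RintegralB//.
pose r y := r1 y - r2 y.
have ir : leb.-integrable [set: R] (EFin \o r).
  rewrite (_ : _ \o _ = (EFin \o r1) \- (EFin \o r2))%E; last by apply/funext => y.
  exact: integrableB.
rewrite (_ : Rintegral _ _ _ = \int[leb]_(s in `]0, t[) (r (t - s) * levy_tail nubar s)); last first.
  by apply: eq_Rintegral => s _; rewrite /r mulrBl.
apply: (caputo_primitive ir t0 (c0 := c0)).
- move=> y yt; rewrite WE// p1// p2// /r RintegralB//.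
  + by apply: integrableS i1 => //; exact: measurable_itv.
  + by apply: integrableS i2 => //; exact: measurable_itv.
- apply: (eq_measurable_fun (levy_kernel nubar : measurableTypeR R -> R)).
    by move=> s; rewrite inE /= in_itv/= /levy_kernel => /andP[-> _].
  by apply: measurable_funTS; exact: measurable_levy_kernel hmin.
- rewrite (_ : (fun s => _) = (fun s => (r1 (t - s) * levy_tail nubar s)%:E) \-
    (fun s => (r2 (t - s) * levy_tail nubar s)%:E))%E; last first.
    by apply/funext => s; rewrite /r mulrBl.
  exact: integrableB.
Qed.

End caputo_potential.

End caputo_of_potential_section.

Lemma integral_exp_primitive (R : realType) (c u : R) : c != 0 -> 0 <= u ->
  (\int[@lebesgue_measure R]_(v in `]0%R, u]) (expR (c * v))%:E = ((expR (c * u) - 1) / c)%:E)%E.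
Proof.
move=> cn0 u0.
rewrite integral_itv_obnd_cbnd; last first.
  apply: measurable_funTS; apply/measurable_EFinP.
  by apply: measurableT_comp => //; exact: measurable_funM.
under eq_integral do rewrite -[c * _]opprK -mulNr.
rewrite integral_expRN_itv ?oppr_eq0// mulr0 oppr0 expR0 mulNr opprK.
by congr EFin; field.
Qed.

Lemma exp_primitive (R : realType) (c u : R) : 0 <= c -> 0 <= u ->
  ((expR (c * u))%:E = 1 + \int[@lebesgue_measure R]_(v in `]0%R, u]) (c * expR (c * v))%:E)%E.
Proof.
move=> c0 u0; have [->|cn0] := eqVneq c 0.
  by rewrite mul0r expR0 integral0_eq ?adde0// => v _; rewrite mul0r.
under eq_integral do rewrite EFinM.
rewrite ge0_integralZl//; last first.
  apply: measurable_funTS; apply/measurable_EFinP.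
  by apply: measurableT_comp => //; exact: measurable_funM.
rewrite integral_exp_primitive// -EFinM -EFinD; congr EFin; field => //.
Qed.

(** * Expectations at the first passage time *)

Section first_passage_family_section.
Context (R : realType) d (T : measurableType d) (P : probability T R).
Variable nubar : {measure set (measurableTypeR R) -> \bar R}.
Notation leb := (@lebesgue_measure R).
Hypothesis hmin : levy_integrable nubar.
Hypothesis hinf : nubar `]0, +oo[%classic = +oo%E.
Hypothesis hac : forall a b : R, 0 < a -> a <= b ->
  abs_continuous_on a b (levy_tail nubar).
Notation f := (bernstein nubar).
Variable K : R -> T -> R.
Hypothesis hK : subordinator_flow P f K.
Notation potential := (potential P K).

(** Duality is asked in probability only: pathwise, K_b > t yields Y <= b and not Y < b. *)
Record first_passage_family (Y : R -> T -> R) : Prop := {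
  passage_measurable : forall t, 0 <= t -> measurable_fun setT (Y t);
  passage_ge0 : forall t w, 0 <= Y t w;
  passage_start : {ae P, forall w, Y 0 w = 0};
  passage_pos : forall t, 0 < t -> P [set w | Y t w <= 0] = 0%E;
  passage_dual : forall t b : R, 0 < t -> 0 < b ->
    (P [set w | (Y t w < b)%R] + P [set w | (K b w <= t)%R] = 1)%E }.

Variable Y : R -> T -> R.
Hypothesis hY : first_passage_family Y.

Let G (h : R -> R) (y : R) (p : measurableTypeR R * T) : \bar R :=
  (if (0 < p.1)%R && (p.1 <= Y y p.2)%R then h p.1 else 0)%:E.

Let G0 h y p : (forall v, 0 <= h v) -> (0 <= G h y p)%E.
Proof. by move=> h0; rewrite lee_fin; case: ifP. Qed.

Let mG h y : 0 <= y -> measurable_fun setT h -> measurable_fun setT (G h y).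
Proof.
move=> y0 mh; have mY := passage_measurable hY y0.
apply/measurable_EFinP; apply: measurable_fun_ifT => //.
  apply: measurable_and; first exact: measurable_fun_ltr.
  apply: measurable_fun_ler => //.
  by apply: (measurableT_comp mY); exact: measurable_snd.
exact: (measurableT_comp mh (measurable_fst)).
Qed.

Let primitiveE h y w :
  (\int[leb]_(v in `]0%R, Y y w]) (h v)%:E = \int[leb]_v G h y (v, w))%E.
Proof.
rewrite integral_mkcond; apply: eq_integral => v _.
rewrite patchE /G /=; case: ifPn => [|vI].
  by rewrite inE /= in_itv/= => ->.
by rewrite ifF//; apply/negbTE; apply: contra vI => vY; rewrite inE /= in_itv.
Qed.

Lemma measurable_primitive (h : R -> R) (y : R) : 0 <= y ->
  measurable_fun setT h -> (forall v, 0 <= h v) ->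
  measurable_fun setT (fun w => \int[leb]_(v in `]0%R, Y y w]) (h v)%:E)%E.
Proof.
move=> y0 mh h0; apply: (eq_measurable_fun (fun w => \int[leb]_v G h y (v, w))%E).
  by move=> w _; rewrite primitiveE.
apply: (measurable_fun_fubini_tonelli_G (m1 := leb)) => //; first exact: mG.
by move=> p; exact: G0.
Qed.

(** Tonelli reduces the left side to the integral of h(v) P(v <= Y), and duality replaces this
    probability by P(K_v <= y). *)
Lemma expected_primitive (h : R -> R) (y : R) : 0 <= y ->
  measurable_fun setT h -> (forall v, 0 <= h v) ->
  (\int[P]_w \int[leb]_(v in `]0%R, Y y w]) (h v)%:E = potential h y)%E.
Proof.
move=> y0 mh h0.
have mY := passage_measurable hY y0.
have mK := measurable_flow hK.
have mU : measurable_fun setT (fun p : measurableTypeR R * T =>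
    (if (0 < p.1)%R && (K p.1 p.2 <= y)%R then h p.1 else 0)%:E).
  apply/measurable_EFinP; apply: measurable_fun_ifT => //.
    apply: measurable_and; first exact: measurable_fun_ltr.
    exact: measurable_fun_ler.
  exact: (measurableT_comp mh (measurable_fst)).
rewrite (eq_integral (fun w => \int[leb]_v G h y (v, w))%E); last by move=> w _; exact: primitiveE.
rewrite -sigma_finite_product_tonelli2; [|exact: mG|by move=> p; exact: G0].
rewrite sigma_finite_product_tonelli1; [|exact: mG|by move=> p; exact: G0].
rewrite /potential (sigma_finite_product_tonelli1 leb P mU); last first.
  by move=> p; rewrite lee_fin; case: ifP.
apply: eq_integral => v _; rewrite /G /=.
have [v0|v0] := ltP 0 v; last by rewrite !integral0_eq.
have iE (A : set T) (a : T -> bool) : measurable A -> A = [set w | a w] ->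
    (\int[P]_w (if a w then h v else 0)%:E = (h v)%:E * P A)%E.
  by move=> mA AE; rewrite integral_if -AE; exact: integral_cst.
have mYge : measurable [set w | v <= Y y w].
  rewrite (_ : [set _ | _] = Y y @^-1` `[v, +oo[%classic).
    by rewrite -[X in measurable X]setTI; apply: mY => //; exact: measurable_itv.
  by apply/seteqP; split => w /=; rewrite in_itv/= andbT.
rewrite (iE [set w | v <= Y y w])// (iE [set w | K v w <= y])//; last first.
  exact: (flow_event_measurable hK).
congr (_ * _)%E.
(* Duality is available for y > 0. At y = 0 both probabilities vanish: K_v > 0 and Y = 0 almost
   surely. *)
move: y0; rewrite le_eqVlt => /orP[/eqP y0|y0]; last first.
  have := passage_dual hY y0 v0 => e.
  have mL : measurable [set w | Y y w < v].
    rewrite (_ : [set _ | _] = Y y @^-1` `]-oo, v[%classic).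
      by rewrite -[X in measurable X]setTI; apply: mY => //; exact: measurable_itv.
    by apply/seteqP; split => w /=; rewrite in_itv.
  have Lfin : P [set w | Y y w < v] \is a fin_num by exact: fin_num_measure.
  have := probability_setC P mL.
  rewrite (_ : ~` _ = [set w | v <= Y y w]); last first.
    by apply/seteqP; split => w /=; rewrite leNgt => /negP.
  move=> ->; rewrite -e addeAC subee// add0e//.
rewrite -y0 (flow_pos hmin hinf hK v0).
have [N [mN N0 hN]] := passage_start hY.
apply/eqP; rewrite eq_le measure_ge0 andbT -N0; apply: le_measure; rewrite ?inE//.
  by rewrite y0.
move=> w /= vY; apply: hN => /= Y0; move: vY; rewrite Y0 leNgt v0//.
Qed.

Variable c : R.
Hypothesis c0 : 0 <= c.

Let mexp : measurable_fun setT (fun v : R => expR (c * v)).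
Proof. by apply: measurableT_comp => //; exact: measurable_funM. Qed.

(** Since e^{cY} is 1 plus a primitive evaluated at Y, its expectation is 1 plus a potential, which
    is finite. *)
Lemma passage_exp_finite (t : R) : 0 <= t ->
  (\int[P]_w (expR (c * Y t w))%:E < +oo)%E.
Proof.
move=> t0.
have mY := passage_measurable hY t0.
have Y0 := passage_ge0 hY t.
rewrite (eq_integral (fun w => 1 + \int[leb]_(v in `]0%R, Y t w]) (c * expR (c * v))%:E)%E); last first.
  by move=> w _; exact: exp_primitive.
have mh : measurable_fun setT (fun v : R => c * expR (c * v)) by exact: measurable_funM.
have h0 (v : R) : 0 <= c * expR (c * v) by rewrite mulr_ge0// expR_ge0.
rewrite ge0_integralD//; last 2 first.
- by move=> w _; apply: integral_ge0 => v _; rewrite lee_fin.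
- exact: measurable_primitive.
rewrite (integral_cst P measurableT 1%E) mul1e lte_add_pinfty//.
  exact: (le_lt_trans (probability_le1 P measurableT) (ltry 1)).
rewrite (expected_primitive t0)//.
exact: (potential_fin hmin hinf hK mh h0 c0 c0 t0).
Qed.

Lemma passage_dominated_finite (C t : R) (h : R -> R) : 0 <= t -> 0 <= C ->
  measurable_fun setT h -> (forall v, 0 <= h v) ->
  (forall v, 0 <= v -> h v <= C * expR (c * v)) ->
  (\int[P]_w (h (Y t w))%:E < +oo)%E.
Proof.
move=> t0 C0 mh h0 hle; have mY := passage_measurable hY t0.
apply: (@le_lt_trans _ _ (\int[P]_w (C%:E * (expR (c * Y t w))%:E))%E).
  apply: ge0_le_integral => //.
  - by move=> w _; rewrite lee_fin.
  - by apply/measurable_EFinP; exact: measurableT_comp.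
  - apply: emeasurable_funM => //; apply/measurable_EFinP.
    exact: (measurableT_comp mexp mY).
  - by move=> w _; rewrite -EFinM lee_fin hle// (passage_ge0 hY).
rewrite ge0_integralZl//.
- by rewrite lte_mul_pinfty// passage_exp_finite.
- by apply/measurable_EFinP; exact: (measurableT_comp mexp mY).
Qed.

(** The equation for [g] is stated with additions only, so that it can be integrated at u = Y(y)
    term by term; finiteness of the potentials then allows the subtraction that [caputo_potential]
    expects. *)
Lemma caputo_expectation (C t : R) (W g h1 h2 : R -> R) : 0 < t -> 0 <= C ->
  measurable_fun setT g -> measurable_fun setT h1 -> measurable_fun setT h2 ->
  (forall v, 0 <= g v) -> (forall v, 0 <= h1 v) -> (forall v, 0 <= h2 v) ->
  (forall v, 0 <= v -> g v <= C * expR (c * v)) ->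
  (forall v, 0 <= v -> h1 v <= C * expR (c * v)) ->
  (forall v, 0 <= v -> h2 v <= C * expR (c * v)) ->
  (forall u : R, (0 <= u)%R -> (g u)%:E + \int[leb]_(v in `]0%R, u]) (h2 v)%:E =
    (g 0%R)%:E + \int[leb]_(v in `]0%R, u]) (h1 v)%:E)%E ->
  (forall y, 0 <= y <= t -> W y = fine (\int[P]_w (g (Y y w))%:E)%E) ->
  caputo_djrbashian_eq (levy_tail nubar) W t
    (fine (\int[P]_w (h1 (Y t w))%:E)%E - fine (\int[P]_w (h2 (Y t w))%:E)%E).
Proof.
move=> t0 C0 mg mh1 mh2 g0 h10 h20 gle h1le h2le geq WE.
have lt0 (h : R -> R) : (forall v, 0 <= v -> h v <= C * expR (c * v)) ->
  forall v, 0 < v -> h v <= C * expR (c * v) by move=> hle v /ltW; exact: hle.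
apply: (caputo_potential hmin hinf hac hK t0 (passage_measurable hY (ltW t0))
   (passage_pos hY t0) (fun b => passage_dual hY t0) mh1 mh2 h10 h20 c0 C0 (lt0 _ h1le) (lt0 _ h2le)
   (c0 := g 0)).
- exact: (passage_dominated_finite (ltW t0) C0 mh1 h10 h1le).
- exact: (passage_dominated_finite (ltW t0) C0 mh2 h20 h2le).
move=> y yI; have /andP[y0 _] := yI; rewrite WE//.
have pfin (h : R -> R) : measurable_fun setT h -> (forall v, 0 <= h v) ->
    (forall v, 0 <= v -> h v <= C * expR (c * v)) -> potential h y \is a fin_num.
  move=> mh h0 hle; rewrite ge0_fin_numE.
    exact: (potential_fin hmin hinf hK mh h0 c0 C0 y0 (lt0 _ hle)).
  by apply: integral_ge0 => p _; rewrite lee_fin; case: ifP.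
have mgY : measurable_fun setT (fun w => (g (Y y w))%:E).
  by apply/measurable_EFinP; exact: (measurableT_comp mg (passage_measurable hY y0)).
have : (\int[P]_w (g (Y y w))%:E + potential h2 y = (g 0%R)%:E + potential h1 y)%E.
  rewrite -(expected_primitive y0 mh1 h10) -(expected_primitive y0 mh2 h20).
  rewrite -ge0_integralD//; last 3 first.
  - by move=> w _; rewrite lee_fin.
  - by move=> w _; apply: integral_ge0 => v _; rewrite lee_fin.
  - exact: measurable_primitive.
  under eq_integral do rewrite geq ?(passage_ge0 hY)//.
  rewrite ge0_integralD//; last 3 first.
  - by move=> w _; rewrite lee_fin.
  - by move=> w _; apply: integral_ge0 => v _; rewrite lee_fin.
  - exact: measurable_primitive.
  by rewrite (integral_cst P measurableT (g 0%R)%:E) (etrans (congr1 _ (probability_setT P)) (mule1 _)).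
have gfin : (\int[P]_w (g (Y y w))%:E)%E \is a fin_num.
  rewrite ge0_fin_numE; first exact: (passage_dominated_finite y0 C0 mg g0 gle).
  by apply: integral_ge0 => w _; rewrite lee_fin.
have p1 := pfin _ mh1 h10 h1le; have p2 := pfin _ mh2 h20 h2le.
move/(congr1 fine); rewrite (fineD gfin p2) (fineD _ p1)// => e.
rewrite [fine (g 0%R)%:E]/= in e.
by apply: (addIr (fine (potential h2 y))); rewrite e; ring.
Qed.

End first_passage_family_section.

(** * The inverse subordinator *)

Lemma le_measure_negligible d (T : measurableType d) (R : realType)
    (mu : {measure set T -> \bar R}) (A B N : set T) :
  measurable A -> measurable B -> mu.-negligible N -> A `<=` B `|` N ->
  (mu A <= mu B)%E.
Proof.
move=> mA mB [M [mM M0 NM]] AB.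
apply: (@le_trans _ _ (mu (B `|` M))).
  apply: le_measure; rewrite ?inE//; first exact: measurableU.
  by move=> x /AB [|/NM]; [left|right].
apply: (le_trans (measureU2 mu mB mM)); rewrite -[leRHS]adde0 leeD2l//.
by rewrite le_eqVlt; apply/orP; left; apply/eqP.
Qed.

Lemma measure_eq_negligible d (T : measurableType d) (R : realType)
    (mu : {measure set T -> \bar R}) (A B N : set T) :
  measurable A -> measurable B -> mu.-negligible N ->
  A `<=` B `|` N -> B `<=` A `|` N -> mu A = mu B.
Proof.
move=> mA mB hN AB BA; apply/eqP; rewrite eq_le.
by rewrite (le_measure_negligible mA mB hN)// (le_measure_negligible mB mA hN).
Qed.

Section inverse_subordinator.
Context (R : realType) d (T : measurableType d) (P : probability T R).
Variable nubar : {measure set (measurableTypeR R) -> \bar R}.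
Hypothesis hmin : levy_integrable nubar.
Hypothesis hinf : nubar `]0, +oo[%classic = +oo%E.
Notation f := (bernstein nubar).
Variables (H : R -> T -> R) (l : R -> R -> R).
Hypothesis hH : is_subordinator P H.
Hypothesis laplaceH : forall t x : R, 0 <= t -> 0 < x ->
  'E_P[fun w => expR (- (x * H t w))]%E = (expR (- (t * f x)))%:E.
Hypothesis hl : forall t : R, 0 < t ->
  is_density_on_pos P (inverse_process H t) (l t).
Notation Y := (inverse_process H).

Let mH t : 0 <= t -> measurable_fun setT (H t) := fun t0 => subordinator_measurable hH t0.

(* [H 0 = 0] only holds almost surely, and [H] is unconstrained at negative
   times. *)
Definition centered_flow (v : R) (w : T) : R := H (Num.max v 0) w - H 0 w.
Notation K := centered_flow.

Let H0 : P.-negligible [set w | H 0 w != 0].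
Proof.
have := subordinator_start hH; apply: negligibleS => w /= /eqP h1 h2.
exact: h1.
Qed.

Let KH v w : 0 <= v -> H 0 w = 0 -> K v w = H v w.
Proof. by move=> v0 hw; rewrite /K hw subr0; congr H; apply/max_idPl. Qed.

Let mK v : measurable_fun setT (K v).
Proof. by apply: measurable_funB; apply: mH => //; rewrite le_max lexx orbT. Qed.

Let max0 (v : R) : 0 <= Num.max v 0. Proof. by rewrite le_max lexx orbT. Qed.

Lemma centered_flowP : subordinator_flow P f K.
Proof.
split => //.
- by move=> v w; rewrite subr_ge0; exact: (subordinator_nondecreasing hH).
- by move=> w; rewrite /K maxxx subrr.
- move=> w u v uv; rewrite lerD2r; apply: (subordinator_nondecreasing hH) => //.
  by rewrite ge_max max0 le_max uv.
- move=> w v c; have [v0|v0] := ltP v 0.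
    (* Below 0 the flow is constant, and v / 2 is still negative. *)
    move=> Kc; exists (v / 2); first by lra.
    move: Kc; rewrite /K !(max_idPr _) //; last exact: ltW.
    by lra.
  rewrite /K (max_idPl v0) ltrBlDr => Hc.
  have h : \forall u \near v^'+, H u w < c + H 0 w.
    exact: (@cvgr_lt _ _ _ _ _ _ (@subordinator_right_continuous _ _ _ _ _ hH w v v0) _ Hc).
  have [u [vu uc]] := @filter_ex _ _ _ _ (filterI (nbhs_right_gt v) h).
  exists u => //; rewrite (max_idPl _) ?ltrBlDr//.
  by rewrite (le_trans v0)// ltW.
- move=> v x v0 x0; rewrite -(laplaceH v0 x0) unlock.
  have me (X : T -> R) : measurable_fun setT X ->
      measurable_fun setT (fun w => (expR (- (x * X w)))%:E).
    by move=> mX; apply/measurable_EFinP; exact: (measurableT_comp (measurable_expRN x) mX).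
  apply: ae_eq_integral => //; [exact: me|apply: me; exact: mH|].
  have := subordinator_start hH; apply: filterS => w hw _.
  by rewrite KH.
Qed.

Let E t w := [set s | 0 <= s /\ t < H s w].

Let hasE t w : has_lbound (E t w). Proof. by exists 0 => s []. Qed.

Lemma inverse_process_ge0 t w : 0 <= Y t w.
Proof.
rewrite -[Y t w]/(inf (E t w)).
have [->|E0] := eqVneq (E t w) set0; first by rewrite inf0.
by apply: lb_le_inf; [exact/set0P|move=> s []].
Qed.

Let E_lt t w c : (E t w) !=set0 -> Y t w < c -> exists2 s, 0 <= s < c & t < H s w.
Proof.
move=> E0 /(inf_lt E0) [s [s0 tH] sc]; exists s => //.
by rewrite s0.
Qed.

Let E_le t w s : 0 <= s -> t < H s w -> Y t w <= s.
Proof. by move=> s0 tH; exact: (@ge_inf _ (E t w) (hasE t w) s (conj s0 tH)). Qed.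

(** For c > 0, Y < c means that H exceeds t at some rational time below c, or that the path never
    exceeds t, when the infimum of the empty set is 0. Monotonicity reduces both to countably many
    times. *)
Lemma measurable_inverse_process t : measurable_fun setT (Y t).
Proof.
apply: (measurability _ (RGenInftyO.measurableE R)) => //.
move=> _ [_ [c ->] <-]; rewrite setTI.
have mHt s : measurable [set w | t < H (Num.max s 0) w].
  rewrite (_ : [set _ | _] = H (Num.max s 0) @^-1` `]t, +oo[%classic).
    by rewrite -[X in measurable X]setTI; apply: mH => //; exact: measurable_itv.
  by apply/seteqP; split => w /=; rewrite in_itv/= andbT.
have [c0|c0] := leP c 0.
  rewrite (_ : _ @^-1` _ = set0)//; apply/seteqP; split => // w /=.
  by rewrite in_itv/= ltNge (le_trans c0 (inverse_process_ge0 t w)).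
rewrite (_ : _ @^-1` _ = \bigcup_(q in [set: rat])
    (if (ratr q : R) < c then [set w | t < H (Num.max (ratr q) 0) w] else set0) `|`
    ~` \bigcup_(n in [set: nat]) [set w | t < H (Num.max n%:R 0) w]); last first.
  apply/seteqP; split => w /=; rewrite in_itv/=.
    have [/set0P E0|E0] := boolP (E t w != set0).
      move=> /(E_lt E0)[s /andP[s0 sc] tH]; left.
      have [q] := rat_in_itvoo sc; rewrite in_itv/= => /andP[sq qc].
      exists q => //; rewrite qc /=; apply: (lt_le_trans tH).
      apply: (subordinator_nondecreasing hH) => //.
      by rewrite le_max (ltW sq).
    move=> _; right => -[n _ /= tH]; move/negP: E0; apply; apply/set0P.
    by exists (Num.max n%:R 0).
  case => [[q _]|nE].
    case: ifPn => // qc /= /(E_le (max0 _)) /le_lt_trans; apply.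
    by rewrite gt_max qc.
  rewrite -[Y t w]/(inf (E t w)) (_ : E t w = set0) ?inf0//.
  apply/seteqP; split => // s [s0 tH]; apply: nE.
  exists (Num.truncn s).+1 => //=; apply: (lt_le_trans tH).
  apply: (subordinator_nondecreasing hH) => //.
  by rewrite le_max ltW// truncnS_gt.
apply: measurableU.
  by apply: bigcupT_measurable_rat => q; case: ifP.
by apply: measurableC; apply: bigcupT_measurable.
Qed.

(** Extracts from the density the facts needed for duality: no mass on ]-oo, 0] and no atoms. *)
Let null_inverse (t : R) (B : set R) : 0 < t -> measurable B ->
  (forall l : R -> \bar R,
     (\int[lebesgue_measure]_(u in B `&` `]0%R, +oo[) l u = 0)%E) ->
  P (Y t @^-1` B) = 0%E.
Proof. by move=> t0 mB B0; have [_ _ ->//] := hl t0. Qed.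

Let inverse_le0 (t : R) : 0 < t -> P [set w | Y t w <= 0] = 0%E.
Proof.
move=> t0; rewrite (_ : [set _ | _] = Y t @^-1` `]-oo, 0]%classic); last first.
  by apply/seteqP; split => w /=; rewrite in_itv.
apply: null_inverse => // g; rewrite (_ : _ `&` _ = set0) ?integral_set0//.
by apply/seteqP; split => // u [] /=; rewrite !in_itv/= andbT leNgt => /negbTE ->.
Qed.

Let inverse_eq (t b : R) : 0 < t -> 0 < b -> P [set w | Y t w = b] = 0%E.
Proof.
move=> t0 b0; rewrite (_ : [set _ | _] = Y t @^-1` [set b])//.
apply: null_inverse => // g.
rewrite (_ : _ `&` _ = [set b]) ?integral_set1//.
by apply/seteqP; split => [u []//|u ->]; split => //=; rewrite in_itv/= b0.
Qed.

Lemma inverse_first_passage : first_passage_family P K Y.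
Proof.
have mYle t : measurable [set w | Y t w <= 0].
  rewrite (_ : [set _ | _] = Y t @^-1` `]-oo, 0]%classic).
    by rewrite -[X in measurable X]setTI; exact: measurable_inverse_process.
  by apply/seteqP; split => w /=; rewrite in_itv.
split => //.
- by move=> t _; exact: measurable_inverse_process.
- exact: inverse_process_ge0.
(* If Y 0 w > 0, the centered path has not left 0 by some time 1/(n+1), a null event by
   [flow_pos]. *)
- have h (n : nat) : P.-negligible [set w | K n.+1%:R^-1 w <= 0].
    by apply/negligibleP; [exact: (flow_event_measurable centered_flowP)|
      exact: (flow_pos hmin hinf centered_flowP)].
  apply: (negligibleS _ (negligibleU H0 (negligible_bigcup h))) => w /= Yn0.
  have Y0 : 0 < Y 0 w by rewrite lt_neqAle inverse_process_ge0 andbT eq_sym; exact/eqP.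
  have [hw|hw] := eqVneq (H 0 w) 0; last by left.
  right; exists (Num.truncn (Y 0 w)^-1) => //=.
  rewrite KH// ?invr_ge0// leNgt; apply/negP => /(E_le _) h'.
  have := h' ltac:(by rewrite invr_ge0); apply/negP; rewrite -ltNge.
  by rewrite invf_plt ?posrE// truncnS_gt.
move=> t b t0 b0.
have mHb : measurable [set w | H b w <= t].
  rewrite (_ : [set _ | _] = H b @^-1` `]-oo, t]%classic).
    by rewrite -[X in measurable X]setTI; apply: mH => //; exact: ltW.
  by apply/seteqP; split => w /=; rewrite in_itv.
have mYb (B : set R) : measurable B -> measurable (Y t @^-1` B).
  by move=> mB; rewrite -[X in measurable X]setTI; exact: measurable_inverse_process.
have -> : P [set w | K b w <= t] = P [set w | H b w <= t].
  apply: (measure_eq_negligible _ mHb H0).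
  - exact: (flow_event_measurable centered_flowP).
  - move=> w /= Kt; have [hw|hw] := eqVneq (H 0 w) 0; last by right.
    by left; rewrite -KH// ltW.
  - move=> w /= Ht; have [hw|hw] := eqVneq (H 0 w) 0; last by right.
    by left; rewrite KH// ltW.
have mYlt : measurable [set w | Y t w < b].
  rewrite (_ : [set _ | _] = Y t @^-1` `]-oo, b[%classic); first exact: mYb.
  by apply/seteqP; split => w /=; rewrite in_itv.
have -> : P [set w | Y t w < b] = P (~` [set w | H b w <= t]).
  (* Two null events separate Y < b from H b > t: on Y <= 0 the path may never exceed t, and on Y =
     b the inequality is only weak. *)
  have neg : P.-negligible ([set w | Y t w <= 0] `|` [set w | Y t w = b]).
    apply: negligibleU; apply/negligibleP => //; first exact: inverse_le0.
      exact: (mYb [set b]).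
    exact: inverse_eq.
  apply: (measure_eq_negligible mYlt _ neg); first exact: measurableC.
  - move=> w /= Yb; have [Y0|Y0] := leP (Y t w) 0; first by right; left.
    left; apply/negP; rewrite -ltNge.
    have /set0P E0 : E t w != set0.
      by apply/eqP => E0; move: Y0; rewrite -[Y t w]/(inf (E t w)) E0 inf0 ltxx.
    have [s /andP[s0 sb] tH] := E_lt E0 Yb.
    by apply: (lt_le_trans tH); apply: (subordinator_nondecreasing hH) => //; exact: ltW.
  - move=> w /= /negP; rewrite -ltNge => /(E_le (ltW b0)).
    by rewrite le_eqVlt => /predU1P[|]; [right; right|left].
rewrite (probability_setC P mHb) subeK//.
exact: fin_num_measure.
Qed.

End inverse_subordinator.

(** * Mixtures over an independent random time *)

Lemma integral_nat_partition d (T : measurableType d) (R : realType)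
    (mu : {measure set T -> \bar R}) (X : T -> nat) (g : T -> \bar R) :
  (forall n, measurable [set w | X w = n]) -> measurable_fun setT g ->
  (forall w, 0 <= g w)%E ->
  (\int[mu]_w g w = \sum_(0 <= n <oo) \int[mu]_(w in [set w | X w = n]) g w)%E.
Proof.
move=> mX mg g0.
have UE : \bigcup_n [set w | X w = n] = setT.
  by apply/seteqP; split => // w _; exists (X w).
rewrite -{1}UE ge0_integral_bigcup//; first by rewrite UE.
by apply/trivIsetP => i j _ _ /eqP ij; apply/seteqP; split => // w /= [-> /ij].
Qed.

Lemma measure_nat_partition d (T : measurableType d) (R : realType)
    (mu : {measure set T -> \bar R}) (X : T -> nat) (A : set T) :
  (forall n, measurable [set w | X w = n]) -> measurable A ->
  (mu A = \sum_(0 <= n <oo) mu (A `&` [set w | X w = n]))%E.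
Proof.
move=> mX mA; have UE : \bigcup_n (A `&` [set w | X w = n]) = A.
  by apply/seteqP; split => [w [n _ []]//|w Aw]; exists (X w).
rewrite -{1}UE measure_semi_bigcup ?UE//.
- by move=> n; exact: measurableI.
- by apply/trivIsetP => i j _ _ /eqP ij; apply/seteqP; split => // w /= [[_ ->] [_ /ij]].
Qed.

Lemma measurable_nat_fiber d (T : measurableType d) (X : T -> nat) (A : nat -> set T) :
  (forall n, measurable [set w | X w = n]) -> (forall n, measurable (A n)) ->
  measurable [set w | A (X w) w].
Proof.
move=> mX mA.
rewrite (_ : [set _ | _] = \bigcup_n ([set w | X w = n] `&` A n)); last first.
  by apply/seteqP; split => [w Aw|w [n _ [/= <-]]//]; exists (X w).
by apply: bigcupT_measurable => n; exact: measurableI.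
Qed.

(** The indicators are eventually constant at each point, so dominated convergence applies; the
    limit event is measurable as a lower limit. *)
Lemma cvg_probability_stationary d (T : measurableType d) (R : realType)
    (P : probability T R) (A_ : (set T)^nat) (A : set T) :
  (forall n, measurable (A_ n)) ->
  (forall w, \forall n \near \oo, A_ n w <-> A w) ->
  measurable A /\ P (A_ n) @[n --> \oo] --> P A.
Proof.
move=> mA_ hA.
have mA : measurable A.
  rewrite (_ : A = \bigcup_N \bigcap_(n in [set n | (N <= n)%N]) A_ n).
    apply: bigcupT_measurable => N; apply: bigcap_measurableType => // n _; exact: mA_.
  apply/seteqP; split => w.
    move=> Aw; have [N _ hN] := hA w; exists N => // n /= Nn.
    by apply/hN.
  move=> [N _ hN]; have [M _ hM] := hA w.
  apply/(hM (maxn M N)); first exact: leq_maxl.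
  by apply: hN; exact: leq_maxr.
split => //.
rewrite (_ : P A = \int[P]_w (\1_A w)%:E)%E; last by rewrite integral_indic// setIT.
rewrite (_ : (fun n => P (A_ n)) = (fun n => \int[P]_w (\1_(A_ n) w)%:E)%E); last first.
  by apply/funext => n; rewrite integral_indic// setIT.
apply: (@dominated_cvg _ _ _ P setT measurableT _ _ (cst 1%E)) => //.
- by move=> n; apply/measurable_EFinP.
- move=> w _; apply: cvg_near_cst; near=> n; congr EFin.
  rewrite !indicE; congr (_%:R).
  have : A_ n w <-> A w by near: n; exact: hA.
  by case: (boolP (w \in A)) => wA [h1 h2]; congr nat_of_bool; [apply: mem_set; apply: h2; exact/set_mem|
    apply: memNset => /h1 /mem_set; exact/negP].
- exact: finite_measure_integrable_cst.
- by move=> n w _; rewrite gee0_abs ?lee_fin// indicE; case: (_ \in _).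
Unshelve. all: by end_near. Qed.

Lemma measurable_fun_nat_fiber d (T : measurableType d) (X : T -> nat) :
  (forall n, measurable [set w | X w = n]) -> measurable_fun setT X.
Proof.
move=> mX _ A _; rewrite setTI.
apply: (@measurable_nat_fiber _ _ X (fun n => [set w | A n])) => // n.
have [An|nAn] := pselect (A n).
  by rewrite (_ : [set _ | _] = setT)//; apply/seteqP; split.
by rewrite (_ : [set _ | _] = set0)//; apply/seteqP; split.
Qed.

Lemma measurable_fun_fiber d (T : measurableType d) (R : realType)
    (h : nat -> \bar R) (X : T -> nat) :
  (forall n, measurable [set w | X w = n]) -> measurable_fun setT (fun w => h (X w)).
Proof.
move=> mX; have mh : measurable_fun setT h by [].
exact: (measurableT_comp mh (measurable_fun_nat_fiber mX)).
Qed.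

Section disc.
Context (R : realType).

Definition grid_index (n : nat) (y : R) : nat := Num.truncn (n.+1%:R * Num.max y 0).

(* The grid point lies strictly to the right of [y], as right-continuity
   requires. *)
Definition grid_point (n : nat) (y : R) : R := (grid_index n y).+1%:R / n.+1%:R.

Lemma measurable_grid_index n m : measurable [set y : R | grid_index n y = m].
Proof.
have mx : measurable_fun setT (fun y : R => n.+1%:R * Num.max y 0).
  by apply: measurable_funM => //; exact: measurable_maxr.
rewrite (_ : [set _ | _] = (fun y : R => n.+1%:R * Num.max y 0) @^-1` `[m%:R, m.+1%:R[%classic).
  by rewrite -[X in measurable X]setTI; apply: mx => //; exact: measurable_itv.
have p0 (y : R) : 0 <= n.+1%:R * Num.max y 0 by rewrite mulr_ge0// le_max lexx orbT.
apply/seteqP; split => y /=; rewrite in_itv/= -truncn_eq//.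
  by move=> <-.
by move/eqP.
Qed.

Lemma grid_point_bound n y : 0 <= y -> y < grid_point n y <= y + n.+1%:R^-1.
Proof.
move=> y0; rewrite /grid_point /grid_index (max_idPl y0).
have n0 : 0 < n.+1%:R :> R by rewrite ltr0n.
have /andP[h1 h2] := truncn_itv (mulr_ge0 (ltW n0) y0).
rewrite ltr_pdivlMr// ler_pdivrMr// mulrDl mulVf ?gt_eqF// mulrC h2 /=.
by rewrite -natr1 lerD2r.
Qed.

Lemma grid_point_gt0 n y : 0 < grid_point n y.
Proof. by rewrite divr_gt0// ltr0n. Qed.

Lemma grid_point_cvg (Q : R -> Prop) (y : R) : 0 <= y ->
  (\forall s \near y^'+, Q s) -> \forall n \near \oo, Q (grid_point n y).
Proof.
move=> y0 [e /= e0 he]; near=> n.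
have /andP[h1 h2] := grid_point_bound n y0.
apply: he => //=; rewrite distrC gtr0_norm ?subr_gt0// ltrBlDl (le_lt_trans h2)// ltrD2l.
by near: n; exact: near_infty_natSinv_lt (PosNum e0).
Unshelve. all: by end_near. Qed.

End disc.

(** [pickle] numbers the integers and turns the partition by values into a series; the default of
    [oapp] occurs only at numbers coding no integer, where the event is empty. *)
Lemma integral_int_partition d (T : measurableType d) (R : realType)
    (mu : {measure set T -> \bar R}) (X : T -> int) (phi : int -> R) :
  (forall B : set int, measurable [set w | B (X w)]) -> (forall k, 0 <= phi k) ->
  (\int[mu]_w (phi (X w))%:E = \sum_(0 <= n <oo)
    (oapp phi 0 (unpickle n))%:E * mu [set w | pickle (X w) = n])%E.
Proof.
move=> mX phi0.
have mn n : measurable [set w | pickle (X w) = n] by exact: (mX (fun k => pickle k = n)).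
have mphi : measurable_fun setT (fun w => (phi (X w))%:E).
  by move=> _ C mC; rewrite setTI; exact: (mX (fun k => C (phi k)%:E)).
rewrite (integral_nat_partition mu (X := fun w => pickle (X w)) mn mphi); last first.
  by move=> w; rewrite lee_fin.
apply: eq_eseriesr => n _; rewrite -integral_cst//.
by apply: eq_integral => w /set_mem /= <-; rewrite pickleK.
Qed.

Section mixture.
Context (R : realType) d (T : measurableType d) (P : probability T R).
Variables (X : R -> T -> int) (Y : T -> R).
Hypothesis mX : forall u (B : set int), 0 <= u -> measurable [set w | B (X u w)].
Hypothesis rcX : forall w u, 0 <= u -> \forall s \near u^'+, X s w = X u w.
Hypotheses (mY : measurable_fun setT Y) (Y0 : forall w, 0 <= Y w).
Hypothesis XY : forall u (B : set int) (C : set R), 0 <= u -> measurable C ->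
  P ([set w | B (X u w)] `&` Y @^-1` C) = (P [set w | B (X u w)] * P (Y @^-1` C))%E.
Variable B : set int.

Definition time_law (u : R) : \bar R := P [set w | B (X (Num.max u 0) w)].

Let mXB u : measurable [set w | B (X (Num.max u 0) w)].
Proof. by apply: mX; rewrite le_max lexx orbT. Qed.

Lemma time_lawE u : 0 <= u -> time_law u = P [set w | B (X u w)].
Proof. by move=> u0; rewrite /time_law (max_idPl u0). Qed.

Let time_law_cvg u : 0 <= u -> time_law (grid_point n u) @[n --> \oo] --> time_law u.
Proof.
move=> u0; have [||_] := @cvg_probability_stationary _ _ _ P
  (fun n => [set w | B (X (grid_point n u) w)]) [set w | B (X u w)].
- by move=> n; apply: mX; exact/ltW/grid_point_gt0.
- move=> w; apply: (grid_point_cvg (Q := fun s => B (X s w) <-> B (X u w))) => //.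
  by apply: filterS (rcX w u0) => s /= ->.
rewrite time_lawE// (_ : (fun n => time_law _) = (fun n => P [set w | B (X (grid_point n u) w)]))//.
by apply/funext => n; rewrite time_lawE// ltW// grid_point_gt0.
Qed.

Let grid_measurable n m : measurable [set w | grid_index n (Y w) = m].
Proof.
rewrite (_ : [set _ | _] = Y @^-1` [set y | grid_index n y = m])//.
by rewrite -[X in measurable X]setTI; apply: mY => //; exact: measurable_grid_index.
Qed.

Lemma measurable_time_law : measurable_fun setT time_law.
Proof.
refine (@emeasurable_fun_cvg _ (measurableTypeR R) R setT
  (fun n u => time_law (grid_point n (Num.max u 0))) time_law _ _).
- move=> n; refine (@measurable_fun_fiber _ (measurableTypeR R) R
    (fun m => time_law (m.+1%:R / n.+1%:R)) (fun u => grid_index n (Num.max u 0)) _).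
  move=> m; rewrite (_ : [set _ | _] = [set y | grid_index n y = m]); first exact: measurable_grid_index.
  by apply/seteqP; split => y /=; rewrite /grid_index [in Num.max (Num.max _ _) _](max_idPl _) ?le_max ?lexx ?orbT.
- move=> u _; rewrite (_ : time_law u = time_law (Num.max u 0)).
    by apply: time_law_cvg; rewrite le_max lexx orbT.
  by rewrite /time_law [in RHS](max_idPl _)// le_max lexx orbT.
Qed.

Let mgrid n : measurable [set w | B (X (grid_point n (Y w)) w)].
Proof.
apply: (measurable_nat_fiber (X := fun w => grid_index n (Y w))
  (A := fun m => [set w | B (X (m.+1%:R / n.+1%:R) w)])) => // m.
by apply: mX; rewrite divr_ge0.
Qed.

Let mgrid_law n : measurable_fun setT (fun w => time_law (grid_point n (Y w))).
Proof.
exact: (measurable_fun_fiber (fun m => time_law (m.+1%:R / n.+1%:R)) (X := fun w => grid_index n (Y w))).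
Qed.

Let grid_mixture n : P [set w | B (X (grid_point n (Y w)) w)] =
  (\int[P]_w time_law (grid_point n (Y w)))%E.
Proof.
rewrite (measure_nat_partition P (X := fun w => grid_index n (Y w)))//.
rewrite (integral_nat_partition P (X := fun w => grid_index n (Y w)))//.
apply: eq_eseriesr => m _.
have q0 : 0 <= m.+1%:R / n.+1%:R :> R by rewrite divr_ge0.
transitivity (P ([set w | B (X (m.+1%:R / n.+1%:R) w)] `&` [set w | grid_index n (Y w) = m])).
  congr (P _); apply/seteqP; split => w /= [+ e]; rewrite /grid_point e//.
(* On this cell the random time is a fixed number, so independence at deterministic times is
   enough. *)
rewrite [LHS](XY B q0 (measurable_grid_index n m)).
transitivity (\int[P]_(w in [set w | grid_index n (Y w) = m]) time_law (m.+1%:R / n.+1%:R)%R)%E.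
  by rewrite -(time_lawE q0); symmetry; exact: integral_cst.
by apply: eq_integral => w; rewrite inE /= => e; rewrite /grid_point e.
Qed.

(** Independence is known at fixed times only. The random time is replaced by a grid point to its
    right, taking countably many values; as the paths are locally constant to the right, the events
    stabilize when the grid is refined. *)
Lemma mixture_probability :
  measurable [set w | B (X (Y w) w)] /\
  P [set w | B (X (Y w) w)] = (\int[P]_w time_law (Y w))%E.
Proof.
have [|mA cA] := @cvg_probability_stationary _ _ _ P
  (fun n => [set w | B (X (grid_point n (Y w)) w)]) [set w | B (X (Y w) w)] mgrid.
  move=> w; apply: (grid_point_cvg (Q := fun s => B (X s w) <-> B (X (Y w) w))) => //.
  by apply: filterS (rcX w (Y0 w)) => s /= ->.
split => //.
have c2 : (\int[P]_w time_law (grid_point n (Y w)) @[n --> \oo] --> \int[P]_w time_law (Y w))%E.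
  apply: (@dominated_cvg _ _ _ P setT measurableT _ _ (cst 1%E)) => //.
  - by move=> w _; exact: time_law_cvg.
  - exact: finite_measure_integrable_cst.
  - by move=> n w _; rewrite gee0_abs//; exact: probability_le1.
have e : (fun n => P [set w | B (X (grid_point n (Y w)) w)]) =
    (fun n => \int[P]_w time_law (grid_point n (Y w)))%E.
  by apply/funext => n; exact: grid_mixture.
rewrite e in cA; exact: (cvg_unique _ cA c2).
Qed.

End mixture.

Section mixture_expectation.
Context (R : realType) d (T : measurableType d) (P : probability T R).
Variables (X : R -> T -> int) (Y : T -> R).
Hypothesis mX : forall u (B : set int), 0 <= u -> measurable [set w | B (X u w)].
Hypothesis rcX : forall w u, 0 <= u -> \forall s \near u^'+, X s w = X u w.
Hypotheses (mY : measurable_fun setT Y) (Y0 : forall w, 0 <= Y w).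
Hypothesis XY : forall u (B : set int) (C : set R), 0 <= u -> measurable C ->
  P ([set w | B (X u w)] `&` Y @^-1` C) = (P [set w | B (X u w)] * P (Y @^-1` C))%E.

Lemma mixture_expectation (phi : int -> R) (psi : R -> R) :
  (forall k, 0 <= phi k) ->
  (forall u, 0 <= u -> (\int[P]_w (phi (X u w))%:E = (psi u)%:E)%E) ->
  (\int[P]_w (phi (X (Y w) w))%:E = \int[P]_w (psi (Y w))%:E)%E.
Proof.
move=> phi0 hpsi.
have mix B := mixture_probability mX rcX mY Y0 XY B.
rewrite (integral_int_partition P (X := fun w => X (Y w) w))//; last first.
  by move=> B; exact: (mix B).1.
have mlaw (n : nat) : measurable_fun setT (fun w => time_law P X [set k | pickle k = n] (Y w)).
  have h := measurable_time_law P mX rcX [set k | pickle k = n].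
  exact: (measurableT_comp h mY).
have c0 n : (0 <= (oapp phi 0 (unpickle n))%:E)%E.
  by rewrite lee_fin; case: (unpickle n).
transitivity (\int[P]_w \sum_(0 <= n <oo) ((oapp phi 0 (unpickle n))%:E *
    time_law P X [set k | pickle k = n] (Y w)))%E.
  rewrite integral_nneseries//.
  - apply: eq_eseriesr => n _; rewrite ge0_integralZl//.
    by congr (_ * _)%E; exact: (mix [set k | pickle k = n]).2.
  - move=> n; apply: emeasurable_funM => //.
  - by move=> n w _; rewrite mule_ge0// measure_ge0.
apply: eq_integral => w _; rewrite -hpsi//.
rewrite (integral_int_partition P (X := X (Y w)))//; last by move=> B; exact: mX.
by apply: eq_eseriesr => n _; rewrite time_lawE.
Qed.

End mixture_expectation.

(** * The Skellam process *)

(** The fundamental theorem of calculus without subtraction, a form that survives summation over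
    infinitely many states. *)
Lemma derivative_integral_equation (R : realType) (F A B : R -> R) (u : R) :
  0 <= u -> (forall x : R, is_derive x 1 F (A x - B x)) ->
  continuous A -> continuous B ->
  ((F u)%:E + \int[lebesgue_measure]_(v in `]0%R, u]) (B v)%:E =
   (F 0)%:E + \int[lebesgue_measure]_(v in `]0%R, u]) (A v)%:E)%E.
Proof.
rewrite le_eqVlt => /predU1P[<- _ _ _|u0 dF cA cB].
  by rewrite set_itvoc0 !integral_set0.
have iC (G : R -> R) : continuous G ->
    lebesgue_measure.-integrable `[0, u] (EFin \o G).
  move=> cG; apply: continuous_compact_integrable; first exact: segment_compact.
  exact: continuous_subspaceT.
have cAB : continuous (fun x => A x - B x).
  by move=> x; apply: cvgB; [exact: cA|exact: cB].
have mC (G : R -> R) : continuous G -> measurable_fun setT G.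
  exact: continuous_measurable_fun.
have cF : continuous F.
  by move=> x; apply: differentiable_continuous; apply/derivable1_diffP/ex_derive; exact: dF.
have h : (\int[lebesgue_measure]_(v in `[0%R, u]) (A v - B v)%:E = (F u - F 0)%:E)%E.
  rewrite EFinB.
  apply: (continuous_FTC2 u0).
  - exact: continuous_subspaceT.
  - split.
    + by move=> x _; apply: ex_derive; exact: dF.
    + by apply: cvg_at_right_filter; exact: cF.
    + by apply: cvg_at_left_filter; exact: cF.
  - by move=> x _; rewrite derive1E; apply: derive_val; exact: dF.
rewrite !integral_itv_obnd_cbnd; last 2 first.
- by apply: measurable_funTS; apply/measurable_EFinP; exact: mC.
- by apply: measurable_funTS; apply/measurable_EFinP; exact: mC.
have fin (G : R -> R) : continuous G ->
    (\int[lebesgue_measure]_(v in `[0%R, u]) (G v)%:E)%E \is a fin_num.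
  by move=> cG; apply: integrable_fin_num => //; exact: iC.
rewrite (_ : (\int[lebesgue_measure]_(v in `[0%R, u]) (A v)%:E =
    \int[lebesgue_measure]_(v in `[0%R, u]) (A v - B v)%:E +
    \int[lebesgue_measure]_(v in `[0%R, u]) (B v)%:E)%E).
  by rewrite h [RHS]addeA -EFinD [F 0 + _]addrC subrK.
rewrite -integralD//; [|exact: (iC _ cAB)|exact: iC].
by apply: eq_integral => v _; rewrite -EFinD subrK.
Qed.

Lemma nneseries_shift (R : realType) (f : nat -> \bar R) (m : nat) :
  (forall i, 0 <= f i)%E -> (forall i, (i < m)%N -> f i = 0%E) ->
  (\sum_(0 <= i <oo) f i = \sum_(0 <= i <oo) f (i + m)%N)%E.
Proof.
move=> f0; elim: m => [_|m IH fm]; first by apply: eq_eseriesr => i _; rewrite addn0.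
rewrite IH; last by move=> i im; apply: fm; exact: ltnW.
rewrite nneseries_recl//= add0n fm// add0e.
rewrite -(@nneseries_addn R _ 1)//.
by apply: eq_eseriesr => i _; rewrite addn1 addSnnS.
Qed.

Section poisson_weight.
Context (R : realType).

(* Vanishing at negative [j] removes all boundary cases from the forward
   equations. *)
Definition poisson_weight (a : R) (j : int) : R :=
  if j is Posz n then a ^+ n / n`!%:R * expR (- a) else 0.

Lemma poisson_weight_ge0 a j : 0 <= a -> 0 <= poisson_weight a j.
Proof.
by move=> a0; case: j => //= n; rewrite mulr_ge0 ?expR_ge0// divr_ge0// exprn_ge0.
Qed.

Lemma poisson_weight0 j : poisson_weight 0 j = (j == 0)%:R.
Proof.
case: j => [[|n]|n] //=; first by rewrite expr0 fact0 divr1 mul1r oppr0 expR0.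
by rewrite expr0n /= !mul0r.
Qed.

Lemma is_derive_poisson_weight (lambda x : R) j :
  is_derive x 1 (fun v => poisson_weight (lambda * v) j)
    (lambda * (poisson_weight (lambda * x) (j - 1) - poisson_weight (lambda * x) j)).
Proof.
have hl : is_derive x 1 (fun v : R => lambda * v) lambda.
  have -> : (fun v : R => lambda * v) = lambda \*: (@idfun R) by [].
  by apply: is_derive_eq; rewrite /GRing.scale /= mulr1.
have he (a : R) : is_derive a 1 (fun a => expR (- a)) (- expR (- a)).
  have h := @is_derive1_comp _ expR (fun t : R => - t) a _ _ (is_derive_expR _) (is_deriveN (is_derive_id a 1)).
  by apply: (is_derive_eq h); rewrite mulrN1.
have hw (a : R) : is_derive a 1 (poisson_weight ^~ j) (poisson_weight a (j - 1) - poisson_weight a j).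
  case: j => [[|n]|n] /=.
  - rewrite (_ : (fun a => _) = (fun a => expR (- a))); last first.
      by apply/funext => b; rewrite expr0 fact0 divr1 mul1r.
    by apply: (is_derive_eq (he a)); rewrite /= expr0 fact0 divr1 mul1r sub0r.
  - have hX := is_deriveZ n.+1`!%:R^-1 (is_deriveX n.+1 (is_derive_id a (1 : R))).
    rewrite (_ : (fun a => _) = (n.+1`!%:R^-1 \*: (@idfun R ^+ n.+1)) * (fun a => expR (- a))); last first.
      by apply/funext => b; rewrite !fctE [in LHS]mulrC mulrC [_ ^+ _ / _]mulrC.
    apply: (is_derive_eq (is_deriveM hX (he a))).
    have n0 : n.+1%:R != 0 :> R by rewrite pnatr_eq0.
    have f0 : n`!%:R != 0 :> R by rewrite pnatr_eq0 -lt0n fact_gt0.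
    rewrite subn1 !fctE /GRing.scale /= factS natrM -[_ *: _]/(_ * _) exprS.
    move: n0 f0; move: (n.+1%:R : R) (n`!%:R : R) => c e n0 f0.
    by field; rewrite n0 f0.
  - by rewrite subrr; exact: is_derive_cst.
have h := @is_derive1_comp _ (poisson_weight ^~ j) (fun v : R => lambda * v) x _ _ (hw _) hl.
by apply: (is_derive_eq h); rewrite mulrC.
Qed.

End poisson_weight.

Section skellam_weight.
Context (R : realType).
Variables lambda1 lambda2 : R.
Hypotheses (l10 : 0 < lambda1) (l20 : 0 < lambda2).
Notation leb := (@lebesgue_measure R).

Definition pair_weight (i j : int) (v : R) : R :=
  poisson_weight (lambda1 * v) i * poisson_weight (lambda2 * v) j.

(** P(N1 - N2 = k) summed over N1 = i; terms with i < k vanish because [poisson_weight] is 0 at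
    negative indices. *)
Definition skellam_weight (k : int) (v : R) : \bar R :=
  (\sum_(0 <= i <oo) (pair_weight i%:Z (i%:Z - k) v)%:E)%E.

Lemma pair_weight_ge0 i j v : 0 <= v -> 0 <= pair_weight i j v.
Proof.
by move=> v0; rewrite mulr_ge0// poisson_weight_ge0// mulr_ge0// ltW.
Qed.

Let continuous_is_derive (F dF : R -> R) : (forall x : R, is_derive x 1 F (dF x)) -> continuous F.
Proof.
move=> hF x; apply: differentiable_continuous; apply/derivable1_diffP/ex_derive; exact: hF.
Qed.

Let continuous_poisson (lambda : R) j : continuous (fun v => poisson_weight (lambda * v) j).
Proof. exact: (continuous_is_derive (fun x => is_derive_poisson_weight lambda x j)). Qed.

Lemma continuous_pair_weight i j : continuous (pair_weight i j).
Proof. by move=> x; apply: cvgM; exact: continuous_poisson. Qed.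

Lemma measurable_pair_weight i j : measurable_fun setT (pair_weight i j).
Proof. by apply: continuous_measurable_fun; exact: continuous_pair_weight. Qed.

Lemma measurable_skellam_weight k : measurable_fun setT (fun v : R => skellam_weight k (Num.max v 0)).
Proof.
apply: ge0_emeasurable_sum => i.
  by move=> x _ _; rewrite lee_fin pair_weight_ge0// le_max lexx orbT.
move=> _; apply/measurable_EFinP; apply: (measurableT_comp (measurable_pair_weight _ _)).
exact: measurable_maxr.
Qed.

(** The forward equation of the pair of independent Poisson processes, from the product rule. *)
Lemma pair_weight_equation i j u : 0 <= u ->
  ((pair_weight i j u)%:E +
     \int[leb]_(v in `]0%R, u]) ((lambda1 + lambda2) * pair_weight i j v)%:E =
   (pair_weight i j 0)%:E + \int[leb]_(v in `]0%R, u])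
     (lambda1 * pair_weight (i - 1) j v + lambda2 * pair_weight i (j - 1) v)%:E)%E.
Proof.
move=> u0; apply: (derivative_integral_equation (F := pair_weight i j)
  (A := fun v => lambda1 * pair_weight (i - 1) j v + lambda2 * pair_weight i (j - 1) v)
  (B := fun v => (lambda1 + lambda2) * pair_weight i j v)) => //.
- move=> x; have h1 := is_derive_poisson_weight lambda1 x i.
  have h2 := is_derive_poisson_weight lambda2 x j.
  apply: (is_derive_eq (is_deriveM h1 h2)); rewrite /GRing.scale /= /pair_weight; ring.
- by move=> x; apply: cvgD; apply: cvgMl_tmp; exact: continuous_pair_weight.
- by move=> x; apply: cvgMl_tmp; exact: continuous_pair_weight.
Qed.

Let wE i j (u : R) : 0 <= u -> (0 <= (pair_weight i j u)%:E)%E.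
Proof. by move=> u0; rewrite lee_fin pair_weight_ge0. Qed.

Lemma skellam_weight_ge0 k u : 0 <= u -> (0 <= skellam_weight k u)%E.
Proof. by move=> u0; apply: nneseries_ge0 => i _ _; exact: wE. Qed.

Lemma skellam_weight0 k : skellam_weight k 0 = (k == 0)%:R%:E.
Proof.
rewrite /skellam_weight (nneseries_shift (m := 0))//; last by move=> i; exact: wE.
rewrite nneseries_recl//; last by move=> i _; exact: wE.
rewrite eseries0 ?adde0; last first.
  move=> [|i] // _ _; rewrite /pair_weight !mulr0 !poisson_weight0 mul0r//.
by rewrite /pair_weight !mulr0 !poisson_weight0 eqxx mul1r sub0r oppr_eq0.
Qed.

(** The term i = 0 vanishes, having index -1, and the rest is reindexed by i + 1. *)
Lemma skellam_weight_pred k u : 0 <= u ->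
  (\sum_(0 <= i <oo) (pair_weight (i%:Z - 1) (i%:Z - k) u)%:E = skellam_weight (k - 1) u)%E.
Proof.
move=> u0; rewrite (nneseries_shift (m := 1)); last 2 first.
- by move=> i; exact: wE.
- by case=> // _; rewrite /pair_weight mul0r.
apply: eq_eseriesr => i _; rewrite PoszD addrK; congr (pair_weight _ _ u)%:E.
by rewrite opprB addrA.
Qed.

(** The pair equations are summed over i. Since they are integrated and nonnegative, Tonelli
    replaces a termwise differentiation of the series. *)
Lemma skellam_weight_equation k u : 0 <= u ->
  (skellam_weight k u + \int[leb]_(v in `]0%R, u]) ((lambda1 + lambda2)%:E * skellam_weight k v) =
   (k == 0)%:R%:E + \int[leb]_(v in `]0%R, u])
     (lambda1%:E * skellam_weight (k - 1) v + lambda2%:E * skellam_weight (k + 1) v))%E.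
Proof.
move=> u0; pose D : set (measurableTypeR R) := `]0, u]%classic.
have mD : measurable D by exact: measurable_itv.
have D0 v : D v -> 0 <= v by rewrite /D /= in_itv/= => /andP[/ltW].
have mw i j : measurable_fun setT (pair_weight i j : measurableTypeR R -> R).
  exact: measurable_pair_weight.
transitivity (\sum_(0 <= i <oo) ((pair_weight i%:Z (i%:Z - k) u)%:E +
    \int[leb]_(v in D) ((lambda1 + lambda2) * pair_weight i%:Z (i%:Z - k) v)%:E))%E.
  rewrite nneseriesD//; last 2 first.
  - by move=> i _ _; exact: wE.
  - by move=> i _ _; apply: integral_ge0 => v /D0 v0; rewrite lee_fin mulr_ge0 ?pair_weight_ge0// addr_ge0// ltW.
  congr (_ + _)%E; rewrite -integral_nneseries//.
  - apply: eq_integral => v /set_mem /D0 v0; rewrite -nneseriesZl//; last first.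
      by move=> i _; exact: wE.
  - move=> i; apply/measurable_EFinP; apply: measurable_funM => //.
    exact: measurable_funTS.
  - by move=> i v /D0 v0; rewrite lee_fin mulr_ge0 ?pair_weight_ge0// addr_ge0// ltW.
rewrite (eq_eseriesr (fun i _ => pair_weight_equation i%:Z (i%:Z - k) u0)).
rewrite nneseriesD//; last 2 first.
- by move=> i _ _; exact: wE.
- move=> i _ _; apply: integral_ge0 => v /D0 v0.
  by rewrite lee_fin addr_ge0// mulr_ge0 ?pair_weight_ge0// ltW.
congr (_ + _)%E; first exact: skellam_weight0.
rewrite -integral_nneseries//; last 2 first.
- move=> i; apply/measurable_EFinP; apply: measurable_funD; apply: measurable_funM => //;
    exact: measurable_funTS.
- by move=> i v /D0 v0; rewrite lee_fin addr_ge0// mulr_ge0 ?pair_weight_ge0// ltW.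
apply: eq_integral => v /set_mem /D0 v0.
transitivity (\sum_(0 <= i <oo) (lambda1%:E * (pair_weight (i%:Z - 1) (i%:Z - k) v)%:E +
    lambda2%:E * (pair_weight i%:Z (i%:Z - (k + 1)) v)%:E))%E.
  by apply: eq_eseriesr => i _; rewrite EFinD !EFinM opprD addrA.
rewrite nneseriesD; last 2 first.
- by move=> i _ _; rewrite mule_ge0 ?lee_fin ?(ltW l10)// pair_weight_ge0.
- by move=> i _ _; rewrite mule_ge0 ?lee_fin ?(ltW l20)// pair_weight_ge0.
rewrite !nneseriesZl; [|by move=> i _; exact: wE|by move=> i _; exact: wE].
by rewrite skellam_weight_pred.
Qed.

End skellam_weight.

(** * The Bessel form of the Skellam law *)

Section skellam_pmf.
Context (R : realType).
Variables lambda1 lambda2 : R.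
Hypotheses (l10 : 0 < lambda1) (l20 : 0 < lambda2).
Notation sw := (skellam_weight lambda1 lambda2).
Notation pw := (pair_weight lambda1 lambda2).

Let term (m : nat) (z : R) (n : nat) : R :=
  (z / 2) ^+ (2 * n + m) / (n`!%:R * (n + m)`!%:R).

Let term_ge0 m z n : 0 <= z -> 0 <= term m z n.
Proof. by move=> z0; rewrite divr_ge0// ?exprn_ge0 ?divr_ge0// mulr_ge0. Qed.

(** [besselI] is a real limit, meaningful only after convergence is shown, here by comparison with
    (z/2)^m times the exponential series at (z/2)^2. *)
Lemma besselIE (m : nat) (z : R) : 0 <= z ->
  ((besselI m z)%:E = \sum_(0 <= n <oo) (term m z n)%:E)%E.
Proof.
move=> z0; have z20 : 0 <= z / 2 by rewrite divr_ge0.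
have cv : cvgn (series (term m z)).
  apply: (@series_le_cvg _ _ (fun n => (z / 2) ^+ m * exp_coeff ((z / 2) ^+ 2) n)).
  - by move=> n; exact: term_ge0.
  - by move=> n; rewrite mulr_ge0 ?exprn_ge0// divr_ge0// exprn_ge0// exprn_ge0.
  - move=> n; rewrite /term /exp_coeff /= exprD exprM.
    rewrite [leLHS](_ : _ = (z / 2) ^+ m * ((z / 2) ^+ 2 ^+ n / n`!%:R) * (n + m)`!%:R^-1); last first.
      by field; rewrite !pnatr_eq0 -!lt0n !fact_gt0.
    rewrite ler_piMr//; first by rewrite mulr_ge0 ?exprn_ge0// divr_ge0// exprn_ge0// exprn_ge0.
    by rewrite invf_le1 ?ler1n ?ltr0n ?fact_gt0.
  - by apply: is_cvg_seriesZ; exact: is_cvg_series_exp_coeff.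
rewrite /besselI -EFin_lim//; congr (limn _); apply/funext => N /=.
by rewrite /series /= sumEFin.
Qed.

(** Chosen so that r s = lambda1 and s / r = lambda2; the half-integer power of lambda1 / lambda2
    becomes an integer power of r. *)
Let r := Num.sqrt (lambda1 / lambda2).
Let s := Num.sqrt (lambda1 * lambda2).

Let r0 : 0 < r. Proof. by rewrite sqrtr_gt0 divr_gt0. Qed.

Let rs : r * s = lambda1.
Proof.
rewrite -sqrtrM ?divr_ge0 ?ltW// (_ : _ / _ * _ = lambda1 ^+ 2); last first.
  by field; rewrite gt_eqF.
by rewrite sqrtr_sqr gtr0_norm.
Qed.

Let ss : s * s = lambda1 * lambda2.
Proof. by rewrite -expr2 sqr_sqrtr// mulr_ge0// ltW. Qed.

Let powr m : (lambda1 / lambda2) `^ (m%:R / 2) = r ^+ m.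
Proof.
have q0 : 0 <= lambda1 / lambda2 by rewrite divr_ge0// ltW.
by rewrite [m%:R / 2]mulrC powRrM powR12_sqrt// powR_mulrn//; exact: ltW.
Qed.

Let r_neq0 : r != 0. Proof. by rewrite gt_eqF. Qed.

Let term_pairE (u a b : R) (n m : nat) :
  a = r ^+ m * s ^+ m -> b = (s * s) ^+ n ->
  u ^+ n * u ^+ (n + m) * (a * b) = r ^+ m * (2 * u * s / 2) ^+ (2 * n + m).
Proof.
move=> -> ->; rewrite (_ : 2 * u * s / 2 = u * s); last by field.
by rewrite mul2n -addnn !exprD !exprMn; ring.
Qed.

(** The index n of the Bessel series is the smaller of the two counts and m their difference. *)
Let pair_term_pos (u : R) (n m : nat) :
  pw (n + m)%N%:Z n u =
  expR (- (u * (lambda1 + lambda2))) * r ^+ m * term m (2 * u * s) n.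
Proof.
rewrite /pair_weight /= /term [in RHS]mulrA -[expR _ * _ * _]mulrA.
rewrite -(@term_pairE u (lambda1 ^+ m) (lambda1 ^+ n * lambda2 ^+ n)); last 2 first.
- by rewrite -exprMn rs.
- by rewrite ss exprMn.
rewrite mulrDr opprD expRD ![u * _]mulrC !exprMn !exprD.
by field; rewrite !pnatr_eq0 -!lt0n !fact_gt0.
Qed.

Let pair_term_neg (u : R) (n m : nat) :
  pw n (n + m)%N%:Z u =
  expR (- (u * (lambda1 + lambda2))) * (r ^+ m)^-1 * term m (2 * u * s) n.
Proof.
rewrite /pair_weight /= /term [in RHS]mulrA -[expR _ * _ * _]mulrA.
have -> : (r ^+ m)^-1 * (2 * u * s / 2) ^+ (2 * n + m) =
    u ^+ n * u ^+ (n + m) * (lambda2 ^+ m * (lambda1 ^+ n * lambda2 ^+ n)).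
  have rm0 : r ^+ m != 0 by rewrite expf_neq0.
  apply: (mulfI rm0); rewrite [LHS]mulrA (mulfV rm0) mul1r.
  have := @term_pairE u (lambda1 ^+ m) (lambda1 ^+ n * lambda2 ^+ n) n m.
  rewrite -exprMn rs ss exprMn => /(_ erefl erefl) h.
  apply: (mulfI rm0); rewrite -h.
  have -> : r ^+ m * (r ^+ m * (u ^+ n * u ^+ (n + m) * (lambda2 ^+ m * (lambda1 ^+ n * lambda2 ^+ n)))) =
    (r * r * lambda2) ^+ m * (u ^+ n * u ^+ (n + m) * (lambda1 ^+ n * lambda2 ^+ n)).
    by rewrite !exprMn; ring.
  have -> : r * r * lambda2 = lambda1.
    by rewrite -expr2 sqr_sqrtr ?divr_ge0 ?ltW// divfK// gt_eqF.
  ring.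
rewrite mulrDr opprD expRD ![u * _]mulrC !exprMn !exprD.
by field; rewrite !pnatr_eq0 -!lt0n !fact_gt0.
Qed.

Let skellam_pmf_series (u : R) (k : int) : 0 <= u -> 
  (skellam_pmf lambda1 lambda2 u k)%:E =
  (\sum_(0 <= n <oo) (expR (- (u * (lambda1 + lambda2))) *
  (lambda1 / lambda2) `^ (k%:~R / 2) * term `|k|%N (2 * u * s) n)%:E)%E.
Proof.
move=> u0; have z0 : 0 <= 2 * u * s by rewrite !mulr_ge0// sqrtr_ge0.
rewrite /skellam_pmf EFinM besselIE// -nneseriesZl; last first.
  by move=> n _; rewrite lee_fin term_ge0.
by apply: eq_eseriesr => n _; rewrite -EFinM.
Qed.

(** For k >= 0 the first k terms of the convolution vanish and the series is shifted by k; for k < 0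
    the two series agree term by term. *)
Lemma skellam_pmfE (u : R) (k : int) : 0 <= u ->
  (skellam_pmf lambda1 lambda2 u k)%:E = sw k u.
Proof.
move=> u0; rewrite skellam_pmf_series// /skellam_weight.
have w0 i j : (0 <= (pw i j u)%:E)%E by rewrite lee_fin pair_weight_ge0.
case: k => m.
  rewrite [RHS](nneseries_shift (m := m)) => //; last first.
    move=> i im; rewrite /pair_weight.
    have -> : i%:Z - m%:Z = Negz (m - i).-1.
      by rewrite NegzE prednK ?subn_gt0// -subzn ?(ltnW im)// opprB.
    by rewrite mulr0.
  apply: eq_eseriesr => n _.
  by rewrite PoszD addrK -PoszD pair_term_pos absz_nat powr.
apply: eq_eseriesr => n _; rewrite NegzE opprK -PoszD pair_term_neg abszN absz_nat.
by rewrite mulrNz mulNr powRN powr.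
Qed.

End skellam_pmf.

Lemma exp_seriesE (R : realType) (x : R) :
  ((expR x)%:E = \sum_(0 <= n <oo) (exp_coeff x n)%:E)%E.
Proof.
rewrite /expR -EFin_lim//; last exact: is_cvg_series_exp_coeff.
by congr (limn _); apply/funext => N /=; rewrite /series /= sumEFin.
Qed.

Lemma poisson_mgf (R : realType) (a theta : R) : 0 <= a ->
  (\sum_(0 <= n <oo) (expR (theta * n%:R) * poisson_weight a n)%:E =
   (expR (a * (expR theta - 1)))%:E)%E.
Proof.
move=> a0; rewrite mulrBr mulr1 expRD mulrC EFinM (exp_seriesE (a * expR theta)) -nneseriesZl; last first.
  by move=> n _; rewrite lee_fin divr_ge0// exprn_ge0// mulr_ge0// expR_ge0.
apply: eq_eseriesr => n _; rewrite -EFinM; congr EFin.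
by rewrite /poisson_weight /exp_coeff /= exprMn mulrC [theta * _]mulrC expRM_natl; ring.
Qed.

Section poisson_process.
Context (R : realType) d (T : measurableType d) (P : probability T R).
Variables (lambda : R) (N : R -> T -> nat).
Hypotheses (l0 : 0 < lambda) (hN : is_poisson_process P lambda N).

Let sN := poisson_process_levy hN.

Let natE u n : [set w | N u w = n] = (fun w => (N u w)%:R : R) @^-1` [set n%:R].
Proof.
by apply/seteqP; split => w /= => [->//|/eqP]; rewrite eqr_nat => /eqP.
Qed.

Lemma poisson_process_measurable u n : 0 <= u -> measurable [set w | N u w = n].
Proof.
move=> u0; rewrite natE -[X in measurable X]setTI.
exact: (subordinator_measurable sN u0).
Qed.

Lemma poisson_process_start : P.-negligible [set w | N 0 w <> 0%N].
Proof.
have := subordinator_start sN; apply: negligibleS => w /= h1 h2; apply: h1.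
by move/eqP: h2; rewrite pnatr_eq0 => /eqP.
Qed.

Lemma poisson_process_weight u n : 0 <= u ->
  P [set w | N u w = n] = (poisson_weight (lambda * u) n)%:E.
Proof.
rewrite le_eqVlt => /predU1P[<-|u0]; last first.
  (* The law is prescribed for positive times; time 0 is recovered below from the almost sure start
     at 0. *)
  by rewrite (poisson_process_law hN)// /poisson_pmf mulr_gt0.
rewrite mulr0 poisson_weight0.
have m0 n' : measurable [set w | N 0 w = n'] by exact: poisson_process_measurable.
case: n => [|n].
  rewrite -(probability_setT P); apply: (measure_eq_negligible (m0 0%N) measurableT poisson_process_start).
    by move=> w _; left.
  by move=> w _; have [e|/eqP e] := eqVneq (N 0 w) 0%N; [left|right].
rewrite -[RHS](measure0 P); apply: (measure_eq_negligible (m0 n.+1) measurable0 poisson_process_start) => //.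
by move=> w /= e; right; rewrite e.
Qed.

(** Integers at distance less than 1 are equal, so a right-continuous integer path is constant just
    to the right of u. *)
Lemma poisson_process_right_constant u w : 0 <= u ->
  \forall s \near u^'+, N s w = N u w.
Proof.
move=> u0; have cv := @subordinator_right_continuous _ _ _ _ _ sN w u u0.
have /= h : \forall s \near u^'+, `|(N u w)%:R - (N s w)%:R| < (1 : R).
  exact: (@cvgr_dist_lt _ _ _ _ _ _ _ cv 1 ltr01).
apply: filterS h => s; rewrite ltr_distl ltrBlDr !natr1 !ltr_nat !ltnS => /andP[h1 h2].
by apply/eqP; rewrite eqn_leq h1 h2.
Qed.

Lemma poisson_process_sigma u n : 0 <= u ->
  process_sigma_algebra (fun t w => (N t w)%:R : R) [set w | N u w = n].
Proof.
move=> u0; apply: sub_sigma_algebra; exists u; first by rewrite /= in_itv/= u0.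
by exists [set n%:R] => //; rewrite setTI natE.
Qed.

End poisson_process.

Section skellam_process.
Context (R : realType) d (T : measurableType d) (P : probability T R).
Variables (lambda1 lambda2 : R) (N1 N2 : R -> T -> nat).
Hypotheses (l10 : 0 < lambda1) (l20 : 0 < lambda2).
Hypotheses (hN1 : is_poisson_process P lambda1 N1) (hN2 : is_poisson_process P lambda2 N2).
Hypothesis N12 : independent_processes P (fun t w => (N1 t w)%:R) (fun t w => (N2 t w)%:R).

Let S (u : R) (w : T) : int := (N1 u w)%:Z - (N2 u w)%:Z.

Let m1 u n : 0 <= u -> measurable [set w | N1 u w = n] := poisson_process_measurable hN1 n (u:=u).
Let m2 u n : 0 <= u -> measurable [set w | N2 u w = n] := poisson_process_measurable hN2 n (u:=u).

Lemma skellam_process_measurable u (B : set int) : 0 <= u -> measurable [set w | B (S u w)].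
Proof.
move=> u0; apply: (@measurable_nat_fiber _ _ (N1 u) (fun n => [set w | B (n%:Z - (N2 u w)%:Z)])).
  by move=> n; exact: m1.
move=> n; apply: (@measurable_nat_fiber _ _ (N2 u) (fun j => [set w | B (n%:Z - j%:Z)])).
  by move=> j; exact: m2.
move=> j; have [h|h] := pselect (B (n%:Z - j%:Z)).
  by rewrite (_ : [set _ | _] = setT)//; apply/seteqP; split.
by rewrite (_ : [set _ | _] = set0)//; apply/seteqP; split.
Qed.

Lemma skellam_process_right_constant w u : 0 <= u -> \forall s \near u^'+, S s w = S u w.
Proof.
move=> u0; have h1 := poisson_process_right_constant hN1 w u0.
have h2 := poisson_process_right_constant hN2 w u0.
by near=> s; rewrite /S; congr (_%:Z - _%:Z); near: s.
Unshelve. all: by end_near. Qed.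

Lemma skellam_process_start : P.-negligible [set w | S 0 w <> 0].
Proof.
apply: (negligibleS _ (negligibleU (poisson_process_start hN1) (poisson_process_start hN2))).
move=> w /= h; have [e1|/eqP] := eqVneq (N1 0 w) 0%N; last by left.
have [e2|/eqP] := eqVneq (N2 0 w) 0%N; last by right.
by exfalso; apply: h; rewrite /S e1 e2.
Qed.

Lemma skellam_process_joint u i j : 0 <= u ->
  P ([set w | N1 u w = i] `&` [set w | N2 u w = j]) =
  (pair_weight lambda1 lambda2 i j u)%:E.
Proof.
move=> u0; rewrite N12; [|exact: poisson_process_sigma|exact: poisson_process_sigma].
by rewrite (poisson_process_weight l10 hN1)// (poisson_process_weight l20 hN2)// EFinM.
Qed.

Lemma skellam_process_law u k : 0 <= u ->
  P [set w | S u w = k] = skellam_weight lambda1 lambda2 k u.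
Proof.
move=> u0; rewrite (measure_nat_partition P (X := N1 u)); last 2 first.
- by move=> n; exact: m1.
- exact: (skellam_process_measurable (fun z => z = k)).
apply: eq_eseriesr => i _.
have -> : [set w | S u w = k] `&` [set w | N1 u w = i] =
    [set w | N1 u w = i] `&` [set w | (N2 u w)%:Z = i%:Z - k].
  apply/seteqP; split => w /=.
    by move=> [<- <-]; split => //; rewrite /S subKr.
  by move=> [<- h]; split => //; rewrite /S h subKr.
case: (i%:Z - k) => j.
  rewrite -skellam_process_joint//; congr (P (_ `&` _)).
  by apply/seteqP; split => w /= [->].
rewrite /pair_weight mulr0 (_ : [set w | _ = Negz j] = set0) ?setI0 ?measure0//.
by apply/seteqP; split.
Qed.

(** Summing over both counts factors the expectation into two Poisson transforms, the second taken
    at -theta. *)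
Lemma skellam_process_mgf u theta : 0 <= u ->
  (\int[P]_w (expR (theta * (S u w)%:~R))%:E =
   (expR (- ((lambda1 + lambda2 - lambda1 * expR theta - lambda2 * expR (- theta)) * u)))%:E)%E.
Proof.
move=> u0; pose g w := (expR (theta * (S u w)%:~R))%:E.
have mg : measurable_fun setT g.
  apply/measurable_EFinP; apply: measurableT_comp => //; apply: measurable_funM => //.
  move=> _ C mC; rewrite setTI.
  exact: (skellam_process_measurable (fun k => C k%:~R)).
have g0 w : (0 <= g w)%E by rewrite lee_fin expR_ge0.
have mA i : measurable [set w | N1 u w = i] by exact: m1.
have mB j : measurable [set w | N2 u w = j] by exact: m2.
have lu1 : 0 <= lambda1 * u by rewrite mulr_ge0// ltW.
have lu2 : 0 <= lambda2 * u by rewrite mulr_ge0// ltW.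
rewrite (integral_nat_partition P (X := N1 u) mA mg g0).
transitivity (\sum_(0 <= i <oo) ((expR (lambda2 * u * (expR (- theta) - 1)))%:E *
    (expR (theta * i%:R) * poisson_weight (lambda1 * u) i)%:E))%E.
  apply: eq_eseriesr => i _; rewrite integral_mkcond.
  rewrite (integral_nat_partition P (X := N2 u) mB); last 2 first.
  - by apply/(measurable_restrictT _ _).1 => //; exact: measurable_funTS.
  - by move=> w; rewrite patchE; case: ifP.
  rewrite -poisson_mgf// muleC -nneseriesZl; last first.
    by move=> j _; rewrite lee_fin mulr_ge0 ?expR_ge0// poisson_weight_ge0.
  apply: eq_eseriesr => j _; rewrite -integral_mkcondr.
  transitivity (\int[P]_(w in [set w | N2 u w = j] `&` [set w | N1 u w = i])
      (expR (theta * (i%:R - j%:R)))%:E)%E.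
    apply: eq_integral => w /set_mem [/= e2 e1].
    by rewrite /g /S e1 e2 rmorphB.
  rewrite integral_cst; last exact: measurableI.
  rewrite setIC [X in (_ * X)%E]skellam_process_joint// -!EFinM; congr EFin.
  by rewrite /pair_weight mulrBr expRD mulNr; ring.
rewrite nneseriesZl; last first.
  by move=> i _; rewrite lee_fin mulr_ge0 ?expR_ge0// poisson_weight_ge0.
by rewrite poisson_mgf// -EFinM -expRD; congr (expR _)%:E; ring.
Qed.

Lemma skellam_process_indep (Y : R -> T -> R) u t (B : set int) (C : set R) :
  independent_processes P (fun t w => (S t w)%:~R) Y ->
  0 <= u -> 0 <= t -> measurable C ->
  P ([set w | B (S u w)] `&` Y t @^-1` C) = (P [set w | B (S u w)] * P (Y t @^-1` C))%E.
Proof.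
move=> SY u0 t0 mC; apply: SY; apply: sub_sigma_algebra.
  exists u; first by rewrite /= in_itv/= u0.
  (* The process is declared independent as a real one; the image of [B] is countable, hence
     Borel. *)
  exists [set k%:~R | k in B].
    apply: countable_measurable.
      by move=> x; exact: measurable_set1.
    exact: (card_le_trans (card_image_le _ _) (countableP _)).
  rewrite setTI; apply/seteqP; split => w /=.
    by move=> [k Bk /eqP]; rewrite eqr_int => /eqP <-.
  by move=> Bw; exists (S u w).
exists t; first by rewrite /= in_itv/= t0.
by exists C => //; rewrite setTI.
Qed.

End skellam_process.

(** * The time-changed process *)

Lemma ge0_integral_density_on_pos (R : realType) d (T : measurableType d)
    (P : probability T R) (Y : T -> R) (l : R -> R) (h : R -> \bar R) :
  measurable_fun setT Y -> is_density_on_pos P Y l ->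
  measurable_fun setT h -> (forall u, 0 <= h u)%E ->
  (\int[P]_w h (Y w) = \int[lebesgue_measure]_(u in `]0%R, +oo[) (h u * (l u)%:E))%E.
Proof.
move=> mY [ml l0 hl] mh h0.
pose l' (u : R) : \bar R := (if 0 < u then l u else 0)%:E.
have iE : (`]0, +oo[%classic : set R) = [set u | 0 < u].
  by apply/seteqP; split => u /=; rewrite in_itv/= andbT.
have l'E : l' = (fun u => (l u)%:E) \_ (`]0, +oo[%classic : set R).
  apply/funext => u; rewrite patchE /l' iE; case: ifPn => u0; last by rewrite memNset //=; exact/negP.
  by rewrite mem_set.
have ml' : measurable_fun setT l'.
  rewrite l'E; apply/(measurable_restrictT _ _).1; first exact: measurable_itv.
  exact/measurable_EFinP.
have l'0 u : (0 <= l' u)%E.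
  by rewrite lee_fin; case: ifPn => // u0; exact: l0.
have mc : measurable_fun setT (cst 1%E : T -> \bar R) by [].
have c0 (w : T) : (0 <= (cst 1%E : T -> \bar R) w)%E by exact: lee01.
pose M1 : {measure set (measurableTypeR R) -> \bar R} :=
  @weighted_law _ _ T (measurableTypeR R) R P (cst 1%E) Y c0 mc mY.
pose M2 : {measure set (measurableTypeR R) -> \bar R} :=
  @weighted_measure _ (measurableTypeR R) R lebesgue_measure l' l'0 ml'.
transitivity (\int[M1]_u h u)%E.
  transitivity (\int[P]_w (cst 1%E w * h (Y w)))%E.
    by apply: eq_integral => w _; rewrite mul1e.
  by symmetry; exact: (@ge0_integral_weighted_law _ _ T (measurableTypeR R) R P _ Y c0 mc mY).
transitivity (\int[M2]_u h u)%E.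
  apply: eq_measure_integral => B mB _.
  transitivity (P (Y @^-1` B)).
    rewrite [LHS](weighted_lawE P c0 mc mY) integral_cst ?mul1e//.
    by rewrite -[X in measurable X]setTI; have := mY measurableT B mB; apply.
  rewrite hl// integral_mkcondr -l'E; exact: erefl.
rewrite [LHS](@ge0_integral_weighted_measure _ (measurableTypeR R) R lebesgue_measure l' l'0 ml')//.
rewrite [RHS]integral_mkcond; apply: eq_integral => u _; rewrite l'E !patchE.
by case: ifP; rewrite ?mul0e// muleC.
Qed.

Section time_changed_skellam.
Context (R : realType) d (T : measurableType d) (P : probability T R).
Variable nubar : {measure set (measurableTypeR R) -> \bar R}.
Hypothesis hmin : levy_integrable nubar.
Hypothesis hinf : nubar `]0, +oo[%classic = +oo%E.
Hypothesis hac : forall a b : R, 0 < a -> a <= b ->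
  abs_continuous_on a b (levy_tail nubar).
Variables (H : R -> T -> R) (l : R -> R -> R).
Hypothesis hH : is_subordinator P H.
Hypothesis laplaceH : forall t x : R, 0 <= t -> 0 < x ->
  'E_P[fun w => expR (- (x * H t w))]%E = (expR (- (t * bernstein nubar x)))%:E.
Hypothesis hl : forall t : R, 0 < t ->
  is_density_on_pos P (inverse_process H t) (l t).
Variables (lambda1 lambda2 : R) (N1 N2 : R -> T -> nat).
Hypotheses (l10 : 0 < lambda1) (l20 : 0 < lambda2).
Hypotheses (hN1 : is_poisson_process P lambda1 N1) (hN2 : is_poisson_process P lambda2 N2).
Hypothesis N12 : independent_processes P (fun t w => (N1 t w)%:R) (fun t w => (N2 t w)%:R).

Notation Y := (inverse_process H).
Let S (u : R) (w : T) : int := (N1 u w)%:Z - (N2 u w)%:Z.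
Let Z (t : R) (w : T) : int := S (Y t w) w.
Hypothesis SY : independent_processes P (fun t w => (S t w)%:~R) Y.
Notation nu := (levy_tail nubar).
Notation K := (centered_flow H).
Notation wgt := (skellam_weight lambda1 lambda2).

Let hK : subordinator_flow P (bernstein nubar) K := centered_flowP hH laplaceH.
Let hY : first_passage_family P K Y := inverse_first_passage hmin hinf hH laplaceH hl.

Let mS u (B : set int) : 0 <= u -> measurable [set w | B (S u w)].
Proof. exact: skellam_process_measurable hN1 hN2 u B. Qed.

Let rcS w u : 0 <= u -> \forall s \near u^'+, S s w = S u w.
Proof. exact: skellam_process_right_constant hN1 hN2 w u. Qed.

Let Y0 t w : 0 <= Y t w := passage_ge0 hY t w.

Let mY t : 0 <= t -> measurable_fun setT (Y t) := fun t0 => passage_measurable hY t0.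

Let SYt t : 0 <= t -> forall u (B : set int) (C : set R), 0 <= u -> measurable C ->
  P ([set w | B (S u w)] `&` Y t @^-1` C) = (P [set w | B (S u w)] * P (Y t @^-1` C))%E.
Proof. by move=> t0 u B C u0 mC; exact: (skellam_process_indep B SY u0 t0 mC). Qed.

Lemma time_changed_measurable t (B : set int) : 0 <= t -> measurable [set w | B (Z t w)].
Proof. by move=> t0; exact: (mixture_probability mS rcS (mY t0) (Y0 t) (SYt t0) B).1. Qed.

Let weight_eq k u : 0 <= u -> P [set w | S u w = k] = wgt k u := skellam_process_law l10 l20 hN1 hN2 N12 k (u:=u).

Let weight_fin k u : 0 <= u -> wgt k u \is a fin_num.
Proof.
by move=> u0; rewrite -weight_eq//; apply: fin_num_measure; exact: (mS (fun j => j = k)).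
Qed.

(** A real-valued version defined on the whole line, the form taken by [caputo_expectation]. *)
Let g (k : int) (u : R) : R := fine (wgt k (Num.max u 0)).

Let gE k u : 0 <= u -> (g k u)%:E = wgt k u.
Proof. by move=> u0; rewrite /g (max_idPl u0) fineK// weight_fin. Qed.

Let mg k : measurable_fun setT (g k).
Proof. by apply: measurableT_comp => //; exact: measurable_skellam_weight. Qed.

Let max0 (u : R) : 0 <= Num.max u 0. Proof. by rewrite le_max lexx orbT. Qed.

Let g0 k u : 0 <= g k u.
Proof. by rewrite fine_ge0// skellam_weight_ge0. Qed.

Let g1 k u : g k u <= 1.
Proof.
rewrite -lee_fin fineK ?weight_fin// -weight_eq//; apply: probability_le1.
exact: (mS (fun j => j = k)).
Qed.

Lemma time_changed_law k t : 0 <= t ->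
  P [set w | Z t w = k] = (\int[P]_w (g k (Y t w))%:E)%E.
Proof.
move=> t0; rewrite [LHS](mixture_probability mS rcS (mY t0) (Y0 t) (SYt t0) (fun j => j = k)).2.
by apply: eq_integral => w _; rewrite time_lawE// gE// -weight_eq.
Qed.

Lemma time_changed_density k t : 0 < t ->
  P [set w | Z t w = k] = (\int[lebesgue_measure]_(u in `]0%R, +oo[)
    (skellam_pmf lambda1 lambda2 u k * l t u)%:E)%E.
Proof.
move=> t0; rewrite (time_changed_law k (ltW t0)).
rewrite (ge0_integral_density_on_pos (mY (ltW t0)) (hl t0) (h := fun u => (g k u)%:E)); last 2 first.
- exact/measurable_EFinP.
- by move=> u; rewrite lee_fin.
apply: eq_integral => u; rewrite inE /= in_itv/= andbT => u0.
by rewrite gE ?ltW// -skellam_pmfE ?ltW// EFinM.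
Qed.

Let law_fine k t : 0 <= t -> (\int[P]_w (g k (Y t w))%:E)%E = (state_prob P Z k t)%:E.
Proof.
move=> t0; rewrite -time_changed_law// fineK//; apply: fin_num_measure.
exact: (time_changed_measurable (fun j => j = k) t0).
Qed.

Lemma time_changed_caputo k t : 0 < t ->
  caputo_djrbashian_eq nu (state_prob P Z k) t
    (lambda1 * (state_prob P Z (k - 1) t - state_prob P Z k t) -
     lambda2 * (state_prob P Z k t - state_prob P Z (k + 1) t)).
Proof.
(* The rates of entering and of leaving state k, the two nonnegative sides of the forward
   equation. *)
move=> t0; pose h1 u := lambda1 * g (k - 1) u + lambda2 * g (k + 1) u.
pose h2 u := (lambda1 + lambda2) * g k u.
have l0 : 0 <= lambda1 + lambda2 by rewrite addr_ge0// ltW.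
have mh1 : measurable_fun setT h1 by apply: measurable_funD; exact: measurable_funM.
have mh2 : measurable_fun setT h2 by exact: measurable_funM.
have h10 u : 0 <= h1 u by rewrite addr_ge0// mulr_ge0// ltW.
have h20 u : 0 <= h2 u by rewrite mulr_ge0.
have mgY j : measurable_fun setT (fun w => (g j (Y t w))%:E).
  by apply/measurable_EFinP; exact: (measurableT_comp (mg j) (mY (ltW t0))).
have gY0 j w : (0 <= (g j (Y t w))%:E)%E by rewrite lee_fin.
have -> : lambda1 * (state_prob P Z (k - 1) t - state_prob P Z k t) -
     lambda2 * (state_prob P Z k t - state_prob P Z (k + 1) t) =
    fine (\int[P]_w (h1 (Y t w))%:E)%E - fine (\int[P]_w (h2 (Y t w))%:E)%E.
  have -> : (\int[P]_w (h1 (Y t w))%:E = (lambda1 * state_prob P Z (k - 1) t +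
      lambda2 * state_prob P Z (k + 1) t)%:E)%E.
    under eq_integral do rewrite /h1 EFinD !EFinM.
    rewrite ge0_integralD//; last 4 first.
    - by move=> w _; rewrite mule_ge0// lee_fin ltW.
    - exact: emeasurable_funM.
    - by move=> w _; rewrite mule_ge0// lee_fin ltW.
    - exact: emeasurable_funM.
    rewrite !ge0_integralZl//; [|by rewrite lee_fin ltW..].
    by rewrite !law_fine ?ltW.
  have -> : (\int[P]_w (h2 (Y t w))%:E = ((lambda1 + lambda2) * state_prob P Z k t)%:E)%E.
    under eq_integral do rewrite /h2 EFinM.
    by rewrite ge0_integralZl// law_fine ?ltW.
  rewrite /=; ring.
(* The weights are probabilities, so growth rate 0 suffices, and this constant dominates [g], [h1]
   and [h2] together. *)
apply: (caputo_expectation hmin hinf hac hK hY (lexx 0) (C := 1 + lambda1 + lambda2) (g := g k) t0) => //.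
- by rewrite -addrA addr_ge0.
- by move=> u _; rewrite mul0r expR0 mulr1 (le_trans (g1 k u))// -addrA lerDl.
- move=> u _; rewrite mul0r expR0 mulr1.
  have := g1 (k - 1) u; have := g1 (k + 1) u => a b.
  rewrite -addrA (@le_trans _ _ (lambda1 + lambda2)) ?lerDr//.
  by rewrite lerD// ler_piMr// ltW.
- move=> u _; rewrite mul0r expR0 mulr1.
  by rewrite -addrA (@le_trans _ _ (lambda1 + lambda2)) ?lerDr// ler_piMr.
- move=> u u0; rewrite !gE// (skellam_weight0 l10 l20).
  have := skellam_weight_equation l10 l20 k u0.
  congr (_ + _ = _ + _)%E; apply: eq_integral => v; rewrite inE /= in_itv/= => /andP[/ltW v0 _].
    by rewrite EFinM gE.
  by rewrite EFinD !EFinM !gE.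
- by move=> y /andP[y0 _]; rewrite law_fine.
Qed.

Section mgf.
Variable theta : R.
Let eta := lambda1 + lambda2 - lambda1 * expR theta - lambda2 * expR (- theta).

Let mexp : measurable_fun setT (fun u : R => expR (- (eta * u))).
Proof. exact: measurable_expRN. Qed.

Let exp_le u : 0 <= u -> expR (- (eta * u)) <= expR (`|eta| * u).
Proof. by move=> u0; rewrite ler_expR -mulNr ler_wpM2r// -normrN ler_norm. Qed.

Lemma time_changed_mgf t : 0 <= t ->
  (\int[P]_w (expR (theta * (Z t w)%:~R))%:E = \int[P]_w (expR (- (eta * Y t w)))%:E)%E.
Proof.
move=> t0; apply: (mixture_expectation mS rcS (mY t0) (Y0 t) (SYt t0)
  (phi := fun k => expR (theta * k%:~R)) (psi := fun u => expR (- (eta * u)))).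
- by move=> k; exact: expR_ge0.
- move=> u u0; exact: skellam_process_mgf.
Qed.

Let exp_fin t : 0 <= t -> (\int[P]_w (expR (- (eta * Y t w)))%:E < +oo)%E.
Proof.
move=> t0; apply: (passage_dominated_finite hmin hinf hK hY (normr_ge0 eta) (C := 1)
  (h := fun u => expR (- (eta * u)))) => //.
- by move=> u u0; rewrite mul1r exp_le.
Qed.

Lemma time_changed_mgf_integrable t : 0 <= t ->
  P.-integrable setT (fun w => (expR (theta * (Z t w)%:~R))%:E).
Proof.
move=> t0; apply/integrableP; split.
  move=> _ C mC; rewrite setTI.
  exact: (time_changed_measurable (fun k => C (expR (theta * k%:~R))%:E) t0).
rewrite (eq_integral (fun w => (expR (theta * (Z t w)%:~R))%:E)); last first.
  by move=> w _; rewrite gee0_abs// lee_fin expR_ge0.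
by rewrite time_changed_mgf// exp_fin.
Qed.

Let mgf_fine t : 0 <= t -> (\int[P]_w (expR (- (eta * Y t w)))%:E)%E = (mgf P Z theta t)%:E.
Proof.
move=> t0; rewrite /mgf unlock fineK time_changed_mgf//.
rewrite ge0_fin_numE ?exp_fin//; apply: integral_ge0 => w _.
by rewrite lee_fin expR_ge0.
Qed.

Lemma time_changed_mgf_caputo t : 0 < t ->
  caputo_djrbashian_eq nu (mgf P Z theta) t
    ((lambda1 * (expR theta - 1) + lambda2 * (expR (- theta) - 1)) * mgf P Z theta t).
Proof.
move=> t0; pose F (u : R) := expR (- (eta * u)).
(* -eta = a - b with a and b nonnegative, so that F' = a F - b F has the required split form. *)
pose a := lambda1 * expR theta + lambda2 * expR (- theta).
pose b := lambda1 + lambda2.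
have a0 : 0 <= a by rewrite addr_ge0// mulr_ge0 ?expR_ge0// ltW.
have b0 : 0 <= b by rewrite addr_ge0// ltW.
have F0 u : 0 <= F u by exact: expR_ge0.
have mFY : measurable_fun setT (fun w => (F (Y t w))%:E).
  by apply/measurable_EFinP; exact: (measurableT_comp mexp (mY (ltW t0))).
have cF : continuous F by exact: continuous_expRN.
have intE c : 0 <= c -> (\int[P]_w (c * F (Y t w))%:E = (c * mgf P Z theta t)%:E)%E.
  move=> c0; under eq_integral do rewrite EFinM.
  rewrite ge0_integralZl//.
    by rewrite mgf_fine ?ltW.
  by move=> w _; rewrite lee_fin.
have -> : (lambda1 * (expR theta - 1) + lambda2 * (expR (- theta) - 1)) * mgf P Z theta t =
    fine (\int[P]_w (a * F (Y t w))%:E)%E - fine (\int[P]_w (b * F (Y t w))%:E)%E.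
  by rewrite !intE//= /a /b; ring.
(* [eta] may be negative and F may grow, hence the rate |eta|; the constant dominates the factors 1,
   a and b. *)
apply: (caputo_expectation hmin hinf hac hK hY (normr_ge0 eta) (C := 1 + a + b) (g := F)
  (h1 := fun u => a * F u) (h2 := fun u => b * F u) t0) => //.
- by rewrite -addrA addr_ge0// addr_ge0.
- exact: measurable_funM.
- exact: measurable_funM.
- by move=> u; rewrite mulr_ge0.
- by move=> u; rewrite mulr_ge0.
- by move=> u u0; apply: (le_trans (exp_le u0)); rewrite ler_peMl ?expR_ge0//; lra.
- by move=> u u0; rewrite ler_pM// ?exp_le//; lra.
- by move=> u u0; rewrite ler_pM// ?exp_le//; lra.
- move=> u u0; apply: (derivative_integral_equation (F := F) (A := fun u => a * F u) (B := fun u => b * F u)) => //.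
  + move=> x; rewrite (_ : F = (fun u => 1 * expR (- (eta * u)))); last first.
      by apply/funext => v; rewrite mul1r.
    by apply: (is_derive_eq (is_derive_expRN eta 1 x)); rewrite /eta /a /b; ring.
  + by move=> x; apply: cvgMl_tmp; exact: cF.
  + by move=> x; apply: cvgMl_tmp; exact: cF.
- by move=> y /andP[y0 _]; rewrite mgf_fine.
Qed.

End mgf.

Lemma time_changed_start : P.-negligible [set w | Z 0 w <> 0].
Proof.
have hS := skellam_process_start hN1 hN2.
apply: (negligibleS _ (negligibleU hS (passage_start hY))) => w /= Zw.
have [e|/eqP e] := eqVneq (Y 0 w) 0; last by right.
by left => Sw; apply: Zw; rewrite /Z e.
Qed.

Lemma time_changed_state0 k : state_prob P Z k 0 = (k == 0)%:R.
Proof.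
rewrite /state_prob.
have mZ : measurable [set w | Z 0 w = k] by exact: (time_changed_measurable (fun j => j = k) (lexx 0)).
have [->|k0] := eqVneq k 0.
  rewrite (_ : P _ = 1%E)//= -[RHS](probability_setT P).
  apply: (measure_eq_negligible _ measurableT time_changed_start).
  - exact: (time_changed_measurable (fun j => j = 0) (lexx 0)).
  - by move=> w _; left.
  - by move=> w _; have [e|/eqP e] := eqVneq (Z 0 w) 0; [left|right].
rewrite (_ : P _ = 0%E)//= -[RHS](measure0 P).
apply: (measure_eq_negligible mZ measurable0 time_changed_start) => //.
by move=> w /= e; right => /= e0; move/eqP: k0; apply; rewrite -e.
Qed.

Lemma time_changed_mgf0 theta : mgf P Z theta 0 = 1.
Proof.
rewrite /mgf unlock.
have /integrableP[mexp _] := time_changed_mgf_integrable theta (lexx 0).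
rewrite (ae_eq_integral (cst 1%E))//.
  rewrite (integral_cst P measurableT 1%E) mul1e.
  exact: (congr1 fine (probability_setT P)).
apply: (negligibleS _ time_changed_start) => w /= h e; apply: h => _.
by rewrite e mulr0 expR0.
Qed.

End time_changed_skellam.

Theorem theorem4 (R : realType) (d : measure_display) (T : measurableType d)
    (P : probability T R)
    (nubar : {measure set (measurableTypeR R) -> \bar R})
    (H : R -> T -> R) (l : R -> R -> R)
    (lambda1 lambda2 : R) (N1 N2 : R -> T -> nat) :
  let nu := levy_tail nubar in
  let Y := inverse_process H in
  let S := fun (t : R) (w : T) => (N1 t w)%:Z - (N2 t w)%:Z in
  let Z := fun (t : R) (w : T) => S (Y t w) w in
  let r := state_prob P Z in
  let L := mgf P Z in
  let ltilde := fun t eta : R => 'E_P[fun w => expR (- (eta * Y t w))]%E in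
  (\int[nubar]_(s in `]0%R, +oo[) (Num.min s 1)%:E < +oo)%E ->
  nubar `]0, +oo[%classic = +oo%E ->
  (forall a b : R, 0 < a -> a <= b -> abs_continuous_on a b nu) ->
  is_subordinator P H ->
  (forall t x : R, 0 <= t -> 0 < x ->
    'E_P[fun w => expR (- (x * H t w))]%E =
    (expR (- (t * bernstein nubar x)))%:E) ->
  (forall t : R, 0 < t -> is_density_on_pos P (Y t) (l t)) ->
  0 < lambda1 -> 0 < lambda2 ->
  is_poisson_process P lambda1 N1 ->
  is_poisson_process P lambda2 N2 ->
  independent_processes P (fun t w => (N1 t w)%:R) (fun t w => (N2 t w)%:R) ->
  independent_processes P (fun t w => (S t w)%:~R) Y ->
  ([/\ forall (k : int) (u : R), 0 <= u ->
         P [set w | S u w = k] = (skellam_pmf lambda1 lambda2 u k)%:E,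
       forall (k : int) (t : R), 0 < t ->
         P [set w | Z t w = k] =
         (\int[lebesgue_measure]_(u in `]0%R, +oo[)
            (skellam_pmf lambda1 lambda2 u k * l t u)%:E)%E,
       forall (k : int) (t : R), 0 < t ->
         caputo_djrbashian_eq nu (r k) t
           (lambda1 * (r (k - 1) t - r k t) -
            lambda2 * (r k t - r (k + 1) t)) &
       r 0 0 = 1 /\ forall k : int, k != 0 -> r k 0 = 0] /\
   [/\ forall theta t : R, 0 <= t ->
         P.-integrable [set: T] (fun w => (expR (theta * (Z t w)%:~R))%:E),
       forall theta t : R, 0 <= t ->
         'E_P[fun w => expR (theta * (Z t w)%:~R)]%E =
         ltilde t (lambda1 + lambda2 - lambda1 * expR theta
                   - lambda2 * expR (- theta)),
       forall theta t : R, 0 < t ->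
         caputo_djrbashian_eq nu (L theta) t
           ((lambda1 * (expR theta - 1) + lambda2 * (expR (- theta) - 1)) *
            L theta t) &
       forall theta : R, L theta 0 = 1]).
Proof.
move=> nu Y S Z r L ltilde hmin hinf hac hH laplaceH hl l10 l20 hN1 hN2 N12 SY.
split; split.
- by move=> k u u0; rewrite skellam_pmfE//; exact: skellam_process_law.
- by move=> k t t0; exact: (time_changed_density hmin hinf hH laplaceH hl l10 l20 hN1 hN2 N12 SY).
- by move=> k t t0; exact: (time_changed_caputo hmin hinf hac hH laplaceH hl l10 l20 hN1 hN2 N12 SY).
- have h := time_changed_state0 hmin hinf hH laplaceH hl hN1 hN2 SY.
  by split => [|k /negbTE k0]; rewrite /r h ?eqxx// k0.
- by move=> theta t t0; exact: (time_changed_mgf_integrable hmin hinf hH laplaceH hl l10 l20 hN1 hN2 N12 SY).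
- move=> theta t t0; rewrite /ltilde unlock.
  exact: (time_changed_mgf hmin hinf hH laplaceH hl l10 l20 hN1 hN2 N12 SY).
- by move=> theta t t0; exact: (time_changed_mgf_caputo hmin hinf hac hH laplaceH hl l10 l20 hN1 hN2 N12 SY).
- by move=> theta; exact: (time_changed_mgf0 hmin hinf hH laplaceH hl l10 l20 hN1 hN2 N12 SY).
Qed.
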